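(* Let $X_1,\dots,X_n$ be $n$ independent copies of a random vector $X\in\mathbb{R}^d$. Assume that for some known constant $\kappa$, $\sup\{\mathbb{E}(\langle\theta,X\rangle^4):\theta\in\mathbb{R}^d,\ \mathbb{E}(\langle\theta,X\rangle^2)\le1\}\le\kappa<\infty$. Let $\epsilon>0$ be any confidence parameter and let the sample size $n$ be such that $$n>\Biggl[20\sqrt{\kappa d}+\Bigl(\frac52+\frac1{2(\kappa-1)}\Bigr)\sqrt{2(\kappa-1)\bigl[\log(\epsilon^{-1})+0.73\,d\bigr]}\Biggr]^2 .$$ Consider some exponent $p\in(1,2]$ and introduce the bound $$\widetilde\gamma_+=\frac1{p+1}\Bigl(\frac{2[\log(\epsilon^{-1})+0.73\,d]}{(\kappa-1)n}\Bigr)^{p/2}\Biggl[\mathbb{E}\Bigl[\bigl((1+\widehat\delta)\|G^{-1/2}X\|^2-1\bigr)_+^{p+1}\Bigr]+\Biggl(\frac{\mathbb{E}\bigl[\bigl((1+\widehat\delta)\|G^{-1/2}X\|^2-1\bigr)_+^{2p+2}\bigr]}{n\epsilon}\Biggr)^{1/2}\Biggr]$$ $$\le\frac1{p+1}\Bigl(\frac{2[\log(\epsilon^{-1})+0.73\,d]}{(\kappa-1)n}\Bigr)^{p/2}(1+\widehat\delta)^{p+1}\Biggl[\mathbb{E}\bigl(\|G^{-1/2}X\|^{2p+2}\bigr)+\Biggl(\frac{\mathbb{E}\bigl(\|G^{-1/2}X\|^{4p+4}\bigr)}{n\epsilon}\Biggr)^{1/2}\Biggr].$$ With probability at least $1-3\epsilon$,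 for any $\theta\in\mathbb{R}^d$, $$-\frac{\widehat\delta+\gamma_-}{1+\widehat\delta}\le\frac{\overline N(\theta)}{N(\theta)}-1\le\frac{\widehat\delta+\widetilde\gamma_+}{(1-\widehat\delta)(1-\widetilde\gamma_+)_+},$$ where $$\frac{\widehat\delta+\gamma_-}{1+\widehat\delta}=\mathbf{O}(\widehat\delta),\qquad\frac{\widehat\delta+\widetilde\gamma_+}{(1-\widehat\delta)(1-\widetilde\gamma_+)_+}=\mathbf{O}_{n\to\infty}(\widehat\delta),\qquad\widehat\delta=\mathbf{O}\Biggl(\sqrt{\frac{\kappa[d+\log(\epsilon^{-1})]}{n}}\Biggr).$$
   Context: $N(\theta)=\mathbb{E}(\langle\theta,X\rangle^2)$, $\overline N(\theta)=\frac1n\sum_{i=1}^n\langle\theta,X_i\rangle^2$, $G=\mathbb{E}(XX^\top)$, $G^{-1/2}$ is the symmetric square root of the pseudo-inverse of $G$, $(z)_+=\max\{z,0\}$. $\mu=\sqrt{\frac{2(\kappa-1)}{n}[\log(\epsilon^{-1})+0.73\,d]}+6.81\sqrt{\frac{2\kappa d}{n}}$, $\widehat\delta=\frac{\mu}{1-2\mu}$, $\gamma_-=\frac{2[\log(\epsilon^{-1})+0.73\,d]}{3(\kappa-1)n}$. Convention: $0/0=1$ and $z/0=+\infty$ for $z>0$. $A=\mathbf{O}(B)$ means that there is a numerical constant $c$ such that $A\le cB$; $A=\mathbf{O}_{n\to\infty}(B)$ means that there is a numerical constant $c$ such that $\limsup_{n\to\infty}A/B\le c$.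
   Formalization: The upper bound is stated for δ̂≤1; the constant in (δ̂+γ₋)/(1+δ̂)=O(δ̂) may depend on κ₀, where 1<κ₀≤κ; the O_{n→∞} claim assumes E‖G^{-1/2}X‖^{4p+4}<∞; the last two O-claims assume log(1/ε)+0.73d≥0; κ>1 and E‖X‖²<∞ are assumed. *)

(* Defs.v *)
From HB Require Import structures.
From mathcomp Require Import all_boot all_order all_algebra.
From mathcomp Require Import all_classical all_reals all_analysis.

Set Implicit Arguments.
Unset Strict Implicit.
Unset Printing Implicit Defensive.

Import Order.TTheory GRing.Theory Num.Theory.
Import numFieldNormedType.Exports.

Local Open Scope classical_set_scope.
Local Open Scope ring_scope.

(* Column vectors with their Borel sigma-algebra. *)
Notation Rvec R d := (g_sigma_algebraType (@open 'cV[R]_d)).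

Definition inner (R : realType) (d : nat) (u v : 'cV[R]_d) : R :=
  (u^T *m v) 0 0.

(* The library norm on 'cV[R]_d is the sup norm, not the Euclidean one. *)
Definition enorm (R : realType) (d : nat) (u : 'cV[R]_d) : R :=
  Num.sqrt (inner u u).

Definition penrose (R : realType) (d : nat) (A B : 'M[R]_d) : Prop :=
  [/\ A *m B *m A = A, B *m A *m B = B,
      (A *m B)^T = A *m B & (B *m A)^T = B *m A].

(* The library's [pinvmx] is only a one-sided generalized inverse (it depends
   on the pivots of Gaussian elimination), hence a separate definition. *)
Definition moore_penrose (R : realType) (d : nat) (A : 'M[R]_d) : 'M[R]_d :=
  xget 0 [set B | penrose A B].

Definition is_sym_sqrt (R : realType) (d : nat) (A S : 'M[R]_d) : Prop :=
  [/\ S^T = S, forall u : 'cV[R]_d, 0 <= inner u (S *m u) & S *m S = A].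

(* Only meaningful for A symmetric positive semi-definite, in which case the
   square root exists and is unique. *)
Definition sym_sqrt (R : realType) (d : nat) (A : 'M[R]_d) : 'M[R]_d :=
  xget 0 [set S | is_sym_sqrt A S].

Definition pospart (R : realType) (z : R) : R := Num.max z 0.
Definition epospart (R : realType) (z : \bar R) : \bar R := maxe z 0%E.

(* Quotient with 0 / 0 = 1 and z / 0 = +oo for z > 0; the second rule is
   already that of the library since 0^-1 = +oo in \bar R. *)
Definition cdiv (R : realType) (x y : \bar R) : \bar R :=
  (if (x == 0) && (y == 0) then 1 else x / y)%E.

Section independent_copies.
Context {R : realType} {dT dV : measure_display} {T : measurableType dT}
  {V : measurableType dV} {P : probability T R} {n : nat}.

Definition mutually_independent (Xs : 'I_n -> {RV P >-> V}) : Prop :=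
  forall (J : {set 'I_n}) (B : 'I_n -> set V),
    (forall i, measurable (B i)) ->
    P (\big[setI/setT]_(i in J) (Xs i @^-1` B i)) =
    (\prod_(i in J) P (Xs i @^-1` B i))%E.

Definition iid_copies (X : {RV P >-> V}) (Xs : 'I_n -> {RV P >-> V}) : Prop :=
  mutually_independent Xs /\
  forall i (B : set V), measurable B ->
    distribution P (Xs i) B = distribution P X B.

End independent_copies.

Section gram.
Context {R : realType} {dT : measure_display} {T : measurableType dT}
  (P : probability T R) {d : nat} (X : {RV P >-> Rvec R d}).

Definition Nform (theta : 'cV[R]_d) : \bar R :=
  'E_P[fun w => (inner theta (X w) ^+ 2)%R]%E.

Definition square_integrable : Prop :=
  ('E_P[fun w => (enorm (X w) ^+ 2)%R] < +oo)%E.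

(* The entries are finite when [square_integrable] holds. *)
Definition gram : 'M[R]_d :=
  \matrix_(i, j) fine 'E_P[fun w => ((X w : 'cV[R]_d) i 0 * (X w : 'cV[R]_d) j 0)%R]%E.

Definition gram_inv_sqrt : 'M[R]_d := sym_sqrt (moore_penrose gram).

(* || G^(-1/2) X || *)
Definition whitened_norm (w : T) : R := enorm (gram_inv_sqrt *m X w).

Definition kurtosis_sup : \bar R :=
  ereal_sup [set 'E_P[fun w => (inner theta (X w) ^+ 4)%R]%E
            | theta in [set theta | (Nform theta <= 1)%E]].

End gram.

Definition empirical_Nform (R : realType) (dT : measure_display)
    (T : measurableType dT) (P : probability T R) (d n : nat)
    (Xs : 'I_n -> {RV P >-> Rvec R d}) (w : T) (theta : 'cV[R]_d) : R :=
  n%:R^-1 * \sum_(i < n) inner theta (Xs i w) ^+ 2.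

Section bounds.
Context {R : realType}.

(* Negative when eps > exp (0.73 d); the square roots and real powers of it
   used below are then junk values. *)
Definition log_term (d : nat) (eps : R) : R := ln eps^-1 + 73 / 100 * d%:R.

Definition mu_bound (d n : nat) (kappa eps : R) : R :=
  Num.sqrt (2 * (kappa - 1) / n%:R * log_term d eps)
  + 681 / 100 * Num.sqrt (2 * kappa * d%:R / n%:R).

Definition delta_hat (d n : nat) (kappa eps : R) : R :=
  mu_bound d n kappa eps / (1 - 2 * mu_bound d n kappa eps).

Definition gamma_minus (d n : nat) (kappa eps : R) : R :=
  2 * log_term d eps / (3 * (kappa - 1) * n%:R).

Definition sample_size_lb (d : nat) (kappa eps : R) : R :=
  (20 * Num.sqrt (kappa * d%:R)
   + (5 / 2 + (2 * (kappa - 1))^-1)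
     * Num.sqrt (2 * (kappa - 1) * log_term d eps)) ^+ 2.

Definition gamma_plus_factor (d n : nat) (kappa eps p : R) : R :=
  (p + 1)^-1 * (2 * log_term d eps / ((kappa - 1) * n%:R)) `^ (p / 2).

Definition lower_dev (d n : nat) (kappa eps : R) : R :=
  (delta_hat d n kappa eps + gamma_minus d n kappa eps)
  / (1 + delta_hat d n kappa eps).

Context {dT : measure_display} {T : measurableType dT}
  (P : probability T R) {d : nat} (X : {RV P >-> Rvec R d}).

(* Extended real: equal to +oo when the moments involved are infinite. *)
Definition gamma_plus_tilde (n : nat) (kappa eps p : R) : \bar R :=
  let excess w :=
    pospart ((1 + delta_hat d n kappa eps) * whitened_norm X w ^+ 2 - 1)%R in
  ((gamma_plus_factor d n kappa eps p)%:E *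
   ('E_P[fun w => (excess w `^ (p + 1))%R]
    + ('E_P[fun w => (excess w `^ (2 * p + 2))%R] / (n%:R * eps)%:E)
        `^ (2^-1)))%E.

Definition gamma_plus_majorant (n : nat) (kappa eps p : R) : \bar R :=
  ((gamma_plus_factor d n kappa eps p
    * (1 + delta_hat d n kappa eps) `^ (p + 1))%:E *
   ('E_P[fun w => (whitened_norm X w `^ (2 * p + 2))%R]
    + ('E_P[fun w => (whitened_norm X w `^ (4 * p + 4))%R] / (n%:R * eps)%:E)
        `^ (2^-1)))%E.

(* [delta_hat] may exceed 1 under the condition [sample_size_lb < n]; the factor
   [1 - delta_hat] is then negative and [upper_dev] is not an upper bound. *)
Definition upper_dev (n : nat) (kappa eps p : R) : \bar R :=
  cdiv ((delta_hat d n kappa eps)%:E + gamma_plus_tilde n kappa eps p)%E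
       ((1 - delta_hat d n kappa eps)%:E
        * epospart (1 - gamma_plus_tilde n kappa eps p))%E.

End bounds.

(* Main.v *)
From HB Require Import structures.
From mathcomp Require Import all_boot all_order all_algebra.
From mathcomp Require Import all_classical all_reals all_analysis.
From mathcomp Require Import measurable_realfun complex ring lra.
Require Import Defs.

(** The deviations of the empirical quadratic form are bounded for all theta at
    once by a PAC-Bayesian change of measure, with Gaussian perturbations in
    whitened coordinates. Write L for the logarithmic term log (1 / eps) + 0.73 d.

    Whitening. Let G be the second moment matrix, B its pseudo-inverse and S the
    square root of B. The vector X lies almost surely in the range of G, so that
    Y = S X and v = S G theta satisfy <v, Y> = <theta, X>, |v|^2 = N(theta) and
    E <v, Y>^4 <= kappa |v|^4 (whitened_coefE, whitened_fourth_moment). By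
    homogeneity it is enough to treat the v with |v|^2 = lam, for the scale
    lam = sqrt (2 L / ((kappa - 1) n)).

    Truncation. Only four moments are available, hence the exponential is
    replaced by quad u = 1 + u + u^2 / 2, for which
    E quad (sg (<v, Y>^2 - lam)) <= 1 + (kappa - 1) lam^2 / 2 with sg = 1 or -1.
    Its logarithm differs from u by a term of order 3. When sg = -1 the argument
    t is at most lam and t - lam^3 / 6 is a lower bound; when sg = 1 a lower bound
    is t - t_+^(p + 1) / (p + 1), which is where gamma_plus_tilde comes from.

    Uniformity. Perturb v into v + b eta with eta a standard Gaussian vector,
    and add to quad a penalty that compensates for the loss in the average of
    its logarithm (symmetrized_penalized_quad_ge). The average over eta of the
    normalized product of these factors over the sample does not depend on v and
    has expectation 1 by independence; outside an event of probability eps it is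
    at most 1 / eps. A translation of eta by v / b, which costs
    |v|^2 / (2 b^2) by the Cameron-Martin formula, turns this single event into a
    bound valid for every v (pac_bayes_bound). The choice of b makes the total
    at most lam mu per observation (noise_budget).

    Conclusion. One such event for each sign and a Chebyshev event for the
    empirical mean of the excess (iid_mean_upper_deviation) have a joint
    probability at least 1 - 3 eps. On them 1 - ratio <= mu + lam^2 / 6 and
    ratio - 1 <= mu + gamma_plus_tilde, and these are at most the stated bounds
    because the sample size condition forces 2 mu < 1 (lower_dev_ge,
    upper_dev_ge). The orders of magnitude are explicit inequalities, except for
    the upper deviation, where gamma_plus_tilde is of order n^(- p / 2) with
    p > 1 and hence eventually below delta_hat. *)

Set Implicit Arguments.
Unset Strict Implicit.
Unset Printing Implicit Defensive.

Import Order.TTheory GRing.Theory Num.Theory.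
Import numFieldNormedType.Exports.

Local Open Scope classical_set_scope.
Local Open Scope ring_scope.

(** * A quadratic truncation of the exponential and its logarithm *)

Section log_quad.
Context {R : realType}.
Implicit Types t u v lam : R.

Definition quad u : R := 1 + u + u ^+ 2 / 2.
Definition log_quad u : R := ln (quad u).

Lemma quad_ge_half u : 2^-1 <= quad u.
Proof. by rewrite /quad; have := sqr_ge0 (u + 1); lra. Qed.

Lemma quad_gt0 u : 0 < quad u.
Proof. by have := quad_ge_half u; lra. Qed.

Lemma is_derive_log_quad u : is_derive u 1 log_quad ((1 + u) / quad u).
Proof.
have q0 := quad_gt0 u.
have dq : is_derive u 1 quad (1 + u).
  rewrite /quad.
  apply: is_derive_eq; rewrite /= !scaler1 /GRing.scale /=; by field.
have := @is_derive1_comp _ (@ln R) quad u _ _ (is_derive1_ln q0) dq.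
by rewrite mulrC.
Qed.

Lemma le_of_derive_ge0 (f df : R -> R) (a b : R) : a <= b ->
  (forall x : R, is_derive x 1 f (df x)) ->
  (forall x, a < x < b -> 0 <= df x) -> f a <= f b.
Proof.
rewrite le_eqVlt => /predU1P[->//|ab] fd df0.
have cf : continuous f.
  move=> z; apply/differentiable_continuous/derivable1_diffP.
  by case: (fd z).
have [c cab e] := @MVT R f df a b ab (fun z _ => fd z) (continuous_subspaceT cf).
by rewrite -subr_ge0 e mulr_ge0 ?subr_ge0 ?(ltW ab)// df0.
Qed.

(** The second derivative of log_quad is at least - 1 / 4, which shows in the
    monotonicity of the difference of both sides on either side of t. *)
Lemma log_quad_tangent t u :
  log_quad t + (1 + t) / quad t * (u - t) - (u - t) ^+ 2 / 8 <= log_quad u.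
Proof.
pose c := (1 + t) / quad t.
pose f x := log_quad x - c * (x - t) + (x - t) ^+ 2 / 8.
pose df x := (1 + x) / quad x - c + (x - t) / 4.
suff : f t <= f u by rewrite /f subrr mulr0 expr0n /= -/c; lra.
have fd (x : R) : is_derive x 1 f (df x).
  have dl := is_derive_log_quad x.
  rewrite /f /df; apply: is_derive_eq; rewrite /= /GRing.scale /=; lra.
suff sgn x : 0 <= (x - t) * df x.
  case: (leP t u) => [tu|/ltW ut].
    apply: (le_of_derive_ge0 tu fd) => x /andP[tx _].
    by have := sgn x; rewrite pmulr_rge0// subr_gt0.
  rewrite -lerN2; apply: (@le_of_derive_ge0 (\- f) (\- df) _ _ ut).
  move=> x /andP[_ xt] /=; rewrite oppr_ge0.
  by have := sgn x; rewrite nmulr_rge0// subr_lt0.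
rewrite /df /c.
have qx := quad_gt0 x; have qt := quad_gt0 t.
have -> : (x - t) * ((1 + x) / quad x - (1 + t) / quad t + (x - t) / 4) =
  (x - t) ^+ 2 * (quad x * quad t * 4 - 8 * (x + t + x * t)) / (16 * quad x * quad t).
  rewrite /quad; field.
  by move: qx qt; rewrite /quad => qx qt; rewrite !gt_eqF//=; lra.
apply: mulr_ge0; last by rewrite invr_ge0 !mulr_ge0// ltW.
apply: mulr_ge0; first exact: sqr_ge0.
have -> : quad x * quad t * 4 - 8 * (x + t + x * t) =
  ((1 + x) * (1 + t) - 3) ^+ 2 + (x - t) ^+ 2 by rewrite /quad; field.
by rewrite addr_ge0 ?sqr_ge0.
Qed.

Lemma log_quad0 : log_quad 0 = 0.
Proof. by rewrite /log_quad /quad expr0n /= mul0r !addr0 ln1. Qed.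

Lemma le_log_quad_neg u : u <= 0 -> u <= log_quad u.
Proof.
move=> u0.
suff : log_quad 0 - 0 >= 0 - log_quad 0 + (u - log_quad u) by rewrite log_quad0; lra.
rewrite log_quad0 !subr0 add0r -[leRHS](subrr 0) -[X in _ <= _ - X]log_quad0.
apply: (@le_of_derive_ge0 (fun x => x - log_quad x) (fun x => 1 - (1 + x) / quad x)) => //.
  by move=> x; have dl := is_derive_log_quad x; apply: is_derive_eq.
move=> x _; rewrite subr_ge0 ler_pdivrMr ?quad_gt0// mul1r /quad.
by have := sqr_ge0 x; lra.
Qed.

Lemma log_quad_le_id u : 0 <= u -> log_quad u <= u.
Proof.
move=> u0; rewrite -subr_ge0 -[leLHS](subr0 0) -[X in _ - X]log_quad0.
apply: (@le_of_derive_ge0 (fun x => x - log_quad x) (fun x => 1 - (1 + x) / quad x)) => //.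
  by move=> x; have dl := is_derive_log_quad x; apply: is_derive_eq.
move=> x _; rewrite subr_ge0 ler_pdivrMr ?quad_gt0// mul1r /quad.
by have := sqr_ge0 x; lra.
Qed.

Lemma log_quad_ge_cubic u : 0 <= u -> u - u ^+ 3 / 6 <= log_quad u.
Proof.
move=> u0; rewrite -subr_ge0.
pose f x := log_quad x - (x - x ^+ 3 / 6).
suff : f 0 <= f u by rewrite {1}/f log_quad0 expr0n /= mul0r !subr0.
apply: (@le_of_derive_ge0 f (fun x => (1 + x) / quad x - (1 - x ^+ 2 / 2))) => //.
  move=> x; have dl := is_derive_log_quad x.
  rewrite /f; apply: is_derive_eq; rewrite /= ?scaler1 /GRing.scale /=.
  by congr (_ - (1 - _)); field.
move=> x /andP[x0 _]; rewrite subr_ge0 ler_pdivlMr ?quad_gt0// /quad.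
have := mulr_ge0 (ltW x0) (mulr_ge0 (ltW x0) (ltW x0)).
have : 0 <= x ^+ 4 by rewrite exprn_even_ge0.
by rewrite !exprS expr0; nra.
Qed.

Lemma log_quad_homo u v : 0 <= u -> u <= v -> log_quad u <= log_quad v.
Proof.
move=> u0 uv; rewrite /log_quad ler_ln ?posrE ?quad_gt0// /quad.
have : u ^+ 2 <= v ^+ 2 by rewrite ler_sqr// nnegrE// (le_trans u0).
lra.
Qed.

(** The form in which log_quad is averaged against a variable of mean t: the
    mean of a parabola only depends on two moments. The bound v <= 1 keeps the
    exponential of the parabola bounded, as ln_penalized_quad_ge requires. *)
Definition parabola_minorant (v t : R) : Prop :=
  v <= 1 /\ exists2 c : R, 0 <= c <= 1 &
    forall u : R, v + c * (u - t) - (u - t) ^+ 2 / 8 <= log_quad u.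

(** The parabola is the one of log_quad_tangent, shifted down. *)
Lemma parabola_minorant_pos v t : 0 <= t -> v <= 1 -> v <= log_quad t ->
  parabola_minorant v t.
Proof.
move=> t0 v1 vt; split => //; exists ((1 + t) / quad t).
  rewrite divr_ge0 ?(ltW (quad_gt0 _)) ?addr_ge0//=.
  by rewrite ler_pdivrMr ?quad_gt0// mul1r /quad; have := sqr_ge0 t; lra.
by move=> u; apply: le_trans (log_quad_tangent t u); rewrite !lerD2r.
Qed.

(** The slope is that of the tangent of log_quad at 0, which is also a lower
    bound of log_quad on the negative half-line. *)
Lemma parabola_minorant_neg v t : t <= 0 -> v <= t -> parabola_minorant v t.
Proof.
move=> t0 vt; split; first by rewrite (le_trans vt)// (le_trans t0).
exists 1; first by rewrite ler01 lexx.
move=> u; case: (leP u 0) => [u0|/ltW u0].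
  by apply: le_trans (le_log_quad_neg u0); have := sqr_ge0 (u - t); lra.
have := log_quad_tangent 0 u; rewrite log_quad0 subr0 /quad expr0n /= mul0r !addr0 divr1.
apply: le_trans; rewrite mul1r add0r.
have : u ^+ 2 <= (u - t) ^+ 2 by rewrite ler_sqr ?nnegrE; lra.
lra.
Qed.

Lemma parabola_minorant_lower lam t : 0 <= lam -> t <= lam ->
  parabola_minorant (t - lam ^+ 3 / 6) t.
Proof.
move=> l0 tl; have l3 : 0 <= lam ^+ 3 by rewrite exprn_ge0.
case: (leP t 0) => [t0|/ltW t0]; first by apply: parabola_minorant_neg => //; lra.
have tl3 : t ^+ 3 <= lam ^+ 3 by rewrite lerXn2r// nnegrE.
apply: parabola_minorant_pos => //; last first.
  by apply: le_trans (log_quad_ge_cubic t0); lra.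
(* on t >= 0 the minimum of t ^+ 3 - 6 t + 6 is at sqrt 2, close to 7 / 5 *)
suff : 6 * t <= t ^+ 3 + 6 by lra.
have := mulr_ge0 (sqr_ge0 (t - 7 / 5)) (addr_ge0 t0 (ler0n R 1)).
have := sqr_ge0 (t - 7 / 5).
by rewrite !exprS expr0; nra.
Qed.

Lemma parabola_minorant_upper p t : 1 < p <= 2 ->
  parabola_minorant (t - Num.max t 0 `^ (p + 1) / (p + 1)) t.
Proof.
move=> /andP[p1 p2]; have p0 : 0 < p + 1 by lra.
case: (leP t 0) => [t0|t0].
  rewrite powR0 ?gt_eqF// mul0r subr0.
  exact: parabola_minorant_neg.
have pw0 : 0 <= t `^ (p + 1) / (p + 1) by rewrite divr_ge0 ?powR_ge0// ltW.
case: (leP t 1) => t1.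
  apply: parabola_minorant_pos; [exact: ltW|lra|].
  apply: le_trans (log_quad_ge_cubic (ltW t0)); rewrite lerD2l lerN2.
  have t3 : t ^+ 3 <= t `^ (p + 1).
    by rewrite -powR_mulrn ?(ltW t0)//; apply: ger_powR; [rewrite t0|lra].
  rewrite ler_pdivlMr// (le_trans _ t3)// mulrAC ler_pdivrMr// ler_pM2l ?exprn_gt0//.
  lra.
(* beyond 1 the function t - t ^ (p + 1) / (p + 1) is at most t - t ^ 2 / 3 <= 3 / 4 *)
have t2 : t ^+ 2 / 3 <= t `^ (p + 1) / (p + 1).
  have t2 : t ^+ 2 <= t `^ (p + 1).
    by rewrite -powR_mulrn ?(ltW t0)//; apply: ler_powR; [exact: ltW|lra].
  rewrite ler_pdivlMr// (le_trans _ t2)// mulrAC ler_pdivrMr// ler_pM2l ?exprn_gt0//.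
  lra.
have t34 : t - t ^+ 2 / 3 <= 3 / 4 by have := sqr_ge0 (t - 3 / 2); lra.
apply: parabola_minorant_pos; [exact: ltW|lra|].
apply: le_trans (log_quad_homo ler01 (ltW t1)).
have := log_quad_ge_cubic ler01; rewrite expr1n; lra.
Qed.

Lemma expR1_lt3 : expR 1 < 3 :> R.
Proof.
have e8 : expR (8^-1) <= 8 / 7 :> R.
  have := expR_ge1Dx (- 8^-1 : R); rewrite expRN => h.
  by rewrite -[leLHS]invrK -[leRHS]invrK lef_pV2 ?posrE ?invr_gt0 ?expR_gt0//; lra.
have -> : expR 1 = expR (8^-1) ^+ 8 :> R by rewrite -expRM_natl; congr expR; lra.
apply: le_lt_trans (_ : (8 / 7) ^+ 8 < 3); last by rewrite !exprS expr0; lra.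
by rewrite lerXn2r// nnegrE ?expR_ge0//; lra.
Qed.

(** The truncated exponential of a centered square: w is a Gaussian
    perturbation, of variance s2, of the linear form under study, and the
    subtraction of s2 removes the bias of its square. The last term is the
    penalty, of the order of the variance of the perturbed square. *)
Definition penalized_quad (sg lam s2 w : R) : R :=
  quad (sg * (w ^+ 2 - s2 - lam)) + 40 * (s2 * w ^+ 2 + s2 ^+ 2 / 2).

Lemma penalized_quad_ge_half sg lam s2 w : 0 <= s2 ->
  2^-1 <= penalized_quad sg lam s2 w.
Proof.
move=> s0; rewrite /penalized_quad.
have := quad_ge_half (sg * (w ^+ 2 - s2 - lam)).
have := mulr_ge0 s0 (sqr_ge0 w); have := sqr_ge0 s2; lra.
Qed.

Lemma penalized_quad_gt0 sg lam s2 w : 0 <= s2 -> 0 < penalized_quad sg lam s2 w.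
Proof. by move=> /(penalized_quad_ge_half sg lam w); lra. Qed.

(** The parabola is at most v + 2 c ^ 2 <= 3, and its exponential at most
    expR 3 < 27. Hence the additive penalty pen is worth at least the factor
    1 + pen / 27 relative to that exponential. *)
Lemma ln_penalized_quad_ge v c t u pen : v <= 1 -> 0 <= c <= 1 -> 0 <= pen ->
  v + c * (u - t) - (u - t) ^+ 2 / 8 <= log_quad u ->
  v + c * (u - t) - (u - t) ^+ 2 / 8 + ln (1 + pen / 27) <= ln (quad u + pen).
Proof.
move=> v1 /andP[c0 c1] p0; set a := v + _ - _ => au.
have p27 : 0 < 1 + pen / 27 by rewrite ltr_wpDr// divr_ge0.
have a3 : a <= 3.
  have := sqr_ge0 (u - t - 4 * c); have := ler_pM c0 c0 c1 c1.
  by rewrite /a; nra.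
have ea : expR a <= 27.
  have e3 : expR 3 = expR 1 ^+ 3 :> R by rewrite -expRM_natl; congr expR; lra.
  apply: (@le_trans _ _ (expR 3)); first by rewrite ler_expR.
  rewrite e3 (_ : 27 = 3 ^+ 3); last by rewrite !exprS expr0; lra.
  by rewrite lerXn2r ?nnegrE ?expR_ge0// ltW// expR1_lt3.
rewrite -[a]expRK -lnM ?posrE ?expR_gt0// ler_ln ?posrE ?mulr_gt0 ?expR_gt0//; last first.
  by have := quad_gt0 u; lra.
have eu : expR a <= quad u by rewrite -[leRHS]lnK ?posrE ?quad_gt0// ler_expR.
have := expR_ge0 a.
have : expR a * pen <= 27 * pen by rewrite ler_wpM2r.
lra.
Qed.

Lemma small_penalty_gain (y : R) : 0 <= y <= 7 / 16 -> y <= ln (1 + 40 * y / 27).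
Proof.
move=> /andP[y0 y1].
have pos : 0 < 1 + 40 * y / 27 by lra.
rewrite -[leLHS]expRK ler_ln ?posrE ?expR_gt0//.
have e : expR y = (expR (- (y / 2))) ^- 2.
  by rewrite -exprVn -expRN opprK -expRM_natl; congr expR; lra.
have h : 1 - y / 2 <= expR (- (y / 2)) by have := expR_ge1Dx (- (y / 2)); lra.
have h0 : 0 < 1 - y / 2 by lra.
apply: (@le_trans _ _ ((1 - y / 2) ^- 2)).
  by rewrite e lef_pV2 ?posrE ?exprn_gt0 ?expR_gt0// lerXn2r// nnegrE ?ltW ?expR_gt0.
rewrite -[leLHS]mul1r ler_pdivrMr ?exprn_gt0//.
have : 0 <= y * (7 / 16 - y) by rewrite mulr_ge0// subr_ge0.
have : 0 <= y ^+ 2 * (7 / 16 - y) by rewrite mulr_ge0 ?sqr_ge0// subr_ge0.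
by rewrite !exprS expr0; nra.
Qed.

(** One of (m + x) ^+ 2 and (m - x) ^+ 2 is at least m ^+ 2, so that a symmetric
    perturbation of m keeps at least half of the penalty evaluated at m. If
    that penalty is large, it exceeds v <= 1 by itself; otherwise it pays for
    the curvature term of the parabola. *)
Lemma symmetrized_penalized_quad_ge (sg lam s2 m v : R) :
  sg ^+ 2 = 1 -> 0 <= s2 -> parabola_minorant v (sg * (m ^+ 2 - lam)) ->
  exists a b c : R, [/\ 0 <= c, v <= a + b * s2 - c * (3 * s2 ^+ 2) &
    forall x, a + b * x ^+ 2 - c * x ^+ 4 <=
      (ln (penalized_quad sg lam s2 (m + x)) +
       ln (penalized_quad sg lam s2 (m - x))) / 2].
Proof.
move=> sg1 s0 [v1 [c c01 vc]]; set t := sg * _ in vc.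
pose y := s2 * m ^+ 2 + s2 ^+ 2 / 2.
have y0 : 0 <= y by rewrite /y !(sqr_ge0, invr_ge0, addr_ge0, mulr_ge0).
pose pen w := 40 * (s2 * w ^+ 2 + s2 ^+ 2 / 2).
have pen0 w : 0 <= pen w.
  by rewrite /pen !(sqr_ge0, invr_ge0, addr_ge0, mulr_ge0).
have penm x : 40 * y <= pen (m + x) \/ 40 * y <= pen (m - x).
  case: (leP 0 (m * x)) => mx; [left|right]; rewrite /pen /y ler_pM2l// lerD2r ler_wpM2l//.
    by rewrite sqrrD; have := sqr_ge0 x; lra.
  by rewrite sqrrB; have := sqr_ge0 x; lra.
have [ybig|/ltW ysmall] := leP (7 / 16) y.
  exists 1, 0, 0; split => //; first by rewrite !mul0r addr0 subr0.
  move=> x; rewrite !mul0r addr0 subr0.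
  have big w w' : 40 * y <= pen w ->
    2 <= ln (penalized_quad sg lam s2 w) + ln (penalized_quad sg lam s2 w').
    move=> yw.
    rewrite -lnM ?posrE ?penalized_quad_gt0//.
    rewrite -[leLHS]expRK ler_ln ?posrE ?expR_gt0 ?mulr_gt0 ?penalized_quad_gt0//.
    have e2 : expR 2 <= 9 :> R.
      have -> : expR 2 = expR 1 ^+ 2 :> R by rewrite -expRM_natl; congr expR; lra.
      rewrite (_ : 9 = 3 ^+ 2); last by rewrite !exprS expr0; lra.
      by rewrite lerXn2r ?nnegrE ?expR_ge0// ltW// expR1_lt3.
    have h1 := penalized_quad_ge_half sg lam w' s0.
    have h2 : 18 <= penalized_quad sg lam s2 w.
      rewrite /penalized_quad -/(pen w).
      by have := quad_ge_half (sg * (w ^+ 2 - s2 - lam)); lra.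
    by apply: (le_trans e2); nra.
  have [/big|/big] := penm x; last first.
    by move=> /(_ (m + x)); lra.
  by move=> /(_ (m - x)); lra.
exists (v - c * sg * s2 - s2 ^+ 2 / 8 + y / 2), (c * sg - (4 * m ^+ 2 - 2 * s2) / 8), (8^-1).
split; first by rewrite invr_ge0.
  by rewrite /y; lra.
move=> x.
pose u (w : R) : R := sg * (w ^+ 2 - s2 - lam).
pose par (w : R) : R := v + c * (u w - t) - (u w - t) ^+ 2 / 8.
have lnge w : par w + ln (1 + pen w / 27) <= ln (penalized_quad sg lam s2 w).
  exact: ln_penalized_quad_ge.
have ln0 w : 0 <= ln (1 + pen w / 27) by rewrite ln_ge0// lerDl divr_ge0.
have lny w : 40 * y <= pen w -> y <= ln (1 + pen w / 27).
  move=> yw; apply: (le_trans (@small_penalty_gain y _)); first by rewrite y0.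
  rewrite ler_ln ?posrE; [by rewrite lerD2l ler_pM2r| |].
    by rewrite ltr_wpDr// divr_ge0// mulr_ge0.
  by rewrite ltr_wpDr// divr_ge0.
have avg : (par (m + x) + par (m - x)) / 2 + y / 2 =
    v - c * sg * s2 - s2 ^+ 2 / 8 + y / 2 +
    (c * sg - (4 * m ^+ 2 - 2 * s2) / 8) * x ^+ 2 - 8^-1 * x ^+ 4.
  have ut w : u w - t = sg * (w ^+ 2 - s2 - m ^+ 2) by rewrite /u /t; ring.
  by rewrite /par !ut !exprMn sg1; field.
rewrite -avg.
have := lnge (m + x); have := lnge (m - x); have := ln0 (m + x); have := ln0 (m - x).
by have [/lny|/lny] := penm x; lra.
Qed.

End log_quad.

(** * Integrals of products of independent factors *)

Section density_transfer.
Context {R : realType} {dT dV : measure_display} {T : measurableType dT}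
  {V : measurableType dV}.
Import HBNNSimple.
Local Open Scope ereal_scope.

(** The right-hand side only involves the masses of the preimages by phi under
    the density h, which is what makes ge0_integral_density_ext possible. *)
Lemma ge0_integral_comp_density_lim (mu : {measure set T -> \bar R})
    (phi : T -> V) (h : T -> R) (f : V -> \bar R) (mf : measurable_fun setT f) :
  measurable_fun setT phi -> measurable_fun setT h ->
  (forall x, (0 <= h x)%R) -> (forall y, 0 <= f y) ->
  \int[mu]_x (f (phi x) * (h x)%:E) =
  limn (fun n => \sum_(k \in range (nnsfun_approx measurableT mf n))
    (k%:E * \int[mu]_(x in phi @^-1` (nnsfun_approx measurableT mf n @^-1` [set k]))
              (h x)%:E)).
Proof.
move=> mphi mh h0 f0; set f_ := nnsfun_approx measurableT mf.
have mpre n k : measurable (phi @^-1` (f_ n @^-1` [set k])).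
  by rewrite -[X in measurable X]setTI; apply: mphi.
transitivity (limn (fun n => \int[mu]_x ((f_ n (phi x))%:E * (h x)%:E))).
  rewrite -monotone_convergence//.
  - apply: eq_integral => x _; apply/esym/cvg_lim => //.
    apply: cvgeZr => //.
    exact: (@cvg_nnsfun_approx _ V R setT measurableT f mf (fun y _ => f0 y) (phi x) I).
  - move=> n; apply/measurable_EFinP/measurable_funM => //.
    exact: measurableT_comp.
  - by move=> n x _; rewrite lee_fin mulr_ge0.
  - move=> x _ m n mn; rewrite lee_fin ler_wpM2r//.
    exact/lefP/nd_nnsfun_approx.
congr (limn _); apply/funext => n.
transitivity (\int[mu]_x (\sum_(k \in range (f_ n))
    (k%:E * ((h x)%:E * (\1_(phi @^-1` (f_ n @^-1` [set k])) x)%:E)))).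
  apply: eq_integral => x _; rewrite -EFinM fimfunE fsbig_finite//=.
  rewrite mulr_suml -sumEFin [RHS]fsbig_finite//=; apply: eq_bigr => k _.
  by rewrite -!EFinM mulrAC mulrA.
rewrite ge0_integral_fsum//; last 2 first.
- move=> k; apply/measurable_EFinP.
  by apply: measurable_funM => //; apply: measurable_funM.
- move=> k x _; have [->|kf] := eqVneq (\1_(phi @^-1` (f_ n @^-1` [set k])) x : R)%R 0%R.
    by rewrite mule0 mule0.
  have kf' : f_ n (phi x) = k.
    by move: kf; rewrite indicE; case: (boolP (x \in _)) => [/set_mem//|]; rewrite eqxx.
  by rewrite -kf' !mule_ge0 ?lee_fin.
apply: eq_fsbigr => k kf.
have [y _ yk] := set_mem kf.
rewrite ge0_integralZl//.
- by congr (_ * _); rewrite [RHS]integral_mkcond; apply: eq_integral => x _; rewrite patchE indicE; case: ifP => _; rewrite ?mule1 ?mule0.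
- by apply/measurable_EFinP/measurable_funM.
- by move=> x _; rewrite mule_ge0 ?lee_fin.
- by rewrite lee_fin -yk.
Qed.

End density_transfer.

Section density_ext.
Import HBNNSimple.

(** Two densities that give the same mass to all preimages of measurable sets
    integrate all nonnegative functions alike. *)
Lemma ge0_integral_density_ext {R : realType} {d1 d2 dV : measure_display}
    {T1 : measurableType d1} {T2 : measurableType d2} {V : measurableType dV}
    (mu1 : {measure set T1 -> \bar R}) (mu2 : {measure set T2 -> \bar R})
    (phi1 : T1 -> V) (phi2 : T2 -> V) (h1 : T1 -> R) (h2 : T2 -> R)
    (f : V -> \bar R) :
  measurable_fun setT phi1 -> measurable_fun setT phi2 ->
  measurable_fun setT h1 -> measurable_fun setT h2 ->
  (forall x, 0 <= h1 x) -> (forall x, 0 <= h2 x) ->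
  (forall B, measurable B -> \int[mu1]_(x in phi1 @^-1` B) (h1 x)%:E =
     \int[mu2]_(x in phi2 @^-1` B) (h2 x)%:E)%E ->
  measurable_fun setT f -> (forall y, 0 <= f y)%E ->
  (\int[mu1]_x (f (phi1 x) * (h1 x)%:E) = \int[mu2]_x (f (phi2 x) * (h2 x)%:E))%E.
Proof.
move=> mp1 mp2 mh1 mh2 h10 h20 eqB mf f0.
rewrite (ge0_integral_comp_density_lim _ mf)// (ge0_integral_comp_density_lim _ mf)//.
congr (limn _); apply/funext => n; apply: eq_fsbigr => k _.
by congr (_ * _)%E; apply: eqB.
Qed.
End density_ext.

Section independent_product.
Context {R : realType} {dT dV : measure_display} {T : measurableType dT}
  {V : measurableType dV} {P : probability T R} {n : nat}
  (Xs : 'I_n -> {RV P >-> V}).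
Hypothesis indep : mutually_independent Xs.

Let comp_measurable (g : V -> R) i : measurable_fun setT g ->
  measurable_fun setT (fun w => g (Xs i w)).
Proof. by move=> mg; apply: measurableT_comp. Qed.

Let integral_indic_comp i (B : set V) : measurable B ->
  (\int[P]_w (\1_B (Xs i w))%:E = P (Xs i @^-1` B))%E.
Proof.
move=> mB; have mpre : measurable (Xs i @^-1` B).
  by rewrite -[X in measurable X]setTI; apply: measurable_funP.
transitivity (\int[P]_w (\1_(Xs i @^-1` B) w)%:E)%E; last by rewrite integral_indic// setIT.
by apply: eq_integral.
Qed.

(** The product rule is moved from indicators to functions one coordinate at a
    time: with the other factors fixed, both sides are measures in the set
    whose indicator stands at coordinate k. *)
Lemma independent_integral_prod_mixed (k : nat) (g : 'I_n -> V -> R) (e : 'I_n -> R) :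
  (forall i, measurable_fun setT (g i)) -> (forall i x, 0 <= g i x) ->
  (forall i, \int[P]_w (g i (Xs i w))%:E = (e i)%:E)%E ->
  (forall i : 'I_n, (k <= i)%N -> exists2 B, measurable B & g i = \1_B) ->
  (\int[P]_w (\prod_(i < n) g i (Xs i w))%:E = (\prod_(i < n) e i)%:E)%E.
Proof.
elim: k g e => [|k IH] g e mg g0 ge gB.
  have /choice[B hB] : forall i, exists B, measurable B /\ g i = \1_B.
    by move=> i; have [B] := gB i (leq0n _); exists B.
  have mB i : measurable (B i) by have [] := hB i.
  have mpre i : measurable (Xs i @^-1` B i).
    by rewrite -[X in measurable X]setTI; apply: measurable_funP.
  set A := \big[setI/setT]_(i in [set: 'I_n]%SET) (Xs i @^-1` B i).
  have mA : measurable A by apply: bigsetI_measurable.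
  have prodA w : \prod_(i < n) g i (Xs i w) = \1_A w.
    rewrite /A (big_morph (fun D : set T => \1_D w : R) (id1 := 1) (op1 := *%R)); last 2 first.
    - by move=> D D'; rewrite indicI.
    - by rewrite indicT.
    apply: eq_big => [i|i _]; first by rewrite inE.
    by case: (hB i) => _ ->; rewrite !indicE.
  under eq_integral do rewrite prodA.
  rewrite integral_indic// setIT.
  apply: (etrans (indep [set: 'I_n]%SET mB)); rewrite (big_morph _ (@EFinM R) erefl).
  apply: eq_big => [i|i _]; first by rewrite inE.
  by rewrite -ge; case: (hB i) => _ ->; apply/esym/integral_indic_comp.
case: (ltnP k n) => [kn|nk]; last first.
  apply: IH => // i ki; have := ltn_ord i; by rewrite ltnNge (leq_trans nk ki).
pose j := Ordinal kn.
pose c := \prod_(i < n | i != j) e i.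
pose h w := \prod_(i < n | i != j) g i (Xs i w).
have mh : measurable_fun setT h.
  have -> : h = fun w => \prod_(i < n) (if i != j then g i (Xs i w) else 1).
    by apply/funext => w; rewrite /h big_mkcond.
  by apply: measurable_prod => i _; case: (i != j) => //; apply: comp_measurable.
have h0 w : 0 <= h w by apply: prodr_ge0.
have c0 : 0 <= c.
  apply: prodr_ge0 => i _; rewrite -lee_fin -ge.
  by apply: integral_ge0 => w _; rewrite lee_fin.
have := @ge0_integral_density_ext R _ _ _ _ _ _ P P (Xs j) (Xs j) h (cst c)
   (EFin \o g j).
rewrite /=.
have -> : (\int[P]_w ((g j (Xs j w))%:E * c%:E) = (e j * c)%:E)%E.
  rewrite ge0_integralZr//=.
  - by rewrite ge EFinM.
  - by apply/measurable_EFinP; apply: comp_measurable.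
  - by move=> w _; rewrite lee_fin.
move=> H; rewrite [in RHS](bigD1 j)//= -/c -H//.
- by apply: eq_integral => w _; rewrite (bigD1 j)//= EFinM.
- move=> B mB.
  pose g' i := if i == j then \1_B else g i.
  pose e' i := if i == j then fine (P (Xs j @^-1` B)) else e i.
  have mpre : measurable (Xs j @^-1` B).
    by rewrite -[X in measurable X]setTI; apply: measurable_funP.
  have gB' : (\int[P]_w (g' j (Xs j w))%:E = P (Xs j @^-1` B))%E.
    by rewrite /g' eqxx integral_indic_comp.
  have pe' : \prod_(i < n) e' i = fine (P (Xs j @^-1` B)) * c.
    rewrite (bigD1 j)//= {1}/e' eqxx; congr (_ * _); apply: eq_bigr => i /negbTE ij.
    by rewrite /e' ij.
  have := IH g' e'; rewrite pe' => IH'.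
  transitivity (\int[P]_w (\prod_(i < n) g' i (Xs i w))%:E)%E.
    rewrite integral_mkcond; apply: eq_integral => w _; rewrite patchE.
    have -> : \prod_(i < n) g' i (Xs i w) = \1_B (Xs j w) * h w.
      rewrite (bigD1 j)//= {1}/g' eqxx; congr (_ * _); apply: eq_bigr => i /negbTE ij.
      by rewrite /g' ij.
    rewrite indicE; have -> : (w \in Xs j @^-1` B) = (Xs j w \in B).
      by apply/idP/idP => /set_mem ?; apply/mem_set.
    by case: ifP => _; rewrite ?mul1r ?mul0r.
  rewrite IH'.
  + rewrite integral_cst// EFinM fineK ?fin_num_measure//; exact: muleC.
  + by move=> i; rewrite /g'; case: ifP.
  + by move=> i x; rewrite /g'; case: ifP => // _; rewrite indicE.
  + move=> i; rewrite /g' /e'; case: eqP => [->|_]; last exact: ge.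
    by rewrite fineK ?fin_num_measure// -gB' /g' eqxx.
  + move=> i ki; rewrite /g'; case: eqP => [_|/eqP ij]; first by exists B.
    by apply: gB; rewrite ltn_neqAle ki andbT; apply: contra ij => /eqP ij; apply/eqP/val_inj.
- exact/measurable_EFinP.
- by move=> y; rewrite lee_fin.
Qed.

Lemma independent_integral_prod (g : 'I_n -> V -> R) (e : 'I_n -> R) :
  (forall i, measurable_fun setT (g i)) -> (forall i x, 0 <= g i x) ->
  (forall i, \int[P]_w (g i (Xs i w))%:E = (e i)%:E)%E ->
  (\int[P]_w (\prod_(i < n) g i (Xs i w))%:E = (\prod_(i < n) e i)%:E)%E.
Proof.
move=> mg g0 ge; apply: (@independent_integral_prod_mixed n) => // i.
by rewrite leqNgt ltn_ord.
Qed.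
End independent_product.

(** * Events of large probability and empirical means *)

Section events.
Context {R : realType} {dT : measure_display} {T : measurableType dT}
  (P : probability T R).

(** Markov's inequality in a form that includes c = 0, where it says that Q
    vanishes almost surely. *)
Lemma markov_event (Q : T -> \bar R) (c eps : R) :
  measurable_fun setT Q -> (forall w, 0 <= Q w)%E -> 0 <= c -> 0 <= eps ->
  (\int[P]_w Q w <= (eps * c)%:E)%E ->
  exists A, [/\ measurable A, ((1 - eps)%:E <= P A)%E & forall w, A w -> (Q w <= c%:E)%E].
Proof.
move=> mQ Q0 c0 eps0 IQ; pose B := [set w | c%:E < Q w]%E.
have mB : measurable B by rewrite -[B]setTI; exact: emeasurable_fun_o_infty.
have absQ : (\int[P]_w `|Q w| = \int[P]_w Q w)%E.
  by apply: eq_integral => w _; rewrite gee0_abs.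
exists (~` B); split; first exact: measurableC; last first.
  by move=> w /negP; rewrite -leNgt.
rewrite probability_setC// EFinB leeB//.
move: c0; rewrite le_eqVlt => /predU1P[c0|c0].
  have : (\int[P]_w `|Q w| = 0)%E.
    by apply/eqP; rewrite absQ eq_le integral_ge0// andbT; rewrite -c0 mulr0 in IQ.
  move=> /(ae_eq_integral_abs P measurableT mQ)[N [mN PN0 sub]].
  apply: (@le_trans _ _ 0%E); last by rewrite lee_fin.
  rewrite -PN0; apply: le_measure; rewrite ?inE// => w /= h; apply: sub => /= /(_ I) Qw.
  by move: h; rewrite /B /= -c0 Qw ltxx.
apply: (@le_trans _ _ (P [set w | (c%:E <= `|Q w|)%E])).
  apply: le_measure; rewrite ?inE//.
    rewrite -[X in measurable X]setTI.
    by apply: emeasurable_fun_c_infty => //; exact: measurableT_comp.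
  by move=> w /= /ltW; rewrite gee0_abs.
have := @le_integral_abse _ _ _ P setT measurableT _ _ mQ c0.
rewrite absQ setTI => /le_trans/(_ IQ).
by rewrite mulrC EFinM lee_pmul2l// lte_fin.
Qed.

Lemma probability_setI_ge (A B : set T) (a b : R) : measurable A -> measurable B ->
  ((1 - a)%:E <= P A)%E -> ((1 - b)%:E <= P B)%E -> ((1 - (a + b))%:E <= P (A `&` B))%E.
Proof.
move=> mA mB; have mC (C : set T) e : measurable C -> ((1 - e)%:E <= P C)%E = (P (~` C) <= e%:E)%E.
  move=> mC; rewrite probability_setC// -(fineK (fin_num_measure P _ mC)) !lee_fin.
  by apply/idP/idP; lra.
rewrite !mC//; last exact: measurableI.
rewrite setCI EFinD => hA hB; apply: le_trans (leeD hA hB).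
by apply: measureU2; exact: measurableC.
Qed.

End events.

Section iid.
Context {R : realType} {dT dV : measure_display} {T : measurableType dT}
  {V : measurableType dV} {P : probability T R} {n : nat}
  {X : {RV P >-> V}} {Xs : 'I_n -> {RV P >-> V}}.
Hypothesis iid : iid_copies X Xs.

Lemma integral_iid_copy (h : V -> \bar R) i : measurable_fun setT h ->
  (forall x, 0 <= h x)%E -> (\int[P]_w h (Xs i w) = \int[P]_w h (X w))%E.
Proof.
move=> mh h0.
apply: (etrans (esym (ge0_integral_distribution (Xs i) mh h0))).
apply: (etrans _ (ge0_integral_distribution X mh h0)).
by apply: eq_measure_integral => B mB _; case: iid => _; apply.
Qed.

Variable f : V -> R.
Hypothesis mf : measurable_fun setT f.
Hypothesis f0 : forall x, 0 <= f x.
Let mfX i : measurable_fun setT (fun w => f (Xs i w)).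
Proof. exact: measurableT_comp. Qed.

Lemma iid_sum_second_moment (a b : R) :
  (\int[P]_w (f (X w))%:E = a%:E)%E -> (\int[P]_w (f (X w) ^+ 2)%:E = b%:E)%E ->
  (\int[P]_w ((\sum_(i < n) f (Xs i w)) ^+ 2)%:E =
   (n%:R * (b - a ^+ 2) + (n%:R * a) ^+ 2)%:E)%E.
Proof.
move=> fa fb; pose m i j : R := if i == j :> 'I_n then b else a ^+ 2.
have mij i j : (\int[P]_w (f (Xs i w) * f (Xs j w))%:E = (m i j)%:E)%E.
  rewrite /m; case: eqVneq => [->|ij].
    rewrite -fb -(integral_iid_copy (h := fun x => (f x ^+ 2)%:E) j).
    - by apply: eq_integral => w _; rewrite expr2.
    - by apply/measurable_EFinP; exact: measurable_funX.
    - by move=> x; rewrite lee_fin sqr_ge0.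
  have := @independent_integral_prod R _ _ _ _ P n Xs iid.1
    (fun k x => if (k == i) || (k == j) then f x else 1)
    (fun k => if (k == i) || (k == j) then a else 1).
  rewrite (bigD1 i)//= (bigD1 j) 1?eq_sym//= !eqxx orbT big1 => [|k /andP[/negbTE -> /negbTE ->]//].
  rewrite mulr1 expr2 => <-.
  - apply: eq_integral => w _; rewrite (bigD1 i)//= (bigD1 j) 1?eq_sym//= !eqxx orbT.
    by rewrite big1 ?mulr1// => k /andP[/negbTE -> /negbTE ->].
  - by move=> k; case: (_ || _).
  - by move=> k x; case: (_ || _).
  - move=> k; case: (_ || _); last by rewrite integral_cst//= probability_setT mul1e.
    rewrite (integral_iid_copy (h := fun x => (f x)%:E))//; exact/measurable_EFinP.
transitivity (\int[P]_w (\sum_i \sum_j (f (Xs i w) * f (Xs j w))%:E))%E.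
  apply: eq_integral => w _; rewrite expr2 mulr_suml -sumEFin; apply: eq_bigr => i _.
  by rewrite mulr_sumr -sumEFin.
have mff i j : measurable_fun setT (fun w => (f (Xs i w) * f (Xs j w))%:E).
  by apply/measurable_EFinP; exact: measurable_funM.
have ff0 i j w : (0 <= (f (Xs i w) * f (Xs j w))%:E)%E by rewrite lee_fin mulr_ge0.
rewrite ge0_integral_sum//; last 2 first.
- by move=> i; exact: emeasurable_sum.
- by move=> i w _; exact: sume_ge0.
under eq_bigr => i _.
  rewrite ge0_integral_sum//.
  under eq_bigr do rewrite mij.
  rewrite sumEFin (bigD1 i)//= {1}/m eqxx.
  under eq_bigr => j ji do rewrite /m eq_sym (negbTE ji).
  rewrite sumr_const cardC1 card_ord.
  over.
rewrite sumEFin sumr_const card_ord; congr _%:E.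
case: (n) => [|k]; first by rewrite !mulr0n !mul0r expr0n addr0.
by rewrite -[a ^+ 2 *+ _]mulr_natl -[LHS]mulr_natl /= -natr1; ring.
Qed.

(** Chebyshev's inequality for the empirical mean, with the variance bounded by
    the second moment. *)
Lemma iid_mean_upper_deviation (eps : R) : (0 < n)%N -> 0 < eps ->
  exists A, [/\ measurable A, ((1 - eps)%:E <= P A)%E & forall w, A w ->
    ((n%:R^-1 * \sum_(i < n) f (Xs i w))%:E <= \int[P]_w (f (X w))%:E
      + (\int[P]_w (f (X w) ^+ 2)%:E / (n%:R * eps)%:E) `^ (2^-1))%E].
Proof.
move=> n0 eps0; have nR : 0 < n%:R :> R by rewrite ltr0n.
have mX : measurable_fun setT (fun w => f (X w)) by exact: measurableT_comp.
have I1 : (0 <= \int[P]_w (f (X w))%:E)%E by apply: integral_ge0 => w _; rewrite lee_fin.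
have I2 : (0 <= \int[P]_w (f (X w) ^+ 2)%:E)%E.
  by apply: integral_ge0 => w _; rewrite lee_fin sqr_ge0.
have ne0 : 0 < n%:R * eps by rewrite mulr_gt0.
case E2 : (\int[P]_w (f (X w) ^+ 2)%:E)%E I2 => [b| |]// b0; last first.
  exists setT; split => // [|w _].
    by rewrite probability_setT lee_fin; lra.
  rewrite inver gt_eqF// mulyr gtr0_sg ?invr_gt0// mul1e poweRyr ?invr_eq0//.
  by rewrite addey ?leey// gt_eqF// (lt_le_trans _ I1).
have : (\int[P]_w (f (X w))%:E < +oo)%E.
  apply: (@le_lt_trans _ _ (1 + b%:E)%E); last by rewrite -EFinD ltry.
  rewrite -E2 -[X in (X + _)%E](probability_setT P) -[P setT]mul1e -integral_cst//.
  rewrite -ge0_integralD//; last 2 first.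
  - by move=> w _; rewrite lee_fin sqr_ge0.
  - by apply/measurable_EFinP; exact: measurable_funX.
  apply: ge0_le_integral => //.
  - by move=> w _; rewrite lee_fin.
  - exact/measurable_EFinP.
  - apply: emeasurable_funD => //; apply/measurable_EFinP; exact: measurable_funX.
  - move=> w _; rewrite -EFinD lee_fin; have := sqr_ge0 (f (X w) - 1).
    by rewrite sqrrB; have := f0 (X w); lra.
case E1 : (\int[P]_w (f (X w))%:E)%E I1 => [a| |]// a0 _.
pose U w := \sum_(i < n) f (Xs i w).
have mU : measurable_fun setT U by exact: measurable_sum.
have U0 w : 0 <= U w by exact: sumr_ge0.
have IU : (\int[P]_w (U w)%:E = (n%:R * a)%:E)%E.
  under eq_integral do rewrite -sumEFin.
  rewrite ge0_integral_sum//; last 2 first.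
  - by move=> i; exact/measurable_EFinP.
  - by move=> i w _; rewrite lee_fin.
  have copy i : (\int[P]_w (f (Xs i w))%:E = a%:E)%E.
    rewrite (integral_iid_copy (h := fun x => (f x)%:E))//; exact/measurable_EFinP.
  under eq_bigr do rewrite copy.
  by rewrite sumEFin sumr_const card_ord mulr_natl.
pose s := Num.sqrt (b / (n%:R * eps)).
have s2 : s ^+ 2 = b / (n%:R * eps) by rewrite sqr_sqrtr// divr_ge0// ltW.
have na0 : 0 <= n%:R * a by rewrite mulr_ge0.
have [A [mA PA hA]] : exists A, [/\ measurable A, ((1 - eps)%:E <= P A)%E &
    forall w, A w -> (((U w - n%:R * a) ^+ 2)%:E <= ((n%:R * s) ^+ 2)%:E)%E].
  have mQ : measurable_fun setT (fun w => ((U w - n%:R * a) ^+ 2)%:E).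
    by apply/measurable_EFinP/measurable_funX/measurable_funB.
  have Q0 w : (0 <= ((U w - n%:R * a) ^+ 2)%:E)%E by rewrite lee_fin sqr_ge0.
  apply: markov_event => //; [exact: sqr_ge0|exact: ltW|].
  (* the square is expanded in such a way that all integrands are nonnegative *)
  have eqI : (\int[P]_w ((U w - n%:R * a) ^+ 2)%:E + (2 * (n%:R * a))%:E * \int[P]_w (U w)%:E =
     \int[P]_w (U w ^+ 2)%:E + \int[P]_w ((n%:R * a) ^+ 2)%:E)%E.
    rewrite -ge0_integralZl_EFin//; last 3 first.
    - by move=> w _; rewrite lee_fin.
    - exact/measurable_EFinP.
    - by rewrite mulr_ge0.
    rewrite -ge0_integralD//; last 2 first.
    - by move=> w _; rewrite -EFinM lee_fin !mulr_ge0.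
    - by apply: emeasurable_funM => //; exact/measurable_EFinP.
    rewrite -ge0_integralD//; last 3 first.
    - by move=> w _; rewrite lee_fin sqr_ge0.
    - by apply/measurable_EFinP; exact: measurable_funX.
    - by move=> w _; rewrite lee_fin sqr_ge0.
    by apply: eq_integral => w _; rewrite -EFinM -!EFinD; congr _%:E; ring.
  move: eqI; rewrite IU (iid_sum_second_moment E1 E2) integral_cst//= probability_setT mule1.
  have : (0 <= \int[P]_w ((U w - n%:R * a) ^+ 2)%:E)%E by apply: integral_ge0.
  case: (\int[P]_w _)%E => [q| |]// q0; rewrite -!EFinM -!EFinD => -[eqI].
  rewrite lee_fin exprMn s2 (_ : eps * _ = n%:R * b); last by field; rewrite !gt_eqF.
  have := sqr_ge0 a; have : 0 <= n%:R * a ^+ 2 by rewrite mulr_ge0// sqr_ge0.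
  by move: eqI; rewrite !expr2; lra.
exists A; split => // w /hA.
rewrite lee_fin inver gt_eqF// -EFinM poweR_EFin -EFinD lee_fin powR12_sqrt; last first.
  by rewrite divr_ge0// ltW.
rewrite -/s -/(U w) => h.
rewrite ler_pdivrMl// mulrDr -lerBlDl.
have ns : 0 <= n%:R * s by rewrite mulr_ge0// sqrtr_ge0.
rewrite (le_trans (ler_norm _))// -(ger0_norm ns) -ler_sqr ?nnegrE// !real_normK// ?num_real//.
Qed.

End iid.

(** * The standard normal law on the line *)

Section standard_normal.
Context {R : realType}.
Local Notation mu := (@lebesgue_measure R).
Local Notation gamma := (@normal_prob R 0 1).
Local Notation phi := (@normal_pdf R 0 1).
Implicit Types (f : R -> \bar R) (s t x : R).

Lemma normal_pdf01E x : phi x = (Num.sqrt (pi *+ 2))^-1 * expR (- x ^+ 2 / 2).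
Proof.
rewrite normal_pdfE ?oner_neq0// /normal_peak /normal_fun.
by rewrite expr1n mul1r subr0.
Qed.

Lemma ge0_integral_normal_prob f : measurable_fun setT f -> (forall x, (0 <= f x)%E) ->
  (\int[gamma]_x f x = \int[mu]_x (f x * (phi x)%:E))%E.
Proof.
move=> mf f0.
have := @ge0_integral_density_ext R _ _ _ _ _ _ gamma mu idfun idfun (cst 1) phi f.
move=> <-//.
- by apply: eq_integral => x _; rewrite mule1.
- exact: measurable_id.
- exact: measurable_id.
- exact: measurable_normal_pdf.
- exact: normal_pdf_ge0.
- move=> B mB; rewrite -[RHS]/(gamma B) -[RHS]mul1e.
  exact: (integral_cst gamma mB 1%E).
Qed.

Lemma lebesgue_measure_shift t (A : set R) : measurable A ->
  pushforward mu ((fun x => x + t) : _ -> measurableTypeR R) A = mu A.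
Proof.
move=> mA.
have ms : measurable_fun setT ((fun x => x + t) : R -> measurableTypeR R).
  exact: measurable_funD.
pose sh : {mfun R >-> measurableTypeR R} := HB.pack ((fun x => x + t) : R -> measurableTypeR R) (isMeasurableFun.Build _ _ _ _ _ ms).
apply/esym/(@lebesgue_measure_unique R (pushforward mu sh)) => //= _ [[a b]] _ <-.
rewrite /pushforward /=.
have -> : (fun x => x + t) @^-1` `]a, b]%classic = `](a - t), (b - t)]%classic.
  by apply/seteqP; split => x /=; rewrite !in_itv/= ltrBlDr lerBrDr.
rewrite !lebesgue_measure_itv/= !lte_fin ltrD2r -!EFinB; case: ifP => // _.
by congr (_%:E); ring.
Qed.

Lemma ge0_integral_shift t f : measurable_fun setT f -> (forall x, (0 <= f x)%E) ->
  (\int[mu]_x f (x + t)%R = \int[mu]_x f x)%E.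
Proof.
move=> mf f0.
pose sh : measurableTypeR R -> measurableTypeR R := fun x => x + t.
have ms : measurable_fun setT sh by exact: measurable_funD.
apply: (etrans (esym (ge0_integral_pushforward ms mu measurableT mf (fun y _ => f0 y)))).
by apply: eq_measure_integral => A mA _; exact: lebesgue_measure_shift.
Qed.

Lemma ge0_integral_opp f : measurable_fun setT f -> (forall x, (0 <= f x)%E) ->
  (\int[mu]_x f (- x)%R = \int[mu]_x f x)%E.
Proof.
move=> mf f0.
pose op : measurableTypeR R -> measurableTypeR R := -%R.
have ms : measurable_fun setT op by exact: oppr_measurable.
apply: (etrans (esym (ge0_integral_pushforward ms mu measurableT mf (fun y _ => f0 y)))).
by apply: eq_measure_integral => A mA _; exact: lebesgue_measureN.
Qed.

Lemma normal_prob_cameron_martin t f : measurable_fun setT f -> (forall x, (0 <= f x)%E) ->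
  (\int[gamma]_x (f (x + t)%R * (expR (- t * x - t ^+ 2 / 2))%:E) =
   \int[gamma]_x f x)%E.
Proof.
move=> mf f0.
have mphi := @measurable_normal_pdf R 0 1.
have mfs : measurable_fun setT (fun x => f (x + t)).
  by apply: measurableT_comp => //; exact: measurable_funD.
rewrite !ge0_integral_normal_prob//; last 2 first.
- apply: emeasurable_funM => //; apply/measurable_EFinP/measurableT_comp => //.
  by apply: measurable_funB => //; apply: measurable_funM.
- by move=> x; rewrite mule_ge0// lee_fin expR_ge0.
pose g x := (f x * (phi x)%:E)%E.
have mg : measurable_fun setT g by apply: emeasurable_funM => //; exact/measurable_EFinP.
have g0 x : (0 <= g x)%E by rewrite mule_ge0// lee_fin normal_pdf_ge0.
apply: (etrans _ (ge0_integral_shift t mg g0)).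
apply: eq_integral => x _; rewrite /g -muleA -EFinM; congr (_ * _%:E)%E.
rewrite !normal_pdf01E mulrCA -expRD; congr (_ * expR _); lra.
Qed.

Lemma normal_prob_reflection f : measurable_fun setT f -> (forall x, (0 <= f x)%E) ->
  (\int[gamma]_x f (- x)%R = \int[gamma]_x f x)%E.
Proof.
move=> mf f0; have mphi := @measurable_normal_pdf R 0 1.
rewrite !ge0_integral_normal_prob//; last first.
  by apply: measurableT_comp.
pose g x := (f x * (phi x)%:E)%E.
have mg : measurable_fun setT g by apply: emeasurable_funM => //; exact/measurable_EFinP.
have g0 x : (0 <= g x)%E by rewrite mule_ge0// lee_fin normal_pdf_ge0.
apply: (etrans _ (ge0_integral_opp mg g0)).
by apply: eq_integral => x _; rewrite /g !normal_pdf01E sqrrN.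
Qed.

Lemma normal_pdf_exp_square s x : 0 < s ->
  expR ((1 - s ^- 2) * x ^+ 2 / 2) * phi x = s * normal_pdf 0 s x.
Proof.
move=> s0; rewrite normal_pdf01E normal_pdfE ?gt_eqF// /normal_peak /normal_fun subr0.
rewrite -mulrnAr sqrtrM ?sqr_ge0// sqrtr_sqr gtr0_norm//.
set q := Num.sqrt (pi *+ 2); set E := expR (- x ^+ 2 / (s ^+ 2 *+ 2)).
rewrite mulrCA -expRD [(s * q)^-1]invfM -[s^-1 / q * E]mulrA mulVKf ?gt_eqF// /E.
congr (_ * expR _).
by field; rewrite gt_eqF.
Qed.

(** The moments of orders 2 and 4 are read off this exponential moment for s
    close to 1, which spares an integration by parts. *)
Lemma normal_prob_exp_square s : 0 < s ->
  (\int[gamma]_x (expR ((1 - s ^- 2) * x ^+ 2 / 2))%:E = s%:E)%E.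
Proof.
move=> s0; rewrite ge0_integral_normal_prob; last 2 first.
- apply/measurable_EFinP/measurableT_comp => //.
  by apply: measurable_funM => //; apply: measurable_funM => //; apply: measurable_funX.
- by move=> x; rewrite lee_fin expR_ge0.
have mN : measurable_fun setT (fun x => (normal_pdf 0 s x)%:E).
  by apply/measurable_EFinP; exact: measurable_normal_pdf.
transitivity (\int[mu]_x (s%:E * (normal_pdf 0 s x)%:E))%E; last first.
  rewrite (@ge0_integralZl _ _ _ mu setT measurableT _ mN) ?lee_fin ?ltW//.
    by rewrite integral_normal_pdf mule1.
  by move=> x _; rewrite lee_fin normal_pdf_ge0.
apply: eq_integral => x _; rewrite -!EFinM; congr _%:E.
exact: normal_pdf_exp_square.
Qed.

Lemma measurable_exprn n : measurable_fun setT (fun x : R => x ^+ n).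
Proof. exact: measurable_funX. Qed.

Local Open Scope ereal_scope.

Lemma ge0_lty_integrable d (T : measurableType d) (m : {measure set T -> \bar R})
    (g : T -> R) : measurable_fun setT g -> (forall w, 0 <= g w)%R ->
  \int[m]_w (g w)%:E < +oo -> m.-integrable setT (EFin \o g).
Proof.
move=> mg g0 gy; apply/integrableP; split; first exact/measurable_EFinP.
by rewrite (eq_integral (fun w => (g w)%:E))// => w _; rewrite gee0_abs ?lee_fin.
Qed.

Lemma normal_prob_exp_square_integrable s : (0 < s)%R ->
  gamma.-integrable setT (EFin \o (fun x => expR ((1 - s ^- 2) * x ^+ 2 / 2))).
Proof.
move=> s0; apply: ge0_lty_integrable.
- apply: measurableT_comp => //.
  by apply: measurable_funM => //; apply: measurable_funM => //; apply: measurable_exprn.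
- by move=> x; rewrite expR_ge0.
- by rewrite normal_prob_exp_square// ltry.
Qed.

Lemma expR_ge_quad (z : R) : (0 <= z -> 1 + z + z ^+ 2 / 2 <= expR z)%R.
Proof.
move=> z0; have := @log_quad_le_id R z z0.
by rewrite -ler_expR /log_quad lnK// posrE quad_gt0.
Qed.

Lemma normal_prob_integrable_exprn n : (n <= 4)%N ->
  gamma.-integrable setT (EFin \o (fun x => x ^+ n)%R).
Proof.
move=> n4; apply: (@le_integrable _ _ _ gamma setT measurableT _
   (fun x => 16%:E * (expR ((1 - 2 ^- 2) * x ^+ 2 / 2))%:E)).
- by apply/measurable_EFinP; exact: measurable_exprn.
- move=> x _; rewrite -EFinM /= lee_fin normrX.
  set z := ((1 - _) * _ / 2)%R.
  rewrite [X in (_ <= X)%R]ger0_norm ?mulr_ge0 ?expR_ge0//.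
  have z0 : (0 <= z)%R by rewrite /z; have := sqr_ge0 (x : R); lra.
  have := expR_ge_quad z0; set e := expR z => ez.
  have xz : (x ^+ 2 = 8 / 3 * z)%R by rewrite /z; field.
  have x4 : (`|x| ^+ 4 <= 15 * e)%R.
    rewrite -normrX ger0_norm ?exprn_even_ge0// (exprM x 2 2).
    by rewrite xz exprMn; have := sqr_ge0 z; lra.
  have e1 : (1 <= e)%R by have := sqr_ge0 z; lra.
  case: (leP 1%R `|x|%R) => x1.
    by apply: (@le_trans _ _ (`|x| ^+ 4)%R); [exact: ler_weXn2l|lra].
  by apply: (@le_trans _ _ 1%R); [rewrite exprn_ile1// ltW|lra].
- by apply: integrableZl => //; apply: normal_prob_exp_square_integrable.
Qed.

Local Open Scope ring_scope.
Local Notation moment n := (\int[gamma]_x (x ^+ n))%R.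

Lemma normal_prob_moment_bound s (a b : R) : 0 < s ->
  (forall x, 1 + a * x ^+ 2 + b * x ^+ 4 <= expR ((1 - s ^- 2) * x ^+ 2 / 2)) ->
  1 + a * moment 2 + b * moment 4 <= s.
Proof.
move=> s0 h.
have i2 := @normal_prob_integrable_exprn 2 isT.
have i4 := @normal_prob_integrable_exprn 4 isT.
have i1 : gamma.-integrable setT (EFin \o cst 1).
  by apply: finite_measure_integrable_cst.
have ia2 : gamma.-integrable setT (EFin \o (fun x => a * x ^+ 2)).
  by apply: (integrableZl measurableT a i2).
have ib4 : gamma.-integrable setT (EFin \o (fun x => b * x ^+ 4)).
  by apply: (integrableZl measurableT b i4).
have i12 : gamma.-integrable setT (EFin \o (fun x => 1 + a * x ^+ 2)).
  exact: (integrableD measurableT i1 ia2).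
have i124 : gamma.-integrable setT (EFin \o (fun x => 1 + a * x ^+ 2 + b * x ^+ 4)).
  exact: (integrableD measurableT i12 ib4).
have -> : s = (\int[gamma]_x (expR ((1 - s ^- 2) * x ^+ 2 / 2)))%R.
  by rewrite /Rintegral normal_prob_exp_square.
have -> : 1 + a * moment 2 + b * moment 4 =
    (\int[gamma]_x (1 + a * x ^+ 2 + b * x ^+ 4))%R.
  rewrite RintegralD// RintegralD// RintegralZl// RintegralZl//.
  by rewrite Rintegral_cst// mul1r /= probability_setT.
by apply: le_Rintegral => //; apply: normal_prob_exp_square_integrable.
Qed.

(** Divided by s - 1 on either side of s = 1, the bound for
    expR z >= 1 + z gives the two inequalities in the limit s = 1. *)
Lemma normal_prob_second_moment : moment 2 = 1.
Proof.
have bound s : 0 < s -> (1 - s ^- 2) / 2 * moment 2 <= s - 1.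
  move=> s0; have := @normal_prob_moment_bound s ((1 - s ^- 2) / 2) 0 s0.
  rewrite mul0r addr0 => h; rewrite lerBrDl; apply: h => x.
  by rewrite mul0r addr0 mulrAC; exact: expR_ge1Dx.
set v := moment 2 in bound *.
have {}bound s : 0 < s -> (s - 1) * (s + 1) * v <= (s - 1) * (2 * s ^+ 2).
  move=> s0; have := bound s s0.
  have -> : (1 - s ^- 2) / 2 * v = ((s - 1) * (s + 1) * v) / (2 * s ^+ 2).
    by field; rewrite gt_eqF.
  by rewrite ler_pdivrMr// mulr_gt0// exprn_gt0.
have v0 : 0 <= v by apply: Rintegral_ge0 => x _; exact: sqr_ge0.
apply/eqP; rewrite eq_le; apply/andP; split; apply/ler_addgt0Pr => e e0.
- pose h := Num.min 1 (e / 3).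
  have h0 : 0 < h by rewrite lt_min ltr01 divr_gt0.
  have h1 : h <= 1 by rewrite ge_min lexx.
  have he : h <= e / 3 by rewrite ge_min lexx orbT.
  have := bound (1 + h) (addr_gt0 ltr01 h0).
  rewrite (addrC 1) addrK -mulrA ler_pM2l//.
  by nra.
- pose h := Num.min 2^-1 (e / 2).
  have h0 : 0 < h by rewrite lt_min invr_gt0 ltr0n divr_gt0.
  have h1 : h <= 2^-1 by rewrite ge_min lexx.
  have he : h <= e / 2 by rewrite ge_min lexx orbT.
  have s0 : 0 < 1 - h by lra.
  have := bound (1 - h) s0.
  rewrite addrAC subrr add0r -mulrA ler_nM2l ?oppr_lt0//.
  by nra.
Qed.

(** With expR z >= 1 + z + z^2 / 2 the terms of order s - 1 cancel, and the
    bound divided by (s - 1)^2 gives moment 4 <= 3 in the limit s = 1. *)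
Lemma normal_prob_fourth_moment : moment 4 <= 3.
Proof.
have bound s : 1 < s -> 4 * moment 4 <= 4 * s ^+ 2 * (2 * s + 1).
  move=> s1; have s0 : 0 < s by rewrite (lt_trans ltr01).
  pose c := (1 - s ^- 2) / 2.
  have := @normal_prob_moment_bound s c (c ^+ 2 / 2) s0.
  rewrite normal_prob_second_moment mulr1; set k := moment 4 => h.
  have c0 : 0 <= c by rewrite divr_ge0// subr_ge0 invf_le1 ?exprn_gt0// exprn_ege1 ?ltW.
  have {}h : 1 + c + c ^+ 2 / 2 * k <= s.
    apply: h => x; have := @expR_ge_quad (c * x ^+ 2) (mulr_ge0 c0 (sqr_ge0 x)).
    by rewrite /c; congr (_ <= expR _); field; rewrite gt_eqF.
  have k0 : 0 <= k by apply: Rintegral_ge0 => x _; rewrite exprn_even_ge0.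
  have e : (s - 1) ^+ 2 / (8 * s ^+ 4) * ((s + 1) ^+ 2 * k) <=
           (s - 1) ^+ 2 / (8 * s ^+ 4) * (4 * s ^+ 2 * (2 * s + 1)).
    rewrite [leLHS](_ : _ = c ^+ 2 / 2 * k); last by rewrite /c; field; rewrite gt_eqF.
    rewrite [leRHS](_ : _ = s - 1 - c); last by rewrite /c; field; rewrite gt_eqF.
    lra.
  have p0 : 0 < (s - 1) ^+ 2 / (8 * s ^+ 4).
    by rewrite divr_gt0 ?mulr_gt0 ?exprn_gt0 ?subr_gt0.
  rewrite ler_pM2l// in e; apply: le_trans e; apply: ler_wpM2r => //.
  by have := ler_sqr (R:=R); nra.
have k0 : 0 <= moment 4 by apply: Rintegral_ge0 => x _; rewrite exprn_even_ge0.
move: (moment 4) bound k0 => k bound k0.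
apply/ler_addgt0Pr => e e0; pose h := Num.min 1 (e / 17).
have h0 : 0 < h by rewrite lt_min ltr01 divr_gt0.
have h1 : h <= 1 by rewrite ge_min lexx.
have he : h <= e / 17 by rewrite ge_min lexx orbT.
have := bound (1 + h); rewrite ltrDl => /(_ h0).
have h2 : h ^+ 2 <= h by rewrite expr2 ler_piMl// ltW.
have h3 : h ^+ 3 <= h by rewrite exprS ler_piMr ?(ltW h0)// (le_trans h2).
have -> : 4 * (1 + h) ^+ 2 * (2 * (1 + h) + 1) = 12 + 32 * h + 28 * h ^+ 2 + 8 * h ^+ 3 by ring.
lra.
Qed.

End standard_normal.

(** * The Euclidean inner product *)

Section inner_theory.
Context {R : realType} {d : nat}.
Implicit Types (u v w : 'cV[R]_d) (A : 'M[R]_d).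

Lemma innerE u v : inner u v = \sum_(i < d) u i 0 * v i 0.
Proof. by rewrite /inner !mxE; apply: eq_bigr => i _; rewrite !mxE. Qed.

Lemma innerC u v : inner u v = inner v u.
Proof. by rewrite !innerE; apply: eq_bigr => i _; rewrite mulrC. Qed.

Lemma innerDr u v w : inner u (v + w) = inner u v + inner u w.
Proof. by rewrite /inner mulmxDr mxE. Qed.

Lemma innerDl u v w : inner (v + w) u = inner v u + inner w u.
Proof. by rewrite ![inner _ u]innerC innerDr. Qed.

Lemma innerZr (a : R) u v : inner u (a *: v) = a * inner u v.
Proof. by rewrite /inner -scalemxAr mxE. Qed.

Lemma innerZl (a : R) u v : inner (a *: v) u = a * inner v u.
Proof. by rewrite ![inner _ u]innerC innerZr. Qed.

Lemma innerNr u v : inner u (- v) = - inner u v.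
Proof. by rewrite -scaleN1r innerZr mulN1r. Qed.

Lemma inner0l u : inner 0 u = 0.
Proof. by rewrite -(scale0r 0) innerZl mul0r. Qed.

Lemma inner_ge0 u : 0 <= inner u u.
Proof. by rewrite innerE sumr_ge0// => i _; rewrite -expr2 sqr_ge0. Qed.

Lemma inner_mulmx A u v : inner u (A *m v) = inner (A^T *m u) v.
Proof. by rewrite /inner trmx_mul trmxK mulmxA. Qed.

Lemma inner_delta i u : inner (delta_mx i 0) u = u i 0.
Proof.
rewrite innerE (bigD1 i)//= !mxE !eqxx mul1r big1 ?addr0// => j /negbTE ji.
by rewrite !mxE ji mul0r.
Qed.

Lemma inner_eq0 u : inner u u = 0 -> u = 0.
Proof.
move=> u0; apply/colP => i; rewrite mxE; apply/eqP; rewrite -sqrf_eq0.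
rewrite eq_le sqr_ge0 andbT -u0 innerE (bigD1 i)//= expr2 lerDl sumr_ge0// => j _.
by rewrite -expr2 sqr_ge0.
Qed.

Lemma inner_cauchy_schwarz u v :
  inner u v ^+ 2 <= inner u u * inner v v.
Proof.
have [v0|v0] := eqVneq (inner v v) 0.
  by rewrite (inner_eq0 v0) innerC !inner0l expr0n mulr0.
have vp : 0 < inner v v by rewrite lt_def v0 inner_ge0.
have := inner_ge0 (inner v v *: u + (- inner u v) *: v).
rewrite !(innerDl, innerDr) !(innerZl, innerZr) (innerC v u).
move: (inner u v) (inner u u) (inner v v) vp => a b c c0 h.
by rewrite -subr_ge0 -(pmulr_rge0 _ c0); move: h; rewrite expr2; lra.
Qed.

End inner_theory.

Lemma inner_col_mx {R : realType} {d1 d2 : nat} (u1 v1 : 'cV[R]_d1) (u2 v2 : 'cV[R]_d2) :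
  inner (col_mx u1 u2) (col_mx v1 v2) = inner u1 v1 + inner u2 v2.
Proof. by rewrite /inner tr_col_mx mul_row_col mxE. Qed.

(** * Gaussian perturbations in dimension d *)

(** A standard Gaussian vector eta of dimension d, described by what a
    perturbation argument uses: translations tau and a reflection rho of the
    underlying space act on eta, the law is invariant under rho, its translates
    have the Cameron-Martin density, and the linear forms of eta have the second
    moment, and at most the fourth moment, of a normal variable. *)
Definition gaussian_noise {R : realType} {d : nat} {dO : measure_display}
    {O : measurableType dO} (nu : probability O R) (eta : O -> 'cV[R]_d)
    (tau : 'cV[R]_d -> O -> O) (rho : O -> O) : Prop :=
  [/\ forall i, measurable_fun setT (fun o => eta o i 0),
      (forall t, measurable_fun setT (tau t)) /\ measurable_fun setT rho,
      (forall t o, eta (tau t o) = eta o + t) /\ (forall o, eta (rho o) = - eta o),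
      forall h : O -> \bar R, measurable_fun setT h -> (forall o, 0 <= h o)%E ->
        (\int[nu]_o h (rho o) = \int[nu]_o h o)%E /\
        (forall t, \int[nu]_o
            (h (tau t o) * (expR (- inner t (eta o) - inner t t / 2))%:E) =
          \int[nu]_o h o)%E
    & forall a, (\int[nu]_o (inner a (eta o) ^+ 2)%:E = (inner a a)%:E)%E /\
        (\int[nu]_o (inner a (eta o) ^+ 4)%:E <= (3 * inner a a ^+ 2)%:E)%E].

Lemma measurable_inner {R : realType} {d : nat} {dO : measure_display}
    {O : measurableType dO} (u v : O -> 'cV[R]_d) :
  (forall i, measurable_fun setT (fun o => u o i 0)) ->
  (forall i, measurable_fun setT (fun o => v o i 0)) ->
  measurable_fun setT (fun o => inner (u o) (v o)).
Proof.
move=> mu mv.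
rewrite (_ : (fun o => _) = fun o => \sum_(i < d) u o i 0 * v o i 0); last first.
  by apply/funext => o; rewrite innerE.
by apply: measurable_sum => i; apply: measurable_funM.
Qed.

Section even_polynomial.
Context {R : realType} {d : measure_display} {T : measurableType d}
  (m : probability T R) (f : T -> R).
Hypothesis i2 : m.-integrable setT (EFin \o (fun x => f x ^+ 2)).
Hypothesis i4 : m.-integrable setT (EFin \o (fun x => f x ^+ 4)).
Variables a b c : R.

Lemma integrable_even_poly :
  m.-integrable setT (EFin \o (fun x => a + b * f x ^+ 2 + c * f x ^+ 4)).
Proof.
have i1 : m.-integrable setT (EFin \o cst a) by apply: finite_measure_integrable_cst.
exact: (integrableD measurableT (integrableD measurableT i1
  (integrableZl measurableT b i2)) (integrableZl measurableT c i4)).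
Qed.

Lemma integral_even_poly :
  (\int[m]_x (a + b * f x ^+ 2 + c * f x ^+ 4)%:E =
   (a + b * (\int[m]_x (f x ^+ 2))%R + c * (\int[m]_x (f x ^+ 4))%R)%:E)%E.
Proof.
have i1 : m.-integrable setT (EFin \o cst a) by apply: finite_measure_integrable_cst.
have ib := integrableZl measurableT b i2; have ic := integrableZl measurableT c i4.
have iab := integrableD measurableT i1 ib.
rewrite -[LHS]fineK; last exact: integrable_fin_num integrable_even_poly.
congr _%:E; rewrite -/(Rintegral _ _ _) RintegralD// RintegralD// !RintegralZl//.
by rewrite Rintegral_cst//= probability_setT mulr1.
Qed.

End even_polynomial.

Section reflection.
Context {R : realType} {d : measure_display} {T : measurableType d}
  (m : {measure set T -> \bar R}) (rho : T -> T).
Hypothesis mrho : measurable_fun setT rho.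
Hypothesis inv : forall h : T -> \bar R, measurable_fun setT h ->
  (forall o, 0 <= h o)%E -> (\int[m]_o h (rho o) = \int[m]_o h o)%E.

Lemma integral_symmetrize (h : T -> R) : measurable_fun setT h -> (forall o, 0 <= h o) ->
  (\int[m]_o (h o)%:E = \int[m]_o ((h o + h (rho o)) / 2)%:E)%E.
Proof.
move=> mh h0; have mhr : measurable_fun setT (fun o => h (rho o)) by exact: measurableT_comp.
under [RHS]eq_integral do rewrite mulrC EFinM EFinD.
rewrite ge0_integralZl//; last 2 first.
- by apply: emeasurable_funD; exact/measurable_EFinP.
- by move=> x _; rewrite adde_ge0// lee_fin.
rewrite ge0_integralD//; last 4 first.
- by move=> x _; rewrite lee_fin.
- exact/measurable_EFinP.
- by move=> x _; rewrite lee_fin.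
- exact/measurable_EFinP.
rewrite (inv (h := EFin \o h)); last 2 first.
- exact/measurable_EFinP.
- by move=> o; rewrite lee_fin.
have half (x : \bar R) : (0 <= x -> x = (2^-1)%:E * (x + x))%E.
  case: x => [r| |]// _; first by congr _%:E; field.
  by rewrite gt0_muley// lte_fin invr_gt0.
by apply: half; apply: integral_ge0 => x _; rewrite lee_fin.
Qed.

End reflection.

Section gaussian_noise_prod.
Context {R : realType} {d1 d2 : nat} {dO1 dO2 : measure_display}
  {O1 : measurableType dO1} {O2 : measurableType dO2}
  (nu1 : probability O1 R) (eta1 : O1 -> 'cV[R]_d1)
  (tau1 : 'cV[R]_d1 -> O1 -> O1) (rho1 : O1 -> O1)
  (nu2 : probability O2 R) (eta2 : O2 -> 'cV[R]_d2)
  (tau2 : 'cV[R]_d2 -> O2 -> O2) (rho2 : O2 -> O2).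
Hypothesis noise1 : gaussian_noise nu1 eta1 tau1 rho1.
Hypothesis noise2 : gaussian_noise nu2 eta2 tau2 rho2.

Let eta (z : O1 * O2) : 'cV[R]_(d1 + d2) := col_mx (eta1 z.1) (eta2 z.2).
Let tau (t : 'cV[R]_(d1 + d2)) (z : O1 * O2) : O1 * O2 :=
  (tau1 (usubmx t) z.1, tau2 (dsubmx t) z.2).
Let rho (z : O1 * O2) : O1 * O2 := (rho1 z.1, rho2 z.2).

(** The cross terms of the moments are odd in one of the two blocks and are
    removed by averaging over the reflection rho2. *)
Lemma gaussian_noise_prod : gaussian_noise (nu1 \x nu2)%E eta tau rho.
Proof.
case: noise1 => meta1 [mtau1 mrho1] [etatau1 etarho1] inv1 mom1.
case: noise2 => meta2 [mtau2 mrho2] [etatau2 etarho2] inv2 mom2.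
have mtau t : measurable_fun setT (tau t).
  by apply/measurable_fun_pair => /=; apply: measurableT_comp.
have mrho : measurable_fun setT rho.
  by apply/measurable_fun_pair => /=; apply: measurableT_comp.
have inner_eta t z : inner t (eta z) =
    inner (usubmx t) (eta1 z.1) + inner (dsubmx t) (eta2 z.2).
  by rewrite -{1}[t]vsubmxK inner_col_mx.
have inner_tt (t : 'cV[R]_(d1 + d2)) :
    inner t t = inner (usubmx t) (usubmx t) + inner (dsubmx t) (dsubmx t).
  by rewrite -{1 2}[t]vsubmxK inner_col_mx.
have meta i : measurable_fun setT (fun z => eta z i 0).
  case: (splitP i) => j ij.
    rewrite (_ : (fun z => _) = fun z => eta1 z.1 j 0); last first.
      apply/funext => z; rewrite /eta (_ : i = lshift d2 j); last exact/val_inj.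
      by rewrite col_mxEu.
    exact: (measurableT_comp (meta1 j)).
  rewrite (_ : (fun z => _) = fun z => eta2 z.2 j 0); last first.
    apply/funext => z; rewrite /eta (_ : i = rshift d1 j); last exact/val_inj.
    by rewrite col_mxEd.
  exact: (measurableT_comp (meta2 j)).
split => //.
- split => [t z|z]; rewrite /eta /tau /rho /=.
    by rewrite etatau1 etatau2 -add_col_mx vsubmxK.
  by rewrite etarho1 etarho2 opp_col_mx.
- move=> h mh h0.
  have mhx x : measurable_fun setT (fun o => h (x, o)) by exact: measurableT_comp.
  have mhs : measurable_fun setT (fun x => \int[nu2]_o h (x, o))%E.
    exact: (measurable_fun_fubini_tonelli_F h).
  have hs0 x : (0 <= \int[nu2]_o h (x, o))%E by apply: integral_ge0.
  split.
    rewrite (fubini_tonelli1 (fun z => h (rho z)))//; last exact: measurableT_comp.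
    rewrite (fubini_tonelli1 h)// /fubini_F.
    have [<- _] := inv1 _ mhs hs0.
    apply: eq_integral => x _; rewrite /rho /=.
    by have [-> _] := inv2 _ (mhx (rho1 x)) (fun o => h0 _).
  move=> t.
  have mexp : measurable_fun setT (fun z => expR (- inner t (eta z) - inner t t / 2)).
    apply: measurableT_comp => //; apply: measurable_funB => //.
    by apply: measurableT_comp => //; apply: measurable_inner.
  rewrite (fubini_tonelli1 (fun z => h (tau t z) * _)%E)//; last 2 first.
  + apply: emeasurable_funM; first exact: measurableT_comp.
    exact/measurable_EFinP.
  + by move=> z; rewrite mule_ge0// lee_fin expR_ge0.
  rewrite (fubini_tonelli1 h)// /fubini_F.
  have [_ /(_ (usubmx t)) <-] := inv1 _ mhs hs0.
  apply: eq_integral => x _.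
  have [_ /(_ (dsubmx t)) <-] := inv2 _ (mhx (tau1 (usubmx t) x)) (fun o => h0 _).
  rewrite -ge0_integralZr//; last 2 first.
  + apply: emeasurable_funM.
      by apply: (measurableT_comp (mhx (tau1 (usubmx t) x))); exact: mtau2.
    apply/measurable_EFinP/measurableT_comp => //; apply: measurable_funB => //.
    by apply: measurableT_comp => //; apply: measurable_inner.
  + by move=> o _; rewrite mule_ge0// lee_fin expR_ge0.
  apply: eq_integral => o _; rewrite /tau /= -muleA -EFinM -expRD.
  congr (_ * (expR _)%:E)%E.
  by rewrite inner_eta inner_tt /=; field.
move=> a; set a1 := usubmx a; set a2 := dsubmx a.
pose xi1 o := inner a1 (eta1 o); pose xi2 o := inner a2 (eta2 o).
have pow_ge0 (c : R) : 0 <= c ^+ 4 by rewrite exprn_even_ge0.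
have mxi1 : measurable_fun setT xi1 by apply: measurable_inner.
have mxi2 : measurable_fun setT xi2 by apply: measurable_inner.
have [m2 m4] := mom2 a2; have [n2 n4] := mom1 a1.
have i2 : nu2.-integrable setT (EFin \o (fun o => xi2 o ^+ 2)).
  apply: ge0_lty_integrable; [exact: measurable_funX|by move=> o; exact: sqr_ge0|].
  by rewrite m2 ltry.
have i4 : nu2.-integrable setT (EFin \o (fun o => xi2 o ^+ 4)).
  apply: ge0_lty_integrable; [exact: measurable_funX|by move=> o|].
  by rewrite (le_lt_trans m4)// ltry.
have j2 : nu1.-integrable setT (EFin \o (fun o => xi1 o ^+ 2)).
  apply: ge0_lty_integrable; [exact: measurable_funX|by move=> o; exact: sqr_ge0|].
  by rewrite n2 ltry.
have j4 : nu1.-integrable setT (EFin \o (fun o => xi1 o ^+ 4)).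
  apply: ge0_lty_integrable; [exact: measurable_funX|by move=> o|].
  by rewrite (le_lt_trans n4)// ltry.
have e2 : (\int[nu2]_o (xi2 o ^+ 2))%R = inner a2 a2 by rewrite /Rintegral m2.
have f2 : (\int[nu1]_o (xi1 o ^+ 2))%R = inner a1 a1 by rewrite /Rintegral n2.
set k2 := (\int[nu2]_o (xi2 o ^+ 4))%R.
have k2le : k2 <= 3 * inner a2 a2 ^+ 2.
  by rewrite -lee_fin fineK//; exact: integrable_fin_num i4.
have k1le : (\int[nu1]_o (xi1 o ^+ 4))%R <= 3 * inner a1 a1 ^+ 2.
  by rewrite -lee_fin fineK//; exact: integrable_fin_num j4.
have xirho o : xi2 (rho2 o) = - xi2 o by rewrite /xi2 etarho2 innerNr.
have inv2' h : measurable_fun setT h -> (forall o, 0 <= h o)%E ->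
  (\int[nu2]_o h (rho2 o) = \int[nu2]_o h o)%E by move=> mh h0; case: (inv2 h mh h0).
have int2 c : (\int[nu2]_o ((c + xi2 o) ^+ 2)%:E =
    (c ^+ 2 + 1 * inner a2 a2 + 0 * k2)%:E)%E.
  rewrite (integral_symmetrize mrho2 inv2'); last 2 first.
  - by apply: measurable_funX; apply: measurable_funD.
  - by move=> o; exact: sqr_ge0.
  rewrite -e2 -(integral_even_poly i2 i4); apply: eq_integral => o _.
  by rewrite xirho; congr _%:E; field.
have int4 c : (\int[nu2]_o ((c + xi2 o) ^+ 4)%:E =
    (c ^+ 4 + 6 * c ^+ 2 * inner a2 a2 + 1 * k2)%:E)%E.
  rewrite (integral_symmetrize mrho2 inv2')//; last first.
    by apply: measurable_funX; apply: measurable_funD.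
  rewrite -e2 -(integral_even_poly i2 i4); apply: eq_integral => o _.
  by rewrite xirho; congr _%:E; field.
have minner : measurable_fun setT (fun z => inner a (eta z)) by apply: measurable_inner.
split.
  rewrite (fubini_tonelli1 (fun z => (inner a (eta z) ^+ 2)%:E)); last 2 first.
  + by apply/measurable_EFinP; exact: measurable_funX.
  + by move=> z; rewrite lee_fin sqr_ge0.
  transitivity (\int[nu1]_x (inner a2 a2 + 1 * xi1 x ^+ 2 + 0 * xi1 x ^+ 4)%:E)%E.
    apply: eq_integral => x _; rewrite /fubini_F.
    under eq_integral do rewrite inner_eta /=.
    by rewrite int2 -/(xi1 x); congr _%:E; ring.
  rewrite (integral_even_poly j2 j4) f2 inner_tt.
  by congr _%:E; ring.
rewrite (fubini_tonelli1 (fun z => (inner a (eta z) ^+ 4)%:E)); last 2 first.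
+ by apply/measurable_EFinP; exact: measurable_funX.
+ by move=> z; rewrite lee_fin.
rewrite [leLHS](_ : _ =
  \int[nu1]_x (k2 + 6 * inner a2 a2 * xi1 x ^+ 2 + 1 * xi1 x ^+ 4)%:E)%E; last first.
  apply: eq_integral => x _; rewrite /fubini_F.
  under eq_integral do rewrite inner_eta /=.
  by rewrite int4 -/(xi1 x); congr _%:E; ring.
rewrite (integral_even_poly j2 j4) f2 inner_tt lee_fin -/a1 -/a2.
clearbody k2; move: k1le k2le; move: (\int[nu1]_x _)%R => k1.
move: (inner a1 a1) (inner a2 a2) => x y k1le k2le.
have -> : 3 * (x + y) ^+ 2 = 3 * x ^+ 2 + 6 * y * x + 3 * y ^+ 2 by ring.
lra.
Qed.
End gaussian_noise_prod.

Lemma gaussian_noise0 {R : realType} :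
  gaussian_noise (@normal_prob R 0 1) (fun=> 0 : 'cV[R]_0) (fun=> idfun) idfun.
Proof.
have in0 (u v : 'cV[R]_0) : inner u v = 0 by rewrite innerE big_ord0.
split => //.
- by split => [t|]; exact: measurable_id.
- by split => [t x|x]; apply/colP => -[].
- move=> h mh h0; split => // t; apply: eq_integral => x _.
  by rewrite !in0 oppr0 mul0r subr0 expR0 mule1.
- move=> a; rewrite !in0 !expr0n /= mulr0; split.
    by rewrite integral0_eq// => x _; rewrite in0 expr0n.
  by rewrite integral0_eq// => x _; rewrite in0 expr0n.
Qed.

Lemma gaussian_noise1 {R : realType} :
  gaussian_noise (@normal_prob R 0 1) (fun x => x%:M : 'cV[R]_1)
    (fun t x => x + t 0 0) -%R.
Proof.
have in1 (u v : 'cV[R]_1) : inner u v = u 0 0 * v 0 0 by rewrite innerE big_ord1.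
have M00 (x : R) : (x%:M : 'cV[R]_1) 0 0 = x by rewrite !mxE eqxx.
split.
- move=> i; rewrite (_ : (fun o => _) = idfun); last first.
    by apply/funext => x; rewrite ord1 M00.
  exact: measurable_id.
- split; last exact: oppr_measurable.
  by move=> t; apply: measurable_funD => //; exact: measurable_id.
- split=> [t x|x]; apply/colP => i; rewrite ord1 !mxE !eqxx//.
- move=> h mh h0; split; first exact: normal_prob_reflection.
  move=> t; rewrite -(normal_prob_cameron_martin (t 0 0) mh h0).
  apply: eq_integral => x _; rewrite !in1 M00; congr (_ * (expR _)%:E)%E; ring.
- move=> a.
  have i2 := @normal_prob_integrable_exprn R 2 isT.
  have i4 := @normal_prob_integrable_exprn R 4 isT.
  have poly := @integral_even_poly R _ _ (@normal_prob R 0 1) id i2 i4.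
  split.
    transitivity (\int[@normal_prob R 0 1]_x (0 + a 0 0 ^+ 2 * x ^+ 2 + 0 * x ^+ 4)%:E)%E.
      by apply: eq_integral => x _; rewrite in1 M00; congr _%:E; ring.
    by rewrite poly normal_prob_second_moment in1; congr _%:E; ring.
  rewrite [leLHS](_ : _ = \int[@normal_prob R 0 1]_x
      (0 + 0 * x ^+ 2 + a 0 0 ^+ 4 * x ^+ 4)%:E)%E; last first.
    by apply: eq_integral => x _; rewrite in1 M00; congr _%:E; ring.
  rewrite poly in1 lee_fin.
  rewrite mul0r !add0r -expr2 -exprM [leRHS]mulrC; apply: ler_wpM2l.
    by rewrite exprn_even_ge0.
  exact: normal_prob_fourth_moment.
Qed.

Lemma gaussian_noise_exists (R : realType) (d : nat) :
  exists (dO : measure_display) (O : measurableType dO) (nu : probability O R)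
    (eta : O -> 'cV[R]_d) (tau : 'cV[R]_d -> O -> O) (rho : O -> O),
  gaussian_noise nu eta tau rho.
Proof.
elim: d => [|d IH]; first by do 6 eexists; exact: gaussian_noise0.
case: IH => dO; case=> O; case=> nu; case=> eta; case=> tau; case=> rho noise.
by do 6 eexists; exact: (gaussian_noise_prod gaussian_noise1 noise).
Qed.

(** * Fourth moments and symmetric perturbations *)

Section direction_moments.
Context {R : realType} {dT : measure_display} {T : measurableType dT}
  (P : probability T R) {d : nat} (Y : T -> 'cV[R]_d) (kappa : R).
Hypothesis mY : forall i, measurable_fun setT (fun w => Y w i 0).
Hypothesis mom4 : forall v, (\int[P]_w (inner v (Y w) ^+ 4)%:E <= (kappa * inner v v ^+ 2)%:E)%E.

Lemma measurable_inner_dir v : measurable_fun setT (fun w => inner v (Y w)).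
Proof. exact: measurable_inner. Qed.

Lemma measurable_inner_self : measurable_fun setT (fun w => inner (Y w) (Y w)).
Proof. exact: measurable_inner. Qed.

Let pow4_ge0 (x : R) : 0 <= x ^+ 4. Proof. by rewrite exprn_even_ge0. Qed.

Lemma inner_sqr_le (u : 'cV[R]_d) : inner u u ^+ 2 <= d%:R * \sum_(i < d) u i 0 ^+ 4.
Proof.
rewrite innerE expr2 mulr_suml.
under eq_bigr do rewrite mulr_sumr.
apply: (@le_trans _ _ (\sum_(i < d) \sum_(j < d) (u i 0 ^+ 4 + u j 0 ^+ 4) / 2)).
  apply: ler_sum => i _; apply: ler_sum => j _.
  have := sqr_ge0 (u i 0 ^+ 2 - u j 0 ^+ 2).
  by rewrite sqrrB -!exprM !expr2; lra.
under eq_bigr do rewrite -mulr_suml big_split /= sumr_const card_ord.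
rewrite -mulr_suml big_split /= sumr_const card_ord.
by rewrite sumrMnl -mulr_natl; lra.
Qed.

Lemma fourth_moment_norm :
  (\int[P]_w (inner (Y w) (Y w) ^+ 2)%:E <= (kappa * d%:R ^+ 2)%:E)%E.
Proof.
apply: (@le_trans _ _ (\int[P]_w (d%:R * \sum_(i < d) Y w i 0 ^+ 4)%:E)%E).
  apply: ge0_le_integral => //.
  - by move=> w _; rewrite lee_fin sqr_ge0.
  - by apply/measurable_EFinP/measurable_funX/measurable_inner_self.
  - apply/measurable_EFinP/measurable_funM => //.
    by apply: measurable_sum => i; exact: measurable_funX.
  - by move=> w _; rewrite lee_fin inner_sqr_le.
under eq_integral do rewrite EFinM -sumEFin.
rewrite ge0_integralZl//; last 2 first.
- by apply: emeasurable_sum => i; apply/measurable_EFinP; exact: measurable_funX.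
- by move=> w _; apply: sume_ge0 => i _; rewrite lee_fin.
rewrite ge0_integral_sum//; last 2 first.
- by move=> i; apply/measurable_EFinP; exact: measurable_funX.
- by move=> i w _; rewrite lee_fin.
have -> : kappa * d%:R ^+ 2 = d%:R * (\sum_(i < d) kappa).
  by rewrite sumr_const card_ord -mulr_natl; ring.
rewrite EFinM -sumEFin; apply: lee_pmul => //.
  by apply: sume_ge0 => i _; apply: integral_ge0 => w _; rewrite lee_fin.
apply: lee_sum => i _; have := mom4 (delta_mx i 0).
rewrite inner_delta mxE !eqxx expr1n mulr1; apply: le_trans.
by under [X in (_ <= X)%E]eq_integral do rewrite inner_delta.
Qed.

(** On each coordinate c = Y_i, with lam = |v|^2,
    <v, Y>^2 c^2 <= <v, Y>^4 / (2 lam) + lam c^4 / 2. *)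
Lemma mixed_fourth_moment v :
  (\int[P]_w (inner v (Y w) ^+ 2 * inner (Y w) (Y w))%:E <=
   (kappa * d%:R * inner v v)%:E)%E.
Proof.
have [v0|vN0] := eqVneq (inner v v) 0.
  rewrite v0 mulr0 (inner_eq0 v0) integral0_eq// => w _.
  by rewrite inner0l expr0n mul0r.
have v0 : 0 < inner v v by rewrite lt_def vN0 inner_ge0.
set lam := inner v v in v0 *.
have c1 : 0 <= (2 * lam)^-1 by rewrite invr_ge0 mulr_ge0// ltW.
have c2 : 0 <= lam / 2 by rewrite divr_ge0// ltW.
have coord i : (\int[P]_w (inner v (Y w) ^+ 2 * Y w i 0 ^+ 2)%:E <= (kappa * lam)%:E)%E.
  apply: (@le_trans _ _ (\int[P]_w ((2 * lam)^-1%:E * (inner v (Y w) ^+ 4)%:E +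
      (lam / 2)%:E * (inner (delta_mx i 0) (Y w) ^+ 4)%:E))%E).
    apply: ge0_le_integral => //.
    - by move=> w _; rewrite lee_fin mulr_ge0 ?sqr_ge0.
    - apply/measurable_EFinP/measurable_funM; apply: measurable_funX => //.
      exact: measurable_inner_dir.
    - apply: emeasurable_funD; apply/measurable_EFinP/measurable_funM => //;
      by apply: measurable_funX; exact: measurable_inner_dir.
    - move=> w _; rewrite inner_delta -!EFinM -EFinD lee_fin.
      set a := inner v _; set c : R := Y _ _ _.
      rewrite -(ler_pM2l v0) mulrDr.
      have -> : lam * ((2 * lam)^-1 * a ^+ 4) = a ^+ 4 / 2 by field.
      by have := sqr_ge0 (a ^+ 2 - lam * c ^+ 2); lra.
  rewrite ge0_integralD//; last 4 first.
  - by move=> w _; rewrite mule_ge0 ?lee_fin.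
  - by apply/measurable_EFinP/measurable_funM => //; apply: measurable_funX; exact: measurable_inner_dir.
  - by move=> w _; rewrite mule_ge0 ?lee_fin.
  - by apply/measurable_EFinP/measurable_funM => //; apply: measurable_funX; exact: measurable_inner_dir.
  have m4 u : measurable_fun setT (fun w => (inner u (Y w) ^+ 4)%:E).
    by apply/measurable_EFinP; apply: measurable_funX; exact: measurable_inner_dir.
  rewrite !ge0_integralZl//; last 2 first.
  - by move=> w _; rewrite lee_fin.
  - by move=> w _; rewrite lee_fin.
  have -> : (kappa * lam)%:E = ((2 * lam)^-1%:E * (kappa * lam ^+ 2)%:E +
      (lam / 2)%:E * (kappa * 1 ^+ 2)%:E)%E.
    by rewrite -!EFinM -EFinD; congr _%:E; field.
  apply: leeD; apply: lee_wpmul2l => //.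
  by have := mom4 (delta_mx i 0); rewrite inner_delta mxE !eqxx.
have -> : (fun w => (inner v (Y w) ^+ 2 * inner (Y w) (Y w))%:E) =
    (fun w => \sum_(i < d) (inner v (Y w) ^+ 2 * Y w i 0 ^+ 2)%:E)%E.
  apply/funext => w; rewrite (innerE (Y w) (Y w)) mulr_sumr sumEFin.
  by congr _%:E; apply: eq_bigr => i _; rewrite expr2.
rewrite ge0_integral_sum//; last 2 first.
- move=> i; apply/measurable_EFinP/measurable_funM; apply: measurable_funX => //.
  exact: measurable_inner_dir.
- by move=> i w _; rewrite lee_fin mulr_ge0 ?sqr_ge0.
have -> : kappa * d%:R * lam = \sum_(i < d) (kappa * lam).
  by rewrite sumr_const card_ord -mulr_natl; ring.
by rewrite -sumEFin; apply: lee_sum => i _; exact: coord.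
Qed.

End direction_moments.

Lemma measurable_penalized_quad {R : realType} {dT : measure_display}
    {T : measurableType dT} (sg lam : R) (f g : T -> R) :
  measurable_fun setT f -> measurable_fun setT g ->
  measurable_fun setT (fun w => penalized_quad sg lam (f w) (g w)).
Proof.
move=> mf mg; rewrite /penalized_quad /quad.
have mu : measurable_fun setT (fun w => sg * (g w ^+ 2 - f w - lam)).
  apply: measurable_funM => //; apply: measurable_funB => //.
  by apply: measurable_funB => //; exact: measurable_funX.
apply: measurable_funD.
  apply: measurable_funD; first exact: measurable_funD.
  by apply: measurable_funM => //; exact: measurable_funX.
apply: measurable_funM => //; apply: measurable_funD.
  by apply: measurable_funM => //; exact: measurable_funX.
by apply: measurable_funM => //; exact: measurable_funX.
Qed.

Section symmetric_perturbation.
Context {R : realType} {dO : measure_display} {O : measurableType dO}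
  (nu : probability O R) (rho : O -> O) (xi : O -> R) (s2 : R).
Hypothesis mrho : measurable_fun setT rho.
Hypothesis inv : forall h : O -> \bar R, measurable_fun setT h ->
  (forall o, 0 <= h o)%E -> (\int[nu]_o h (rho o) = \int[nu]_o h o)%E.
Hypothesis mxi : measurable_fun setT xi.
Hypothesis xirho : forall o, xi (rho o) = - xi o.
Hypothesis xi2 : (\int[nu]_o (xi o ^+ 2)%:E = s2%:E)%E.
Hypothesis xi4 : (\int[nu]_o (xi o ^+ 4)%:E <= (3 * s2 ^+ 2)%:E)%E.

Lemma perturbation_integrable2 : nu.-integrable setT (EFin \o (fun o => xi o ^+ 2)).
Proof.
apply: ge0_lty_integrable; [exact: measurable_funX|by move=> o; exact: sqr_ge0|].
by rewrite xi2 ltry.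
Qed.

Lemma perturbation_integrable4 : nu.-integrable setT (EFin \o (fun o => xi o ^+ 4)).
Proof.
apply: ge0_lty_integrable; [exact: measurable_funX|by move=> o; rewrite exprn_even_ge0|].
by rewrite (le_lt_trans xi4)// ltry.
Qed.

Lemma perturbation_Rintegral2 : (\int[nu]_o (xi o ^+ 2))%R = s2.
Proof. by rewrite /Rintegral xi2. Qed.

Lemma perturbation_Rintegral4 : (\int[nu]_o (xi o ^+ 4))%R <= 3 * s2 ^+ 2.
Proof.
by rewrite -lee_fin fineK//; exact: integrable_fin_num perturbation_integrable4.
Qed.

Lemma perturbation_s2_ge0 : 0 <= s2.
Proof. by rewrite -lee_fin -xi2; apply: integral_ge0 => o _; rewrite lee_fin sqr_ge0. Qed.

(** The odd powers of xi cancel and the bias s2 of (m + xi) ^+ 2 is subtracted,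
    so that the perturbation only costs terms in m ^+ 2 * s2 and s2 ^+ 2. *)
Lemma penalized_quad_perturbation_le (sg lam m : R) : sg ^+ 2 = 1 ->
  (\int[nu]_o (penalized_quad sg lam s2 (m + xi o))%:E <=
   (1 + sg * (m ^+ 2 - lam) + (m ^+ 2 - lam) ^+ 2 / 2 +
    42 * (m ^+ 2 * s2) + 61 * s2 ^+ 2)%:E)%E.
Proof.
move=> sg1; have s0 := perturbation_s2_ge0.
rewrite (integral_symmetrize mrho inv); last 2 first.
- by apply: measurable_penalized_quad => //; exact: measurable_funD.
- by move=> o; rewrite ltW// penalized_quad_gt0.
pose D := m ^+ 2 - lam.
pose a := 1 + sg * (D - s2) + (D - s2) ^+ 2 / 2 + 40 * (s2 * m ^+ 2 + s2 ^+ 2 / 2).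
pose b := sg + (D - s2) + 2 * m ^+ 2 + 40 * s2.
rewrite (eq_integral (fun o => (a + b * xi o ^+ 2 + 2^-1 * xi o ^+ 4)%:E)); last first.
  move=> o _; rewrite xirho /penalized_quad /quad !exprMn sg1 /a /b /D.
  by congr _%:E; field.
rewrite (integral_even_poly perturbation_integrable2 perturbation_integrable4).
rewrite perturbation_Rintegral2 lee_fin; have := perturbation_Rintegral4.
move: (\int[nu]_o _)%R => k; rewrite /a /b /D; lra.
Qed.

End symmetric_perturbation.

(** * The PAC-Bayesian inequality *)

Section pac_bayes.
Context {R : realType} {dT dV : measure_display} {T : measurableType dT}
  {V : measurableType dV} {P : probability T R} {n d : nat}
  {X : {RV P >-> V}} {Xs : 'I_n -> {RV P >-> V}} (y : V -> 'cV[R]_d) (kappa : R).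
Hypothesis iid : iid_copies X Xs.
Hypothesis my : forall i, measurable_fun setT (fun x => y x i 0).
Hypothesis mom4 : forall v,
  (\int[P]_w (inner v (y (X w)) ^+ 4)%:E <= (kappa * inner v v ^+ 2)%:E)%E.
Context {dO : measure_display} {O : measurableType dO} {nu : probability O R}
  {eta : O -> 'cV[R]_d} {tau : 'cV[R]_d -> O -> O} {rho : O -> O}.
Hypothesis noise : gaussian_noise nu eta tau rho.
Variables (sg lam b : R).
Hypothesis sg1 : sg ^+ 2 = 1.

Let meta i : measurable_fun setT (fun o => eta o i 0).
Proof. by case: noise. Qed.

Let mY i : measurable_fun setT (fun w => y (X w) i 0).
Proof. exact: (measurableT_comp (my i)). Qed.

(** The factor of one observation, for the parameter b * eta. The parameter
    theta enters later, through a translation of eta. *)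
Definition smoothed (x : V) (o : O) : R :=
  penalized_quad sg lam (b ^+ 2 * inner (y x) (y x)) (b * inner (y x) (eta o)).

Let var_ge0 x : 0 <= b ^+ 2 * inner (y x) (y x).
Proof. by rewrite mulr_ge0 ?sqr_ge0 ?inner_ge0. Qed.

Lemma smoothed_ge_half x o : 2^-1 <= smoothed x o.
Proof. exact: penalized_quad_ge_half. Qed.

Lemma smoothed_gt0 x o : 0 < smoothed x o.
Proof. exact: penalized_quad_gt0. Qed.

Lemma measurable_smoothed o : measurable_fun setT (smoothed^~ o).
Proof.
apply: measurable_penalized_quad; apply: measurable_funM => //; exact: measurable_inner.
Qed.

Definition smoothed_mean (o : O) : R := fine (\int[P]_w (smoothed (X w) o)%:E)%E.

Lemma integral_smoothed o :
  (\int[P]_w (smoothed (X w) o)%:E = (smoothed_mean o)%:E)%E.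
Proof.
rewrite fineK// ge0_fin_numE; last first.
  by apply: integral_ge0 => w _; rewrite lee_fin ltW// smoothed_gt0.
have mu : measurable_fun setT (fun w => inner (eta o) (y (X w))) by apply: measurable_inner.
have ms : measurable_fun setT (fun w => inner (y (X w)) (y (X w))) by apply: measurable_inner.
pose G w := (2 + 3 * lam ^+ 2) + 23 * (b ^+ 4 * inner (eta o) (y (X w)) ^+ 4)
  + 43 * (b ^+ 4 * inner (y (X w)) (y (X w)) ^+ 2).
apply: (@le_lt_trans _ _ (\int[P]_w (G w)%:E)%E).
  apply: ge0_le_integral => //.
  - by move=> w _; rewrite lee_fin ltW// smoothed_gt0.
  - apply/measurable_EFinP.
    exact: (measurableT_comp (measurable_smoothed o)).
  - apply/measurable_EFinP; rewrite /G.
    apply: measurable_funD; first apply: measurable_funD => //;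
      by do 2 (apply: measurable_funM => //); exact: measurable_funX.
  - move=> w _; rewrite lee_fin /smoothed /penalized_quad /G.
    rewrite (innerC (eta o)); move: (inner (y _) (eta o)) (inner (y (X w)) (y (X w))) => q s.
    have -> : b ^+ 4 * q ^+ 4 = ((b * q) ^+ 2) ^+ 2 by rewrite -exprM exprMn.
    have -> : b ^+ 4 * s ^+ 2 = (b ^+ 2 * s) ^+ 2 by rewrite exprMn -exprM.
    move: ((b * q) ^+ 2) (b ^+ 2 * s) => W2 S; rewrite /quad exprMn sg1.
    have := sqr_ge0 (sg * (W2 - S - lam) - 1); rewrite sqrrB exprMn sg1.
    have := sqr_ge0 (W2 + S); have := sqr_ge0 (W2 + lam); have := sqr_ge0 (S - lam).
    by have := sqr_ge0 (W2 - S); lra.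
have ic (c : R) : P.-integrable setT (EFin \o cst c) by apply: finite_measure_integrable_cst.
have i4 : P.-integrable setT (EFin \o (fun w => inner (eta o) (y (X w)) ^+ 4)).
  apply: ge0_lty_integrable; [exact: measurable_funX|by move=> w; rewrite exprn_even_ge0|].
  by rewrite (le_lt_trans (mom4 _))// ltry.
have i2 : P.-integrable setT (EFin \o (fun w => inner (y (X w)) (y (X w)) ^+ 2)).
  apply: ge0_lty_integrable; [exact: measurable_funX|by move=> w; rewrite sqr_ge0|].
  by rewrite (le_lt_trans (fourth_moment_norm mY mom4))// ltry.
apply: integrable_lty => //.
exact: (integrableD measurableT (integrableD measurableT (ic _)
  (integrableZl measurableT 23 (integrableZl measurableT (b ^+ 4) i4)))
  (integrableZl measurableT 43 (integrableZl measurableT (b ^+ 4) i2))).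
Qed.

Lemma smoothed_mean_ge_half o : 2^-1 <= smoothed_mean o.
Proof.
rewrite -lee_fin -integral_smoothed.
have -> : (2^-1%:E = \int[P]_w (cst 2^-1%:E) w)%E by rewrite integral_cst//= probability_setT mule1.
apply: ge0_le_integral => //.
- by move=> w _; rewrite lee_fin invr_ge0.
- by apply/measurable_EFinP; exact: (measurableT_comp (measurable_smoothed o)).
- by move=> w _; rewrite lee_fin smoothed_ge_half.
Qed.

Lemma smoothed_mean_gt0 o : 0 < smoothed_mean o.
Proof. by have := smoothed_mean_ge_half o; lra. Qed.

Lemma measurable_smoothed_mean : measurable_fun setT smoothed_mean.
Proof.
apply: measurableT_comp => //.
apply: (measurable_fun_fubini_tonelli_G (fun z => (smoothed (X z.1) z.2)%:E)).
  apply/measurable_EFinP.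
  apply: measurable_penalized_quad; apply: measurable_funM => //; apply: measurable_inner => i;
    by [exact: (measurableT_comp (mY i))|exact: (measurableT_comp (meta i))].
by move=> z; rewrite lee_fin ltW// smoothed_gt0.
Qed.

Lemma integral_smoothed_copy i o :
  (\int[P]_w (smoothed (Xs i w) o)%:E = (smoothed_mean o)%:E)%E.
Proof.
have ms : measurable_fun setT (EFin \o smoothed^~ o).
  exact/measurable_EFinP/measurable_smoothed.
have s0 x : (0 <= (EFin \o smoothed^~ o) x)%E by rewrite lee_fin ltW// smoothed_gt0.
rewrite -integral_smoothed; exact: (integral_iid_copy iid i ms s0).
Qed.

(** The likelihood ratio of the sample at noise o, of expectation 1. *)
Definition likelihood (w : T) (o : O) : R :=
  \prod_(i < n) (smoothed (Xs i w) o / smoothed_mean o).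

Lemma likelihood_gt0 w o : 0 < likelihood w o.
Proof. by apply: prodr_gt0 => i _; rewrite divr_gt0 ?smoothed_gt0 ?smoothed_mean_gt0. Qed.

Lemma measurable_likelihood_pair :
  measurable_fun setT (fun z : T * O => likelihood z.1 z.2).
Proof.
apply: measurable_prod => i _.
apply: measurable_funM.
  apply: measurable_penalized_quad; apply: measurable_funM => //; apply: measurable_inner => j;
    by [exact: (measurableT_comp (measurableT_comp (my j) (measurable_funP (Xs i))))
       |exact: (measurableT_comp (meta j))].
rewrite (_ : (fun z => _) = fun z => expR (- ln (smoothed_mean z.2))); last first.
  by apply/funext => z; rewrite -lnV ?posrE ?smoothed_mean_gt0// lnK// posrE invr_gt0 smoothed_mean_gt0.
apply: measurableT_comp => //; apply: measurableT_comp => //; apply: measurableT_comp => //.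
exact: (measurableT_comp measurable_smoothed_mean).
Qed.

Lemma measurable_likelihood w : measurable_fun setT (likelihood w).
Proof.
have mp : measurable_fun setT (pair w : O -> T * O) by exact: pair1_measurable.
exact: (measurableT_comp measurable_likelihood_pair mp).
Qed.

Definition partition_function (w : T) : \bar R := (\int[nu]_o (likelihood w o)%:E)%E.

Lemma measurable_partition_function : measurable_fun setT partition_function.
Proof.
apply: (measurable_fun_fubini_tonelli_F (fun z => (likelihood z.1 z.2)%:E)).
  by apply/measurable_EFinP; exact: measurable_likelihood_pair.
by move=> z; rewrite lee_fin ltW// likelihood_gt0.
Qed.

Lemma integral_partition_function : (\int[P]_w partition_function w = 1)%E.
Proof.
have mL : measurable_fun setT (fun z : T * O => (likelihood z.1 z.2)%:E).
  by apply/measurable_EFinP; exact: measurable_likelihood_pair.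
have L0 (z : T * O) : (0 <= (likelihood z.1 z.2)%:E)%E by rewrite lee_fin ltW// likelihood_gt0.
transitivity (\int[nu]_o (cst 1 o))%E; last by rewrite integral_cst//= probability_setT mule1.
apply: (etrans (fubini_tonelli (m1 := P) (m2 := nu) (fun z => (likelihood z.1 z.2)%:E) mL L0)).
apply: eq_integral => o _; rewrite /fubini_G /=.
have := @independent_integral_prod R _ _ _ _ P n Xs iid.1
  (fun _ x => smoothed x o / smoothed_mean o) (fun _ => 1).
rewrite big1//; apply.
- by move=> i; apply: measurable_funM => //; exact: measurable_smoothed.
- by move=> i x; rewrite divr_ge0// ltW ?smoothed_gt0 ?smoothed_mean_gt0.
- move=> i; under eq_integral do rewrite EFinM.
  rewrite ge0_integralZr//; last 3 first.
  + by apply/measurable_EFinP; exact: (measurableT_comp (measurable_smoothed o)).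
  + by move=> w _; rewrite lee_fin ltW// smoothed_gt0.
  + by rewrite lee_fin invr_ge0 ltW// smoothed_mean_gt0.
  by rewrite integral_smoothed_copy -EFinM divff// gt_eqF// smoothed_mean_gt0.
Qed.

(** The event does not involve theta, which makes the final bound uniform. *)
Lemma partition_function_event (eps : R) : 0 < eps ->
  exists A, [/\ measurable A, ((1 - eps)%:E <= P A)%E &
    forall w, A w -> (partition_function w <= eps^-1%:E)%E].
Proof.
move=> e0.
apply: markov_event.
- exact: measurable_partition_function.
- by move=> w; apply: integral_ge0 => o _; rewrite lee_fin ltW// likelihood_gt0.
- by rewrite invr_ge0 ltW.
- exact: ltW.
- by rewrite integral_partition_function mulfV ?gt_eqF.
Qed.

Section shift.
Variable theta : 'cV[R]_d.
Hypothesis b0 : b != 0.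
Hypothesis theta_lam : inner theta theta = lam.
Let t := b^-1 *: theta.
Let xi x o := inner (b *: y x) (eta o).
Let s2 x := b ^+ 2 * inner (y x) (y x).

Lemma smoothed_shift x o :
  smoothed x (tau t o) = penalized_quad sg lam (s2 x) (inner theta (y x) + xi x o).
Proof.
case: noise => _ _ [etat _] _ _; rewrite /smoothed etat; congr penalized_quad.
by rewrite innerDr innerZr /xi innerZl mulrDr mulrA divff// mul1r addrC (innerC theta).
Qed.

Let mtau : measurable_fun setT (tau t). Proof. by case: noise => _ [+ _] _ _ _; apply. Qed.
Let mrho : measurable_fun setT rho. Proof. by case: noise => _ [_ +] _ _ _. Qed.
Let inv h : measurable_fun setT h -> (forall o, 0 <= h o)%E ->
  (\int[nu]_o h (rho o) = \int[nu]_o h o)%E.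
Proof. by case: noise => _ _ _ + _ => /[apply]/[apply] -[]. Qed.
Let mxi x : measurable_fun setT (xi x). Proof. exact: measurable_inner. Qed.
Let xirho x o : xi x (rho o) = - xi x o.
Proof. by case: noise => _ _ [_ etarho] _ _; rewrite /xi etarho innerNr. Qed.
Let xi2 x : (\int[nu]_o (xi x o ^+ 2)%:E = (s2 x)%:E)%E.
Proof.
case: noise => _ _ _ _ /(_ (b *: y x)) [-> _].
by rewrite innerZl innerZr mulrA -expr2.
Qed.
Let xi4 x : (\int[nu]_o (xi x o ^+ 4)%:E <= (3 * s2 x ^+ 2)%:E)%E.
Proof.
case: noise => _ _ _ _ /(_ (b *: y x)) [_ h].
by move: h; rewrite innerZl innerZr mulrA -expr2.
Qed.

Hypothesis theta_mom2 : (\int[P]_w (inner theta (y (X w)) ^+ 2)%:E = lam%:E)%E.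

(** After the translation the argument of the factor is <theta, y> plus a
    symmetric perturbation of variance b^2 |y|^2, and the moments of order 4 of y
    control each term of penalized_quad_perturbation_le. *)
Lemma integral_smoothed_mean_shift :
  (\int[nu]_o (smoothed_mean (tau t o))%:E <=
   (1 + (kappa - 1) * lam ^+ 2 / 2 + 42 * (kappa * d%:R * lam * b ^+ 2) +
    61 * (kappa * d%:R ^+ 2 * b ^+ 4))%:E)%E.
Proof.
pose h (z : T * O) := (smoothed (X z.1) (tau t z.2))%:E.
have mt2 i : measurable_fun setT (fun z : T * O => eta (tau t z.2) i 0).
  exact: (measurableT_comp (measurableT_comp (meta i) mtau)).
have mh : measurable_fun setT h.
  apply/measurable_EFinP.
  apply: measurable_penalized_quad; apply: measurable_funM => //; apply: measurable_inner => i //;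
    exact: (measurableT_comp (mY i)).
have h0 z : (0 <= h z)%E by rewrite lee_fin ltW// smoothed_gt0.
have -> : (\int[nu]_o (smoothed_mean (tau t o))%:E = \int[P]_w \int[nu]_o h (w, o))%E.
  apply: (etrans _ (esym (fubini_tonelli (m1 := P) (m2 := nu) h mh h0))).
  by apply: eq_integral => o _; rewrite /fubini_G /h /= integral_smoothed.
pose m w := inner theta (y (X w)).
have mm : measurable_fun setT m by apply: measurable_inner.
have ms2 : measurable_fun setT (fun w => s2 (X w)).
  by apply: measurable_funM => //; apply: measurable_inner.
pose G1 w := 1 + sg * (m w ^+ 2 - lam) + (m w ^+ 2 - lam) ^+ 2 / 2.
have G10 w : 0 <= G1 w.
  rewrite /G1; have := sqr_ge0 (sg * (m w ^+ 2 - lam) + 1).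
  by rewrite sqrrD exprMn sg1; lra.
have mG1 : measurable_fun setT G1.
  rewrite /G1; have mD : measurable_fun setT (fun w => m w ^+ 2 - lam).
    by apply: measurable_funB => //; exact: measurable_funX.
  apply: measurable_funD; first by apply: measurable_funD => //; exact: measurable_funM.
  by apply: measurable_funM => //; exact: measurable_funX.
have b2 : (0 <= (42 * b ^+ 2)%:E)%E by rewrite lee_fin mulr_ge0 ?sqr_ge0.
have b4 : (0 <= (61 * b ^+ 4)%:E)%E by rewrite lee_fin mulr_ge0// exprn_even_ge0.
have miY : measurable_fun setT (fun w => inner (y (X w)) (y (X w))) by apply: measurable_inner.
pose g1 w := (m w ^+ 2 * inner (y (X w)) (y (X w)))%:E.
pose g2 w := (inner (y (X w)) (y (X w)) ^+ 2)%:E.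
have g10 w : (0 <= g1 w)%E by rewrite lee_fin mulr_ge0 ?sqr_ge0 ?inner_ge0.
have g20 w : (0 <= g2 w)%E by rewrite lee_fin sqr_ge0.
have mg1 : measurable_fun setT g1.
  by apply/measurable_EFinP/measurable_funM => //; exact: measurable_funX.
have mg2 : measurable_fun setT g2 by apply/measurable_EFinP; exact: measurable_funX.
have pos1 w : (0 <= (42 * b ^+ 2)%:E * g1 w)%E by rewrite mule_ge0.
have pos2 w : (0 <= (61 * b ^+ 4)%:E * g2 w)%E by rewrite mule_ge0.
have mpos1 : measurable_fun setT (fun w => (42 * b ^+ 2)%:E * g1 w)%E.
  exact: measurable_funeM.
have mpos2 : measurable_fun setT (fun w => (61 * b ^+ 4)%:E * g2 w)%E.
  exact: measurable_funeM.
apply: (@le_trans _ _ (\int[P]_w ((G1 w)%:E + ((42 * b ^+ 2)%:E * g1 w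
     + (61 * b ^+ 4)%:E * g2 w)))%E).
  apply: ge0_le_integral => //.
  - by move=> w _; apply: integral_ge0.
  - exact: (measurable_fun_fubini_tonelli_F h).
  - by apply: emeasurable_funD; [exact/measurable_EFinP|exact: emeasurable_funD].
  - move=> w _.
    rewrite /h /=; under eq_integral do rewrite smoothed_shift.
    apply: (le_trans (penalized_quad_perturbation_le mrho inv (mxi (X w)) (xirho (X w))
       (xi2 (X w)) (xi4 (X w)) lam (m w) sg1)).
    rewrite /g1 /g2 -!EFinM -!EFinD lee_fin /G1 /s2; rewrite le_eqVlt; apply/orP; left; apply/eqP.
    ring.
rewrite ge0_integralD//; last 4 first.
- by move=> w _; rewrite lee_fin.
- exact/measurable_EFinP.
- by move=> w _; rewrite adde_ge0.
- exact: emeasurable_funD.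
rewrite ge0_integralD//.
rewrite !ge0_integralZl//.
have E1 : (\int[P]_w (G1 w)%:E <= (1 + (kappa - 1) * lam ^+ 2 / 2)%:E)%E.
  have i2 : P.-integrable setT (EFin \o (fun w => m w ^+ 2)).
    apply: ge0_lty_integrable; [exact: measurable_funX|by move=> w; rewrite sqr_ge0|].
    by rewrite theta_mom2 ltry.
  have i4 : P.-integrable setT (EFin \o (fun w => m w ^+ 4)).
    apply: ge0_lty_integrable; [exact: measurable_funX|by move=> w; rewrite exprn_even_ge0|].
    by rewrite (le_lt_trans (mom4 _))// ltry.
  rewrite (eq_integral (fun w => ((1 - sg * lam + lam ^+ 2 / 2) + (sg - lam) * m w ^+ 2 +
      2^-1 * m w ^+ 4)%:E)); last first.
    by move=> w _; rewrite /G1; congr _%:E; field.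
  rewrite (integral_even_poly i2 i4) {1}/Rintegral theta_mom2 /= lee_fin.
  have : (\int[P]_w (m w ^+ 4))%R <= kappa * lam ^+ 2.
    by rewrite -lee_fin fineK ?integrable_fin_num// -theta_lam mom4.
  by move: (\int[P]_w _)%R => k; lra.
have -> : 1 + (kappa - 1) * lam ^+ 2 / 2 + 42 * (kappa * d%:R * lam * b ^+ 2) +
    61 * (kappa * d%:R ^+ 2 * b ^+ 4) = 1 + (kappa - 1) * lam ^+ 2 / 2 +
    (42 * b ^+ 2 * (kappa * d%:R * lam) + 61 * b ^+ 4 * (kappa * d%:R ^+ 2)) by ring.
rewrite [leRHS]EFinD; apply: leeD; first exact: E1.
rewrite [leRHS]EFinD; apply: leeD; rewrite [leRHS]EFinM; apply: lee_wpmul2l => //.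
  by rewrite -theta_lam; exact: mixed_fourth_moment.
exact: fourth_moment_norm.
Qed.

(** The change of variables by t turns the bound on the partition function
    into an exponential inequality at theta. The inequality expR z >= 1 + z
    under the integral replaces the convexity step of PAC-Bayesian proofs, and
    the average over rho removes the linear term of the Cameron-Martin
    density. *)
Lemma pac_bayes_bound (eps : R) (w : T) (g : 'I_n -> R) : 0 < eps ->
  (partition_function w <= eps^-1%:E)%E ->
  (forall i, parabola_minorant (g i) (sg * (inner theta (y (Xs i w)) ^+ 2 - lam))) ->
  \sum_(i < n) g i <=
    n%:R * ((kappa - 1) * lam ^+ 2 / 2 + 42 * (kappa * d%:R * lam * b ^+ 2) +
            61 * (kappa * d%:R ^+ 2 * b ^+ 4)) + lam / (2 * b ^+ 2) + ln eps^-1.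
Proof.
move=> e0 Zle gpar.
pose x i := Xs i w.
have abc i := @symmetrized_penalized_quad_ge R sg lam (s2 (x i)) (inner theta (y (x i))) (g i)
  sg1 (var_ge0 _) (gpar i).
have [A hA] := choice abc; have [B hB] := choice hA; have [C hC] := choice hB.
have C0 i : 0 <= C i by case: (hC i).
have gle i : g i <= A i + B i * s2 (x i) - C i * (3 * s2 (x i) ^+ 2) by case: (hC i).
have lnge i z : A i + B i * z ^+ 2 - C i * z ^+ 4 <=
    (ln (penalized_quad sg lam (s2 (x i)) (inner theta (y (x i)) + z)) +
     ln (penalized_quad sg lam (s2 (x i)) (inner theta (y (x i)) - z))) / 2.
  by case: (hC i) => _ _; apply.
(* the integrand of the translated partition function *)
pose K o := eps * likelihood w (tau t o) * expR (- inner t (eta o) - inner t t / 2).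
pose M o := smoothed_mean (tau t o).
have mM : measurable_fun setT M by exact: (measurableT_comp measurable_smoothed_mean).
have M0 o : 0 <= M o by rewrite ltW// smoothed_mean_gt0.
have K0 o : 0 <= K o by rewrite !mulr_ge0 ?expR_ge0 ?(ltW e0)// ltW// likelihood_gt0.
have mK : measurable_fun setT K.
  apply: measurable_funM.
    apply: measurable_funM => //; exact: (measurableT_comp (measurable_likelihood w)).
  apply: measurableT_comp => //; apply: measurable_funB => //.
  by apply: measurableT_comp => //; apply: measurable_inner.
have IK : (\int[nu]_o (K o)%:E <= 1)%E.
  have mL : measurable_fun setT (EFin \o likelihood w).
    exact/measurable_EFinP/measurable_likelihood.
  have L0 o : (0 <= (EFin \o likelihood w) o)%E by rewrite lee_fin ltW// likelihood_gt0.
  have mK' : measurable_fun setT (fun o => (EFin \o likelihood w) (tau t o) *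
      (expR (- inner t (eta o) - inner t t / 2))%:E)%E.
    apply: emeasurable_funM; first exact: (measurableT_comp mL).
    apply/measurable_EFinP/measurableT_comp => //; apply: measurable_funB => //.
    by apply: measurableT_comp => //; apply: measurable_inner.
  have -> : (\int[nu]_o (K o)%:E = eps%:E * partition_function w)%E.
    have [_ _ _ h _] := noise; have [_ /(_ t) e] := h _ mL L0.
    rewrite /partition_function -e -ge0_integralZl//; last 2 first.
    - by move=> o _; rewrite mule_ge0// lee_fin expR_ge0.
    - by rewrite lee_fin ltW.
    by apply: eq_integral => o _; rewrite /= -!EFinM mulrA.
  have -> : (1 = eps%:E * eps^-1%:E)%E by rewrite -EFinM divff// gt_eqF.
  by apply: lee_wpmul2l => //; rewrite lee_fin ltW.
pose f i o := smoothed (x i) (tau t o).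
have f0 i o : 0 < f i o by exact: smoothed_gt0.
have KE o : K o = expR (ln eps + \sum_(i < n) (ln (f i o) - ln (M o))
    + (- inner t (eta o) - inner t t / 2)).
  rewrite !expRD lnK ?posrE// /K /likelihood expR_sum; congr (_ * _ * _).
    by apply: eq_bigr => i _; rewrite expRB !lnK ?posrE//; exact: smoothed_mean_gt0.
  by rewrite expRD.
have Kge o : \sum_(i < n) ln (f i o) - inner t (eta o) <=
    K o + n%:R * M o + (inner t t / 2 + ln eps^-1 - 1 - n%:R).
  have := expR_ge1Dx (ln eps + \sum_(i < n) (ln (f i o) - ln (M o))
    + (- inner t (eta o) - inner t t / 2)); rewrite -KE.
  rewrite sumrB sumr_const card_ord lnV ?posrE// -[ln (M o) *+ n]mulr_natl.
  have lnM : ln (M o) <= M o - 1.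
    have := @le_ln1Dx R (M o - 1); rewrite (addrC 1 (M o - 1)) subrK; apply.
    by have := smoothed_mean_gt0 (tau t o); rewrite -/(M o); lra.
  have : n%:R * ln (M o) <= n%:R * (M o - 1) by rewrite ler_wpM2l.
  lra.
pose p i o := A i + B i * xi (x i) o ^+ 2 + (- C i) * xi (x i) o ^+ 4.
pose Ks o := (K o + K (rho o)) / 2.
pose Ms o := (M o + M (rho o)) / 2.
have ple o : \sum_(i < n) p i o <= Ks o + n%:R * Ms o + (inner t t / 2 + ln eps^-1 - 1 - n%:R).
  have : \sum_(i < n) p i o <= \sum_(i < n) (ln (f i o) + ln (f i (rho o))) / 2.
    apply: ler_sum => i _; rewrite /p mulNr /f !smoothed_shift xirho.
    exact: lnge.
  have -> : \sum_(i < n) (ln (f i o) + ln (f i (rho o))) / 2 =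
      (\sum_(i < n) ln (f i o) + \sum_(i < n) ln (f i (rho o))) / 2.
    by rewrite -mulr_suml big_split.
  have := Kge o; have := Kge (rho o).
  have [_ _ [_ ->] _ _] := noise; rewrite innerNr /Ks /Ms; lra.
have i2 i := perturbation_integrable2 (mxi (x i)) (xi2 (x i)).
have i4 i := perturbation_integrable4 (mxi (x i)) (xi4 (x i)).
have ip i : nu.-integrable setT (EFin \o p i) by exact: integrable_even_poly.
have Ip i : ((g i)%:E <= \int[nu]_o (p i o)%:E)%E.
  rewrite (integral_even_poly (i2 i) (i4 i)) (perturbation_Rintegral2 (xi2 (x i))) lee_fin.
  apply: le_trans (gle i) _; rewrite mulNr lerD2l lerN2 ler_wpM2l//.
  exact: (perturbation_Rintegral4 (mxi (x i)) (xi4 (x i))).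
have mKs : measurable_fun setT Ks.
  by apply: measurable_funM => //; apply: measurable_funD => //; exact: measurableT_comp.
have mMs : measurable_fun setT Ms.
  by apply: measurable_funM => //; apply: measurable_funD => //; exact: measurableT_comp.
have IKs : (\int[nu]_o (Ks o)%:E <= 1)%E by rewrite -(integral_symmetrize mrho inv mK K0).
have IMs := integral_smoothed_mean_shift.
rewrite (integral_symmetrize mrho inv mM M0) in IMs.
have iKs : nu.-integrable setT (EFin \o Ks).
  apply: ge0_lty_integrable => //; first by move=> o; rewrite divr_ge0 ?addr_ge0.
  by rewrite (le_lt_trans IKs)// ltry.
have iMs : nu.-integrable setT (EFin \o Ms).
  apply: ge0_lty_integrable => //; first by move=> o; rewrite divr_ge0 ?addr_ge0.
  by rewrite (le_lt_trans IMs)// ltry.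
pose k := inner t t / 2 + ln eps^-1 - 1 - n%:R.
have inM := integrableZl measurableT n%:R iMs.
have ik : nu.-integrable setT (EFin \o cst k) by apply: finite_measure_integrable_cst.
have iS : nu.-integrable setT (fun o => \sum_(i < n) (p i o)%:E)%E.
  by apply: integrable_sum => // i _; exact: ip.
have iKM := integrableD measurableT iKs inM.
have iR := integrableD measurableT iKM ik.
have main : (\int[nu]_o (\sum_(i < n) (p i o)%:E) <=
    \int[nu]_o ((Ks o)%:E + n%:R%:E * (Ms o)%:E + k%:E))%E.
  apply: le_integral => // o _.
  by rewrite sumEFin -EFinM -!EFinD lee_fin; exact: ple.
rewrite (integral_sum measurableT ip) in main.
rewrite (integralD measurableT iKM ik) (integralD measurableT iKs inM) in main.
have Ik : (\int[nu]_o (EFin \o cst k) o = k%:E)%E.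
  transitivity (\int[nu]_o (cst k%:E o))%E => //.
  by rewrite integral_cst//= probability_setT mule1.
rewrite (integralZl measurableT iMs) Ik in main.
have : ((\sum_(i < n) g i)%:E <= 1 + n%:R%:E * (1 + (kappa - 1) * lam ^+ 2 / 2 +
    42 * (kappa * d%:R * lam * b ^+ 2) + 61 * (kappa * d%:R ^+ 2 * b ^+ 4))%:E + k%:E)%E.
  rewrite -sumEFin; apply: le_trans (le_trans main _).
    by apply: lee_sum => i _; exact: Ip.
  by apply: leeD => //; apply: leeD => //; apply: lee_wpmul2l.
rewrite -EFinM -!EFinD lee_fin => /le_trans; apply.
rewrite /k /t innerZl innerZr theta_lam.
have -> : b^-1 * (b^-1 * lam) / 2 = lam / (2 * b ^+ 2) by field.
lra.
Qed.

End shift.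

End pac_bayes.

(** * Pseudo-inverse and square root of a positive semi-definite matrix *)

Section symmetric_polynomial_calculus.
Context {R : realType} {d' : nat}.
Local Notation d := d'.+1.
Variable A : 'M[R]_d.
Hypothesis symA : A^T = A.
Hypothesis psdA : forall u : 'cV[R]_d, 0 <= inner u (A *m u).
Implicit Types (p q : {poly R}) (u v : 'cV[R]_d).

Lemma horner_mx_sym p : (horner_mx A p)^T = horner_mx A p.
Proof.
elim/poly_ind: p => [|p c IH]; first by rewrite rmorph0 trmx0.
rewrite rmorphD rmorphM /= horner_mx_X horner_mx_C raddfD /= tr_scalar_mx; congr (_ + _).
rewrite -[_ * A]/(_ *m A) trmx_mul IH symA.
exact: comm_mx_horner (comm_mx_refl A).
Qed.

Lemma sym_sqr_eq0 (M : 'M[R]_d) : M^T = M -> M *m M = 0 -> M = 0.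
Proof.
move=> sM MM; apply/matrixP => i j; rewrite [RHS]mxE.
have : inner (M *m delta_mx j 0) (M *m delta_mx j 0) = 0.
  by rewrite inner_mulmx sM mulmxA MM mul0mx inner0l.
move/inner_eq0 => /colP /(_ i); rewrite !mxE (bigD1 j)//= !mxE !eqxx mulr1 big1 ?addr0//.
by move=> k /negbTE kj; rewrite !mxE kj mulr0.
Qed.

(** A symmetric matrix of square zero vanishes, hence so does a nilpotent one. *)
Lemma horner_mx_nilpotent p k : horner_mx A (p ^+ k) = 0 -> horner_mx A p = 0.
Proof.
move=> pk; have : horner_mx A (p ^+ (2 ^ k)) = 0.
  by rewrite -(subnK (ltnW (ltn_expl k (ltnSn 1)))) exprD rmorphM /= pk mulr0.
elim: (k) => [|m IH]; first by rewrite expn0 expr1.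
rewrite expnS mulnC exprM expr2 rmorphM /= => h; apply: IH.
by apply: sym_sqr_eq0 h; exact: horner_mx_sym.
Qed.

(** A complex eigenvector x + i y of a real symmetric matrix has real
    eigenvalue a, since b (|x|^2 + |y|^2) = 0 for its imaginary part b. *)
Lemma sym_eigen_real (a b : R) (x y : 'cV[R]_d) :
  A *m x = a *: x - b *: y -> A *m y = b *: x + a *: y ->
  (x != 0) || (y != 0) -> b = 0 /\ 0 <= a.
Proof.
move=> Ax Ay xy.
have pos : 0 < inner x x + inner y y.
  rewrite lt_def addr_ge0 ?inner_ge0// andbT paddr_eq0 ?inner_ge0//.
  by apply: contraL xy => /andP[/eqP/inner_eq0 -> /eqP/inner_eq0 ->]; rewrite eqxx.
have b0 : b = 0.
  have := inner_mulmx A x y; rewrite symA Ax Ay.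
  rewrite innerDr innerDl !innerZr -scaleNr !innerZl => e.
  have : b * (inner x x + inner y y) = 0 by lra.
  by move/eqP; rewrite mulf_eq0 (gt_eqF pos) orbF => /eqP.
split => //.
have := psdA x; have := psdA y; rewrite Ax Ay b0 !scale0r subr0 add0r !innerZr.
move=> h1 h2; have : 0 <= a * (inner x x + inner y y) by rewrite mulrDr addr_ge0.
by rewrite pmulr_lge0.
Qed.

(** The characteristic polynomial splits over the complex numbers, with real
    nonnegative roots by sym_eigen_real, and multiplicities can be dropped by
    horner_mx_nilpotent. *)
Lemma sym_annihilator : exists s : seq R,
  [/\ uniq s, {in s, forall x, 0 <= x} &
      horner_mx A (\prod_(x <- s) ('X - x%:P)) = 0].
Proof.
pose toC := real_complex R : {rmorphism R -> R[i]}.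
pose AC := map_mx toC A.
have [rs rsE] := closed_field_poly_normal (char_poly AC).
have monC : char_poly AC \is monic by exact: char_poly_monic.
rewrite (monicP monC) scale1r in rsE.
have rsR z : z \in rs -> exists2 a : R, 0 <= a & z = toC a.
  move=> zrs; have : eigenvalue AC z.
    by rewrite eigenvalue_root_char rsE root_prod_XsubC.
  move=> /eigenvalueP[v vA v0].
  pose x : 'cV[R]_d := \col_i complex.Re (v 0 i).
  pose y : 'cV[R]_d := \col_i complex.Im (v 0 i).
  have entry j : \sum_k v 0 k * toC (A k j) = z * v 0 j.
    by have /rowP/(_ j) := vA; rewrite !mxE => <-; apply: eq_bigr => k _; rewrite mxE.
  have Aji j k : A j k = A k j by rewrite -{1}symA mxE.
  have ReD : {morph @complex.Re R : u w / u + w} by move=> [? ?] [? ?].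
  have ImD : {morph @complex.Im R : u w / u + w} by move=> [? ?] [? ?].
  have Ax : A *m x = complex.Re z *: x - complex.Im z *: y.
    apply/colP => j; have := congr1 (@complex.Re R) (entry j).
    rewrite (big_morph (@complex.Re R) ReD erefl) !mxE => e.
    transitivity (complex.Re (z * v 0 j)).
      rewrite -e; apply: eq_bigr => k _; rewrite !mxE Aji.
      by case: (v 0 k) => p q /=; rewrite mulr0 subr0 mulrC.
    by case: (z) => a b; case: (v 0 j).
  have Ay : A *m y = complex.Im z *: x + complex.Re z *: y.
    apply/colP => j; have := congr1 (@complex.Im R) (entry j).
    rewrite (big_morph (@complex.Im R) ImD erefl) !mxE => e.
    transitivity (complex.Im (z * v 0 j)).
      rewrite -e; apply: eq_bigr => k _; rewrite !mxE Aji.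
      by case: (v 0 k) => p q /=; rewrite mulr0 add0r mulrC.
    by case: (z) => a b; case: (v 0 j) => p q /=; rewrite addrC.
  have xy : (x != 0) || (y != 0).
    apply: contraNT v0; rewrite negb_or !negbK => /andP[/eqP x0 /eqP y0].
    apply/eqP/rowP => j; rewrite mxE.
    have /colP/(_ j) := x0; have /colP/(_ j) := y0; rewrite !mxE.
    by case: (v 0 j) => p q /= -> ->.
  have [b0 a0] := sym_eigen_real Ax Ay xy.
  exists (complex.Re z) => //; case: (z) b0 => a b /= ->; done.
pose rr := [seq complex.Re z | z <- rs].
have rsE' : rs = map toC rr.
  rewrite -map_comp -[LHS]map_id; apply/eq_in_map => z /rsR[a _ ->] //.
have chiE : char_poly A = \prod_(x <- rr) ('X - x%:P).
  apply: (map_poly_inj toC); rewrite map_char_poly -/AC rsE rsE' rmorph_prod big_map.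
  by apply: eq_bigr => x _; rewrite rmorphB /= map_polyX map_polyC.
exists (undup rr); split; first exact: undup_uniq.
  by move=> x; rewrite mem_undup => /mapP[z /rsR[a a0 ->] ->].
apply: (@horner_mx_nilpotent _ (size rr)).
have /dvdpP[q ->] : char_poly A %| (\prod_(x <- undup rr) ('X - x%:P)) ^+ size rr.
  rewrite chiE; set Q := \prod_(x <- undup rr) _.
  have : {in rr, forall x, ('X - x%:P) %| Q}.
    by move=> x xr; rewrite dvdp_XsubCl root_prod_XsubC mem_undup.
  elim: (rr) => [|x s IH] h; first by rewrite big_nil dvd1p.
  rewrite big_cons exprS dvdp_mul ?h ?mem_head// IH// => z zs.
  by rewrite h// inE zs orbT.
by rewrite rmorphM /= Cayley_Hamilton mulr0.
Qed.

Lemma interpolation (s : seq R) (f : R -> R) : uniq s ->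
  exists p, {in s, forall x, p.[x] = f x}.
Proof.
elim: s => [|a s IH] /=; first by exists 0.
move=> /andP[as_ /IH[p pf]]; pose Q := \prod_(x <- s) ('X - x%:P).
have Qa : Q.[a] != 0 by rewrite -rootE root_prod_XsubC.
exists (p + ((f a - p.[a]) / Q.[a]) *: Q) => x; rewrite inE => /predU1P[->|xs].
  by rewrite hornerD hornerZ divfK// addrC subrK.
rewrite hornerD hornerZ (rootP (_ : root Q x)) ?root_prod_XsubC//.
by rewrite mulr0 addr0 pf.
Qed.

(** Polynomials that agree on the spectrum take the same value at A, so that
    the pseudo-inverse is r(A) for r interpolating x^-1, with 0^-1 = 0, on the
    spectrum. Its square root is g(A)^2 for g interpolating the fourth root of
    x^-1: as the square of a symmetric matrix it is positive. *)
Lemma penrose_sqrt_exists_pos : exists B S : 'M[R]_d, penrose A B /\ is_sym_sqrt B S.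
Proof.
have [s [us s0 sA]] := sym_annihilator.
have eqA p q : {in s, forall x, p.[x] = q.[x]} -> horner_mx A p = horner_mx A q.
  move=> pq; apply/eqP; rewrite -subr_eq0 -rmorphB /=.
  have /dvdpP[r ->] : \prod_(x <- s) ('X - x%:P) %| p - q.
    apply: uniq_roots_dvdp; last by rewrite uniq_rootsE.
    by apply/allP => x xs; rewrite rootE hornerD hornerN pq// subrr.
  by rewrite rmorphM /= sA mulr0.
have [r rE] := interpolation (fun x => x^-1) us.
have [g gE] := interpolation (fun x => Num.sqrt (Num.sqrt x^-1)) us.
pose mA p := horner_mx A p.
have mAM p q : mA p *m mA q = mA (p * q) by rewrite /mA rmorphM.
have mAX : A = mA 'X by rewrite /mA horner_mx_X.
exists (mA r), (mA (g * g)); split; split.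
- rewrite {1 2 3}mAX !mAM; apply: eqA => x xs; rewrite !hornerE rE//.
  by have [->|x0] := eqVneq x 0; rewrite ?mulr0 ?mul0r// divfK.
- rewrite {1}mAX !mAM; apply: eqA => x xs; rewrite !hornerE rE//.
  by have [->|x0] := eqVneq x 0; rewrite ?invr0 ?mulr0 ?mul0r// mulVf// mul1r.
- by rewrite {1 2}mAX !mAM horner_mx_sym.
- by rewrite {1 2}mAX !mAM horner_mx_sym.
- exact: horner_mx_sym.
- move=> u; rewrite -mAM -mulmxA inner_mulmx horner_mx_sym; exact: inner_ge0.
- rewrite mAM; apply: eqA => x xs; rewrite !hornerE gE// rE//.
  have xi : 0 <= x^-1 by rewrite invr_ge0 s0.
  transitivity ((Num.sqrt (Num.sqrt x^-1) ^+ 2) ^+ 2); first by rewrite /=; ring.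
  by rewrite !sqr_sqrtr ?sqrtr_ge0.
Qed.

End symmetric_polynomial_calculus.

Lemma penrose_sqrt_exists {R : realType} {d : nat} (A : 'M[R]_d) :
  A^T = A -> (forall u : 'cV[R]_d, 0 <= inner u (A *m u)) ->
  exists B S : 'M[R]_d, penrose A B /\ is_sym_sqrt B S.
Proof.
case: d A => [|d] A sA pA; last exact: penrose_sqrt_exists_pos.
have M0 (M N : 'M[R]_0) : M = N by apply/matrixP => -[].
exists 0, 0; split; split; try exact: M0.
by move=> u; rewrite innerE big_ord0.
Qed.

Lemma penrose_uniq {R : realType} {d : nat} (A B C : 'M[R]_d) :
  penrose A B -> penrose A C -> B = C.
Proof.
move=> [ABA BAB sAB sBA] [ACA CAC sAC sCA].
have e1 : A *m B = A *m C.
  rewrite -{1}ACA -[A *m C *m A *m B]mulmxA -{1}sAC -sAB -trmx_mul.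
  by rewrite mulmxA ABA sAC.
have e2 : B *m A = C *m A.
  rewrite -{1}ACA -[A *m C *m A]mulmxA mulmxA -{1}sBA -sCA -trmx_mul.
  by rewrite -mulmxA (mulmxA A) ABA sCA.
by rewrite -BAB e2 -mulmxA e1 mulmxA CAC.
Qed.

Lemma moore_penrose_sqrtP {R : realType} {d : nat} (A : 'M[R]_d) :
  A^T = A -> (forall u : 'cV[R]_d, 0 <= inner u (A *m u)) ->
  penrose A (moore_penrose A) /\
  is_sym_sqrt (moore_penrose A) (sym_sqrt (moore_penrose A)).
Proof.
move=> sA pA; have [B [S [AB BS]]] := penrose_sqrt_exists sA pA.
have MP : penrose A (moore_penrose A) by exact: (xgetPex 0 (ex_intro _ B AB)).
split => //; rewrite (penrose_uniq MP AB).
exact: (xgetPex 0 (ex_intro _ S BS)).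
Qed.

(** * Whitening *)

Lemma measurable_Rvec_coord {R : realType} {d : nat} (i : 'I_d) :
  measurable_fun setT (fun x : Rvec R d => (x : 'cV[R]_d) i 0).
Proof.
apply: (measurability (@RGenOInfty.G R)); first exact: RGenOInfty.measurableE.
move=> _ [_ [a ->] <-]; rewrite setTI; apply: sub_sigma_algebra.
apply: (@open_comp _ _ (fun x : 'cV[R]_d => x i 0)) => [x _|].
  exact: coord_continuous.
rewrite set_itvE; exact: open_gt.
Qed.

Lemma measurable_Rvec_inner {R : realType} {d : nat} (u : 'cV[R]_d) :
  measurable_fun setT (fun x : Rvec R d => inner u x).
Proof.
apply: measurable_inner => i; first exact: measurable_cst.
exact: measurable_Rvec_coord.
Qed.

Lemma measurable_Rvec_mulmx_coord {R : realType} {d : nat} (M : 'M[R]_d) (i : 'I_d) :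
  measurable_fun setT (fun x : Rvec R d => (M *m (x : 'cV[R]_d)) i 0).
Proof.
rewrite (_ : (fun x => _) = fun x : Rvec R d => \sum_j M i j * (x : 'cV[R]_d) j 0).
  apply: measurable_sum => j; apply: measurable_funM => //.
  exact: measurable_Rvec_coord.
by apply/funext => x; rewrite mxE.
Qed.

Section whitening.
Context {R : realType} {dT : measure_display} {T : measurableType dT}
  {P : probability T R} {d : nat} {X : {RV P >-> Rvec R d}}.
Hypothesis X2 : square_integrable X.
Implicit Types (u v theta : 'cV[R]_d).

Lemma measurable_RV_inner (Z : {RV P >-> Rvec R d}) u :
  measurable_fun setT (fun w => inner u (Z w)).
Proof. exact: (measurableT_comp (measurable_Rvec_inner u)). Qed.

Let mc i : measurable_fun setT (fun w => (X w : 'cV[R]_d) i 0).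
Proof. exact: (measurableT_comp (measurable_Rvec_coord i)). Qed.

Lemma integrable_coord_prod i j :
  P.-integrable setT (EFin \o (fun w => (X w : 'cV[R]_d) i 0 * (X w : 'cV[R]_d) j 0)).
Proof.
have sqE w : enorm (X w) ^+ 2 = inner (X w) (X w) by rewrite sqr_sqrtr// inner_ge0.
have mI : measurable_fun setT (fun w => inner (X w) (X w)) by exact: measurable_inner.
have : P.-integrable setT (EFin \o (fun w => inner (X w) (X w))).
  apply: ge0_lty_integrable => // [w|]; first exact: inner_ge0.
  move: X2; rewrite /square_integrable unlock; congr (_ < _)%E.
  by apply: eq_integral => w _; rewrite sqE.
apply: le_integrable => //.
  by apply/measurable_EFinP; exact: measurable_funM.
move=> w _; rewrite lee_fin [leRHS]ger0_norm ?inner_ge0// normrM.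
have sub k : (X w : 'cV[R]_d) k 0 ^+ 2 <= inner (X w) (X w).
  rewrite innerE (bigD1 k)//= -expr2 lerDl sumr_ge0// => l _.
  by rewrite -expr2 sqr_ge0.
have := sub i; have := sub j; rewrite -(real_normK (num_real (X w i 0))).
rewrite -(real_normK (num_real (X w j 0))) => h1 h2.
have := sqr_ge0 (`|X w i 0| - `|X w j 0|); rewrite sqrrB; nra.
Qed.

Lemma integral_inner_prod u v :
  (\int[P]_w (inner u (X w) * inner v (X w))%:E = (inner u (gram X *m v))%:E)%E.
Proof.
transitivity (\int[P]_w (\sum_i \sum_j (u i 0 * v j 0)%:E *
    ((X w : 'cV[R]_d) i 0 * (X w : 'cV[R]_d) j 0)%:E))%E.
  apply: eq_integral => w _; rewrite !innerE mulr_suml -sumEFin.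
  apply: eq_bigr => i _; rewrite mulr_sumr -sumEFin; apply: eq_bigr => j _.
  by rewrite -EFinM mulrACA.
have iZ i j : P.-integrable setT (fun w => (u i 0 * v j 0)%:E *
    ((X w : 'cV[R]_d) i 0 * (X w : 'cV[R]_d) j 0)%:E)%E.
  exact: integrableZl (integrable_coord_prod i j).
rewrite integral_sum//; last by move=> i; exact: integrable_sum.
rewrite innerE -sumEFin; apply: eq_bigr => i _.
rewrite integral_sum// mxE mulr_sumr -sumEFin; apply: eq_bigr => j _.
rewrite integralZl//; last exact: integrable_coord_prod.
rewrite mxE unlock -[X in (_ * X)%E]fineK; last first.
  exact: (integrable_fin_num _ (integrable_coord_prod i j)).
by rewrite -EFinM; congr _%:E; ring.
Qed.

Lemma Nform_gram theta : Nform X theta = (inner theta (gram X *m theta))%:E.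
Proof.
rewrite -integral_inner_prod /Nform unlock.
by apply: eq_integral => w _; rewrite expr2.
Qed.

Lemma gram_sym : (gram X)^T = gram X.
Proof.
apply/matrixP => i j; rewrite !mxE; congr fine; congr expectation.
by apply/funext => w; rewrite mulrC.
Qed.

Lemma gram_psd u : 0 <= inner u (gram X *m u).
Proof.
rewrite -lee_fin -integral_inner_prod; apply: integral_ge0 => w _.
by rewrite lee_fin -expr2 sqr_ge0.
Qed.

Local Notation G := (gram X).
Local Notation B := (moore_penrose (gram X)).
Local Notation S := (gram_inv_sqrt X).

Let penG : penrose G B.
Proof. by have [] := moore_penrose_sqrtP gram_sym gram_psd. Qed.

Let sS : S^T = S.
Proof. by have [_ []] := moore_penrose_sqrtP gram_sym gram_psd. Qed.

Let SS : S *m S = B.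
Proof. by have [_ []] := moore_penrose_sqrtP gram_sym gram_psd. Qed.

Definition whiten (x : Rvec R d) : 'cV[R]_d := S *m (x : 'cV[R]_d).

(** The coefficient vector of theta in whitened coordinates, see
    whitened_coefE. *)
Definition whitened_coef theta : 'cV[R]_d := S *m (G *m theta).

Lemma whitened_norm_sqr w : whitened_norm X w ^+ 2 = inner (whiten (X w)) (whiten (X w)).
Proof. by rewrite sqr_sqrtr// inner_ge0. Qed.

Lemma measurable_whiten i : measurable_fun setT (fun x => whiten x i 0).
Proof. exact: measurable_Rvec_mulmx_coord. Qed.

Lemma whitened_coef_norm theta :
  inner (whitened_coef theta) (whitened_coef theta) = inner theta (G *m theta).
Proof.
have [GBG _ _ _] := penG.
rewrite /whitened_coef inner_mulmx sS (mulmxA S) SS inner_mulmx gram_sym.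
by rewrite !mulmxA GBG innerC.
Qed.

Lemma whitened_coefE theta (x : Rvec R d) : G *m B *m (x : 'cV[R]_d) = x ->
  inner (whitened_coef theta) (whiten x) = inner theta x.
Proof.
move=> GBx; rewrite /whiten inner_mulmx sS /whitened_coef mulmxA SS -[in RHS]GBx.
by rewrite [RHS]inner_mulmx trmx_mul gram_sym -SS trmx_mul sS !mulmxA.
Qed.

Lemma whitened_second_moment theta :
  (\int[P]_w (inner (whitened_coef theta) (whiten (X w)) ^+ 2)%:E =
   (inner (whitened_coef theta) (whitened_coef theta))%:E)%E.
Proof.
have [GBG _ _ _] := penG.
have sB : B^T = B by rewrite -SS trmx_mul sS.
under eq_integral do rewrite expr2 /whiten inner_mulmx sS.
rewrite integral_inner_prod whitened_coef_norm; congr _%:E.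
rewrite /whitened_coef !(mulmxA S) SS inner_mulmx gram_sym !mulmxA GBG.
by rewrite inner_mulmx trmx_mul gram_sym sB !mulmxA GBG innerC.
Qed.

(** S *m G *m S is the orthogonal projection on the range of G. *)
Lemma whitened_contraction v : inner (S *m v) (G *m (S *m v)) <= inner v v.
Proof.
pose w := whitened_coef (S *m v); rewrite -whitened_coef_norm -/w.
have ww : inner w w = inner v w.
  by rewrite [LHS]whitened_coef_norm [in RHS]/w /whitened_coef [RHS]inner_mulmx sS.
have := inner_ge0 (v + (-1) *: w); rewrite !(innerDl, innerDr) !(innerZl, innerZr).
by rewrite (innerC w v) ww; lra.
Qed.

Lemma whitened_fourth_moment (kappa : R) v : (kurtosis_sup X <= kappa%:E)%E ->
  (\int[P]_w (inner v (whiten (X w)) ^+ 4)%:E <= (kappa * inner v v ^+ 2)%:E)%E.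
Proof.
move=> kurt; have [v0|vn0] := eqVneq (inner v v) 0.
  rewrite v0 expr0n mulr0 (inner_eq0 v0).
  by rewrite integral0_eq// => w _; rewrite inner0l expr0n.
have vp : 0 < inner v v by rewrite lt_def vn0 inner_ge0.
pose c := (Num.sqrt (inner v v))^-1.
have c2 : c ^+ 2 = (inner v v)^-1 by rewrite /c exprVn sqr_sqrtr// ltW.
have c4 : c ^+ 4 = (inner v v ^+ 2)^-1 by rewrite -[4%N]/(2 * 2)%N exprM c2 exprVn.
have N1 : (Nform X (c *: (S *m v)) <= 1)%E.
  rewrite Nform_gram lee_fin -scalemxAr innerZl innerZr mulrA -expr2 c2.
  by rewrite mulrC ler_pdivrMr// mul1r whitened_contraction.
have : (\int[P]_w (c ^+ 4 * inner (S *m v) (X w) ^+ 4)%:E <= kappa%:E)%E.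
  apply: le_trans kurt; apply: ereal_sup_ubound; exists (c *: (S *m v)) => //.
  by rewrite unlock; apply: eq_integral => w _; rewrite innerZl exprMn.
under eq_integral do rewrite EFinM.
rewrite ge0_integralZl_EFin//; last 3 first.
- by move=> w _; rewrite lee_fin exprn_even_ge0.
- by apply/measurable_EFinP/measurable_funX; exact: measurable_RV_inner.
- by rewrite c4 invr_ge0 sqr_ge0.
have -> : (\int[P]_w (inner v (whiten (X w)) ^+ 4)%:E =
           \int[P]_w (inner (S *m v) (X w) ^+ 4)%:E)%E.
  by apply: eq_integral => w _; rewrite /whiten inner_mulmx sS.
rewrite c4 muleC lee_pdivrMr ?exprn_gt0// EFinM; done.
Qed.

Lemma measurable_off_gram_range :
  measurable [set x : Rvec R d | G *m B *m (x : 'cV[R]_d) != x].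
Proof.
pose f (x : Rvec R d) := inner ((G *m B - 1%:M) *m (x : 'cV[R]_d)) ((G *m B - 1%:M) *m (x : 'cV[R]_d)).
have mf : measurable_fun setT f.
  by apply: measurable_inner => i; exact: measurable_Rvec_mulmx_coord.
rewrite (_ : [set x | _] = f @^-1` (~` [set 0])).
  by rewrite -[X in measurable X]setTI; apply: mf => //; exact: measurableC.
apply/seteqP; split => x /= h.
  move=> /inner_eq0; rewrite mulmxBl mul1mx => /eqP; rewrite subr_eq0.
  by rewrite (negbTE h).
apply/eqP => e; apply: h; rewrite /f mulmxBl mul1mx e subrr; exact: inner0l.
Qed.

(** X lies almost surely in the range of its second moment matrix, because
    the quadratic form vanishes in the directions orthogonal to it. *)
Lemma ae_in_gram_range :
  P (X @^-1` [set x : Rvec R d | G *m B *m (x : 'cV[R]_d) != x]) = 0.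
Proof.
have [GBG _ _ _] := penG; pose M := G *m B - 1%:M.
have MG : M *m G = 0 by rewrite mulmxBl mul1mx GBG subrr.
pose f w := inner (M *m X w) (M *m X w).
have mf : measurable_fun setT f.
  by apply: measurable_inner => i; apply: (measurableT_comp (measurable_Rvec_mulmx_coord M i)).
have f0 : (\int[P]_w `|(f w)%:E| = 0)%E.
  transitivity (\int[P]_w (\sum_i (inner (M^T *m delta_mx i 0) (X w) ^+ 2)%:E))%E.
    apply: eq_integral => w _; rewrite gee0_abs ?lee_fin ?inner_ge0//.
    rewrite /f innerE -sumEFin; apply: eq_bigr => i _.
    by rewrite -[M]trmxK -inner_mulmx trmxK inner_delta expr2.
  rewrite ge0_integral_sum//; last 2 first.
  - by move=> i; apply/measurable_EFinP/measurable_funX; exact: measurable_RV_inner.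
  - by move=> i w _; rewrite lee_fin sqr_ge0.
  rewrite big1// => i _; under eq_integral do rewrite expr2.
  rewrite integral_inner_prod -inner_mulmx !mulmxA MG !mul0mx innerC.
  by rewrite inner0l.
have mfE : measurable_fun setT (EFin \o f) by exact/measurable_EFinP.
have /(ae_eq_integral_abs P measurableT mfE) := f0.
case=> N [mN PN0 sub]; apply/eqP; rewrite -measure_le0 -PN0.
apply: le_measure; rewrite ?inE//.
  rewrite -[X in measurable X]setTI; apply: measurable_funPT => //.
  exact: measurable_off_gram_range.
move=> w /= h; apply: sub => /= /(_ I) [] /inner_eq0.
rewrite mulmxBl mul1mx => /eqP; rewrite subr_eq0 => /eqP e.
by rewrite e eqxx in h.
Qed.

End whitening.

Arguments whiten {R dT T P d} X x.
Arguments whitened_coef {R dT T P d} X theta.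

(** * Consequences of the sample size condition *)

Lemma sqrtr_divr {R : realType} (x y : R) : 0 <= y ->
  Num.sqrt (x / y) = Num.sqrt x / Num.sqrt y.
Proof. by move=> y0; rewrite mulrC sqrtrM ?invr_ge0// sqrtrV// mulrC. Qed.

Section sample_size.
Context {R : realType} (d n : nat) (kappa eps : R).
Hypothesis kappa1 : 1 < kappa.
Hypothesis size : sample_size_lb d kappa eps < n%:R.
Local Notation L := (log_term d eps).
Local Notation mu := (mu_bound d n kappa eps).
Local Notation delta := (delta_hat d n kappa eps).
Local Notation a := (Num.sqrt (2 * (kappa - 1) / n%:R * L)).
Local Notation c := (Num.sqrt (kappa * d%:R / n%:R)).

Lemma sample_size_gt0 : 0 < n%:R :> R.
Proof. by apply: le_lt_trans size; rewrite sqr_ge0. Qed.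

(** The sample size condition divided by sqrt n. *)
Lemma sample_size_normalized : 20 * c + (5 / 2 + (2 * (kappa - 1))^-1) * a < 1.
Proof.
have n0 := sample_size_gt0; have k1 : 0 < kappa - 1 by rewrite subr_gt0.
have r0 : 0 < Num.sqrt n%:R :> R by rewrite sqrtr_gt0.
rewrite (mulrAC _ _ L) !sqrtr_divr// !mulrA -mulrDl ltr_pdivrMr// mul1r.
set x := _ + _; have x0 : 0 <= x.
  by rewrite addr_ge0 ?mulr_ge0 ?sqrtr_ge0// addr_ge0 ?divr_ge0// invr_ge0 mulr_ge0// ltW.
rewrite -ltr_sqr ?nnegrE ?(ltW r0)// sqr_sqrtr ?(ltW n0)//; exact: size.
Qed.

Lemma mu_boundE : mu = a + 681 / 100 * (Num.sqrt 2 * c).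
Proof. by rewrite /mu_bound -sqrtrM// !mulrA. Qed.

Lemma sqrt2_le : Num.sqrt 2 <= 283 / 200 :> R.
Proof.
have := sqr_sqrtr (ler0n R 2); have := sqrtr_ge0 (2 : R).
move: (Num.sqrt _) => x x0; rewrite expr2 leNgt => x2; apply/negP => h.
have : 0 < (x - 283 / 200) * (x + 283 / 200) by apply: mulr_gt0; lra.
lra.
Qed.

Lemma mu_bound_ge0 : 0 <= mu.
Proof.
apply: addr_ge0; first exact: sqrtr_ge0.
by apply: mulr_ge0; [lra|exact: sqrtr_ge0].
Qed.

(** The constant is an upper bound of 6.81 * 2 * sqrt 2 / 20. *)
Lemma mu_bound_lt : 2 * mu <= 97 / 100.
Proof.
have := sample_size_normalized; rewrite mu_boundE.
have s2 := sqrt2_le.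
have : 0 <= a by exact: sqrtr_ge0.
have : 0 <= c by exact: sqrtr_ge0.
have : 0 <= (2 * (kappa - 1))^-1 by rewrite invr_ge0 mulr_ge0// subr_ge0 ltW.
move: a c (Num.sqrt 2) s2 => a' c' s s2; move: (_^-1) => k k0 c0 a0 h.
have : 0 <= k * a' by rewrite mulr_ge0.
have := ler_wpM2r c0 s2; move: (s * c') => sc; rewrite mulrDl in h; lra.
Qed.

Lemma delta_hat_ge_mu : mu <= delta.
Proof.
have m0 := mu_bound_ge0; have m1 := mu_bound_lt.
rewrite /delta_hat ler_pdivlMr; last by lra.
by have := sqr_ge0 mu; rewrite expr2; lra.
Qed.

Lemma delta_hat_ge0 : 0 <= delta.
Proof. exact: le_trans mu_bound_ge0 delta_hat_ge_mu. Qed.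

(** The squared norm that every whitened parameter is rescaled to: it balances
    the second order term (kappa - 1) lam / 2 with L / (n lam). *)
Definition penalty_scale : R := Num.sqrt (2 * L / ((kappa - 1) * n%:R)).
Local Notation lam := penalty_scale.

Section positive_log.
Hypothesis L0 : 0 <= L.

Lemma penalty_scale_sqr : lam ^+ 2 = 2 * L / ((kappa - 1) * n%:R).
Proof.
rewrite sqr_sqrtr// divr_ge0 ?mulr_ge0// ?subr_ge0 ltW//.
Qed.

Lemma sqrt_log_penalty_scale : a = (kappa - 1) * lam.
Proof.
have n0 := sample_size_gt0; have k1 : 0 < kappa - 1 by rewrite subr_gt0.
have s0 : 0 <= (kappa - 1) * lam by rewrite mulr_ge0 ?sqrtr_ge0// ltW.
rewrite -[RHS](ger0_norm s0) -sqrtr_sqr exprMn penalty_scale_sqr; congr Num.sqrt.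
by field; rewrite !gt_eqF.
Qed.

Lemma gamma_minusE : gamma_minus d n kappa eps = lam ^+ 2 / 3.
Proof.
have n0 := sample_size_gt0; have k1 : 0 < kappa - 1 by rewrite subr_gt0.
by rewrite penalty_scale_sqr /gamma_minus; field; rewrite !gt_eqF.
Qed.

(** With gamma = lam^2 / 3 the inequality mu + gamma / 2 <= lower_dev amounts to
    mu^2 + (gamma / 2) (1 - 3 mu) >= 0, which holds for gamma <= 1; when
    gamma > 1 the lower deviation exceeds 1. *)
Lemma lower_dev_ge (r : R) : 0 <= r ->
  1 - r <= mu + lam ^+ 2 / 6 -> 1 - r <= lower_dev d n kappa eps.
Proof.
move=> r0 h; have m0 := mu_bound_ge0; have m1 := mu_bound_lt.
have -> : lower_dev d n kappa eps = (mu + lam ^+ 2 / 3 * (1 - 2 * mu)) / (1 - mu).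
  by rewrite /lower_dev gamma_minusE /delta_hat; field; apply/andP; split; lra.
rewrite ler_pdivlMr; last by lra.
have := sqr_ge0 lam; move: (lam ^+ 2) h => l h l0.
move: mu m0 m1 h => m m0 m1 h; have m2 : 0 <= 1 - m by lra.
have [l3|l3] := leP l 3; last first.
  have : 0 <= (l - 3) * (1 - 2 * m) by rewrite mulr_ge0//; lra.
  by have := mulr_ge0 r0 m2; lra.
have hm := ler_wpM2r m2 h.
have [m3|m3] := leP m 3^-1.
  have : 0 <= l * (1 - 3 * m) by rewrite mulr_ge0//; lra.
  by have := sqr_ge0 m; rewrite expr2; lra.
have : 0 <= (3 - l) * (3 * m - 1) by rewrite mulr_ge0//; lra.
have : 0 <= (1 - m) * (1 - 2 * m) by rewrite mulr_ge0//; lra.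
by lra.
Qed.

Lemma sqrt2_ge : 7 / 5 <= Num.sqrt 2 :> R.
Proof.
have := sqr_sqrtr (ler0n R 2); have := sqrtr_ge0 (2 : R).
move: (Num.sqrt _) => x x0; rewrite expr2 leNgt => x2; apply/negP => h.
have : 0 < (7 / 5 - x) * (x + 7 / 5) by apply: mulr_gt0; lra.
lra.
Qed.

(** The variance b^2 of the perturbation is chosen to balance the two terms of
    order c = sqrt (kappa d / n): with b^-2 = 9.2 c n they sum up to
    (42 / 9.2 + 4.6) c < 6.81 sqrt 2 c, while the quartic term is at most
    (61 / 9.2^2) d < 0.73 d. *)
Lemma noise_budget (b : R) : (0 < d)%N -> 0 < lam -> b ^+ 2 = (46 / 5 * (c * n%:R))^-1 ->
  n%:R * ((kappa - 1) * lam ^+ 2 / 2 + 42 * (kappa * d%:R * lam * b ^+ 2)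
          + 61 * (kappa * d%:R ^+ 2 * b ^+ 4)) + lam / (2 * b ^+ 2) + ln eps^-1
  <= n%:R * lam * mu.
Proof.
move=> d0 lam0 bE; have n0 := sample_size_gt0.
have k1 : 0 < kappa - 1 by rewrite subr_gt0.
have dR : 0 < d%:R :> R by rewrite ltr0n.
have k0 : 0 < kappa by exact: lt_trans kappa1.
have c2 : kappa * d%:R = c ^+ 2 * n%:R.
  rewrite sqr_sqrtr ?divfK ?gt_eqF//; exact: ltW (divr_gt0 (mulr_gt0 k0 dR) n0).
have c0 : 0 < c by rewrite sqrtr_gt0; exact: divr_gt0 (mulr_gt0 k0 dR) n0.
rewrite mu_boundE sqrt_log_penalty_scale.
have -> : b ^+ 4 = (b ^+ 2) ^+ 2 by rewrite -exprM.
rewrite bE (expr2 d%:R) (mulrA kappa).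
move: c c0 c2 {bE} => x x0 c2; rewrite c2.
have LE : n%:R * ((kappa - 1) * lam ^+ 2) = 2 * ln eps^-1 + 2 * (73 / 100) * d%:R.
  by rewrite penalty_scale_sqr /log_term; field; rewrite !gt_eqF.
have s2 := sqrt2_ge.
move: (ln _) LE => l LE.
move: (Num.sqrt 2) s2 => s s2.
rewrite [leLHS](_ : _ = n%:R * ((kappa - 1) * lam ^+ 2) / 2
   + (42 * 5 / 46 + 23 / 5) * (n%:R * (lam * x)) + 61 * 25 / (46 * 46) * d%:R + l); last first.
  by field; rewrite !gt_eqF.
rewrite [leRHS](_ : _ = n%:R * ((kappa - 1) * lam ^+ 2) + 681 / 100 * (s * (n%:R * (lam * x))));
  last by ring.
have q0 : 0 <= n%:R * (lam * x) by rewrite !mulr_ge0// ltW.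
have := ler_wpM2r q0 s2; rewrite LE; move: (n%:R * (lam * x)) q0 => q q0.
by have := ltW dR; move: (s * q) (d%:R : R) => sq dd; lra.
Qed.

End positive_log.

End sample_size.

(** * Deviations in whitened coordinates *)

Section deviation.
Context {R : realType} {dT : measure_display} {T : measurableType dT}
  {P : probability T R} {d n : nat} {X : {RV P >-> Rvec R d}}
  {Xs : 'I_n -> {RV P >-> Rvec R d}} {kappa eps p : R}.
Hypothesis iid : iid_copies X Xs.
Hypothesis X2 : square_integrable X.
Hypothesis kappa1 : 1 < kappa.
Hypothesis kurt : (kurtosis_sup X <= kappa%:E)%E.
Hypothesis eps0 : 0 < eps.
Hypothesis size : sample_size_lb d kappa eps < n%:R.
Hypothesis p12 : 1 < p <= 2.

Local Notation lam := (penalty_scale d n kappa eps).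
Local Notation mu := (mu_bound d n kappa eps).
Local Notation delta := (delta_hat d n kappa eps).
Local Notation gamma := (gamma_plus_tilde X n kappa eps p).

Let n0 : 0 < n%:R :> R. Proof. exact: sample_size_gt0 size. Qed.

Definition excess (x : Rvec R d) : R :=
  pospart ((1 + delta) * inner (whiten X x) (whiten X x) - 1) `^ (p + 1).

Lemma excess_ge0 x : 0 <= excess x.
Proof. exact: powR_ge0. Qed.

Lemma measurable_excess : measurable_fun setT excess.
Proof.
have : measurable_fun setT (fun x : Rvec R d =>
    pospart ((1 + delta) * inner (whiten X x) (whiten X x) - 1)); last first.
  exact: (measurableT_comp (measurable_powR (p + 1))).
apply: measurable_maxr => //; apply: measurable_funB => //.
by apply: measurable_funM => //; apply: measurable_inner => i; exact: measurable_whiten.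
Qed.

Lemma gamma_plus_tildeE : gamma =
  ((gamma_plus_factor d n kappa eps p)%:E * (\int[P]_w (excess (X w))%:E +
    (\int[P]_w (excess (X w) ^+ 2)%:E / (n%:R * eps)%:E) `^ (2^-1)))%E.
Proof.
rewrite /gamma_plus_tilde.
have -> : ('E_P[fun w => (pospart ((1 + delta) * whitened_norm X w ^+ 2 - 1) `^ (p + 1))%R] =
    \int[P]_w (excess (X w))%:E)%E.
  by rewrite unlock; apply: eq_integral => w _; rewrite whitened_norm_sqr.
have -> // : ('E_P[fun w => (pospart ((1 + delta) * whitened_norm X w ^+ 2 - 1) `^ (2 * p + 2))%R] =
    \int[P]_w (excess (X w) ^+ 2)%:E)%E.
rewrite unlock; apply: eq_integral => w _.
rewrite whitened_norm_sqr -powR_mulrn ?powR_ge0// -powRrM.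
by rewrite (_ : (p + 1) * 2 = 2 * p + 2)//; ring.
Qed.

Lemma gamma_plus_factor_ge0 : 0 <= gamma_plus_factor d n kappa eps p.
Proof. by rewrite mulr_ge0 ?powR_ge0// invr_ge0; move: p12 => /andP[]; lra. Qed.

Lemma gamma_plus_tilde_ge0 : (0 <= gamma)%E.
Proof.
rewrite gamma_plus_tildeE mule_ge0 ?lee_fin ?gamma_plus_factor_ge0//.
rewrite adde_ge0 ?poweR_ge0// integral_ge0// => w _; rewrite lee_fin; exact: excess_ge0.
Qed.

(** Where the denominator of the upper deviation does not vanish it is at most
    1 while delta_hat dominates mu; where it vanishes the quotient is +oo. *)
Lemma upper_dev_ge (x : R) : delta <= 1 -> (x%:E <= mu%:E + gamma)%E ->
  (x%:E <= upper_dev X n kappa eps p)%E.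
Proof.
move=> d1 xle; have d0 := delta_hat_ge0 kappa1 size; have md := delta_hat_ge_mu kappa1 size.
have {}xle : (x%:E <= delta%:E + gamma)%E.
  by apply: (le_trans xle); apply: leeD; rewrite ?lee_fin.
rewrite /upper_dev; move: gamma_plus_tilde_ge0 xle; case: gamma => [g| |]//; last first.
  move=> _ _; rewrite addeNy /epospart (_ : maxe -oo 0 = 0)%E; last by rewrite /maxe ltNy0.
  by rewrite mule0 addey// /cdiv /= inve0 mulyy leey.
rewrite lee_fin => g0; rewrite -!EFinD lee_fin => xle.
have -> : (epospart (1 - g)%:E = (Num.max (1 - g) 0)%:E)%E by rewrite /epospart -EFin_max.
rewrite -EFinM /cdiv !eqe; set D := (1 - delta) * _.
have D0 : 0 <= D by rewrite mulr_ge0 ?le_max ?lexx ?orbT// subr_ge0.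
have D1 : D <= 1.
  rewrite -[leRHS]mulr1 ler_pM ?le_max ?lexx ?orbT ?subr_ge0//; first by lra.
  by rewrite ge_max ler01 andbT; lra.
have [D0'|Dn0] := eqVneq D 0.
  have dg : delta + g != 0.
    apply/eqP => dg; have g00 : g = 0 by lra. have d00 : delta = 0 by lra.
    by move: D0'; rewrite /D g00 d00 !subr0 mul1r max_l// => /eqP; rewrite oner_eq0.
  rewrite (negbTE dg)/= D0' inve0 mulry gtr0_sg ?mul1e ?leey//.
  by rewrite lt_def dg addr_ge0.
rewrite andbF inver (negbTE Dn0) -EFinM lee_fin.
have Dp : 0 < D by rewrite lt_def Dn0.
rewrite ler_pdivlMr//; apply: le_trans (_ : (delta + g) * D <= _); last first.
  by rewrite ler_piMr// addr_ge0.
by rewrite ler_wpM2r.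
Qed.

Section large_log.
Hypothesis L0 : 0 < log_term d eps.

Let lam0 : 0 < lam.
Proof.
rewrite sqrtr_gt0 divr_gt0 ?mulr_gt0// ?subr_gt0//.
Qed.

(** By the Cauchy-Schwarz inequality <theta, Y>^2 - lam <= lam (|Y|^2 - 1), and
    the right-hand side does not depend on the direction of theta. *)
Lemma excess_dominates (theta : 'cV[R]_d) (x : Rvec R d) : inner theta theta = lam ->
  Num.max (inner theta (whiten X x) ^+ 2 - lam) 0 `^ (p + 1) <= lam `^ (p + 1) * excess x.
Proof.
move=> tl; have /andP[p1 _] := p12; have d0 := delta_hat_ge0 kappa1 size.
rewrite -powRM ?(ltW lam0)//; last by rewrite le_max lexx orbT.
have m0 y : 0 <= Num.max y 0 :> R by rewrite le_max lexx orbT.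
apply: ge0_ler_powR; rewrite ?nnegrE ?m0//; first by lra.
  by rewrite mulr_ge0 ?m0// ltW.
rewrite ge_max mulr_ge0 ?m0 ?(ltW lam0)// andbT.
apply: (@le_trans _ _ (lam * ((1 + delta) * inner (whiten X x) (whiten X x) - 1))).
  have := inner_cauchy_schwarz theta (whiten X x); rewrite tl.
  have : 0 <= lam * (delta * inner (whiten X x) (whiten X x)).
    exact: mulr_ge0 (ltW lam0) (mulr_ge0 d0 (inner_ge0 _)).
  move: (inner _ _ ^+ 2) (inner (whiten X x) _) => a b; lra.
by rewrite ler_wpM2l ?(ltW lam0)// le_max lexx.
Qed.

Variables (dO : measure_display) (O : measurableType dO) (nu : probability O R)
  (eta : O -> 'cV[R]_d) (tau : 'cV[R]_d -> O -> O) (rho : O -> O).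
Hypothesis noise : gaussian_noise nu eta tau rho.

(** The value of b required by noise_budget. *)
Definition noise_scale : R :=
  Num.sqrt (46 / 5 * (Num.sqrt (kappa * d%:R / n%:R) * n%:R))^-1.
Local Notation Z sg w :=
  (@partition_function R _ _ _ _ P n d X Xs (whiten X) _ _ nu eta sg lam noise_scale w).

Lemma whitened_deviation (sg : R) (w : T) (theta : 'cV[R]_d) (g : 'I_n -> R) :
  sg ^+ 2 = 1 -> inner theta (gram X *m theta) = lam -> (Z sg w <= eps^-1%:E)%E ->
  (forall i, parabola_minorant (g i)
     (sg * (inner (whitened_coef X theta) (whiten X (Xs i w)) ^+ 2 - lam))) ->
  \sum_(i < n) g i <= n%:R * lam * mu.
Proof.
move=> sg1 tl Zle gpar.
(* in dimension 0 no vector has squared norm lam > 0 *)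
have d0 : (0 < d)%N.
  case: (posnP d) => // d00; move: lam0; rewrite -tl innerE big1 ?ltxx// => i.
  by have := ltn_ord i; rewrite {2}d00.
have k0 : 0 < kappa by exact: lt_trans kappa1.
have b2 : noise_scale ^+ 2 = (46 / 5 * (Num.sqrt (kappa * d%:R / n%:R) * n%:R))^-1.
  by rewrite sqr_sqrtr.
have b0 : noise_scale != 0.
  rewrite -sqrf_eq0 b2 gt_eqF// invr_gt0; apply: mulr_gt0; first by lra.
  apply: mulr_gt0 => //; rewrite sqrtr_gt0; apply: divr_gt0 => //.
  by apply: mulr_gt0; rewrite ?ltr0n.
apply: le_trans (noise_budget kappa1 size (ltW L0) d0 lam0 b2).
apply: (pac_bayes_bound _ _ noise sg1 b0 _ _ eps0 Zle gpar).
- exact: measurable_whiten.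
- by move=> v; exact: whitened_fourth_moment.
- by rewrite whitened_coef_norm.
- by rewrite whitened_second_moment// whitened_coef_norm// tl.
Qed.

Local Notation M w v := (n%:R^-1 * \sum_(i < n) inner v (whiten X (Xs i w)) ^+ 2).

Lemma whitened_lower_deviation (w : T) (theta : 'cV[R]_d) :
  inner theta (gram X *m theta) = lam -> (Z (-1) w <= eps^-1%:E)%E ->
  lam - M w (whitened_coef X theta) <= lam * (mu + lam ^+ 2 / 6).
Proof.
move=> tl Zle; pose t i := -1 * (inner (whitened_coef X theta) (whiten X (Xs i w)) ^+ 2 - lam).
have := whitened_deviation (g := fun i => t i - lam ^+ 3 / 6) _ tl Zle.
rewrite sqrrN expr1n => /(_ erefl) h.
have {h} : \sum_(i < n) (t i - lam ^+ 3 / 6) <= n%:R * lam * mu.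
  apply: h => i; apply: parabola_minorant_lower; first exact: ltW.
  by rewrite /t mulN1r opprB; have := sqr_ge0 (inner (whitened_coef X theta) (whiten X (Xs i w))); lra.
rewrite sumrB sumr_const card_ord -mulr_sumr sumrB sumr_const card_ord.
rewrite -[lam *+ _]mulr_natl -[(_ / 6) *+ _]mulr_natl => h.
rewrite -(ler_pM2l n0) mulrBr mulVKf ?gt_eqF//.
by move: h; rewrite !exprS expr0; lra.
Qed.

Lemma whitened_upper_deviation (w : T) (theta : 'cV[R]_d) :
  inner theta (gram X *m theta) = lam -> (Z 1 w <= eps^-1%:E)%E ->
  M w (whitened_coef X theta) - lam <= lam *
   (mu + gamma_plus_factor d n kappa eps p * (n%:R^-1 * \sum_(i < n) excess (Xs i w))).
Proof.
move=> tl Zle; have /andP[p1 _] := p12; have pp : 0 < p + 1 by lra.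
pose t i := 1 * (inner (whitened_coef X theta) (whiten X (Xs i w)) ^+ 2 - lam).
have := whitened_deviation (g := fun i => t i - Num.max (t i) 0 `^ (p + 1) / (p + 1)) _ tl Zle.
rewrite expr1n => /(_ erefl) h.
have {h} h : \sum_(i < n) (t i - Num.max (t i) 0 `^ (p + 1) / (p + 1)) <= n%:R * lam * mu.
  by apply: h => i; apply: parabola_minorant_upper.
have fE : gamma_plus_factor d n kappa eps p = (p + 1)^-1 * lam `^ p.
  rewrite /gamma_plus_factor -penalty_scale_sqr// ?(ltW L0)//; congr (_ * _).
  by rewrite -powR_mulrn ?(ltW lam0)// -powRrM; congr (_ `^ _); field.
have lp : lam `^ (p + 1) = lam * lam `^ p.
  by rewrite powRD ?powRr1 ?(ltW lam0)// 1?mulrC// gt_eqF ?implybT// gt_eqF.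
have ex : \sum_(i < n) Num.max (t i) 0 `^ (p + 1) <= lam * lam `^ p * \sum_(i < n) excess (Xs i w).
  rewrite -lp mulr_sumr; apply: ler_sum => i _; rewrite /t mul1r.
  by apply: excess_dominates; rewrite whitened_coef_norm.
move: h; rewrite sumrB -mulr_suml => h.
have {}h : \sum_(i < n) t i <= n%:R * lam * mu + lam * lam `^ p * (\sum_(i < n) excess (Xs i w)) / (p + 1).
  rewrite -lerBlDr; apply: le_trans h; rewrite lerB// ler_wpM2r// invr_ge0 ltW//.
move: h; rewrite /t -mulr_sumr mul1r sumrB sumr_const card_ord -[lam *+ _]mulr_natl => h.
rewrite -(ler_pM2l n0) mulrBr mulVKf ?gt_eqF// fE.
apply: (le_trans h); rewrite le_eqVlt; apply/orP; left; apply/eqP; field.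
by rewrite !gt_eqF.
Qed.

End large_log.
End deviation.

(** * The deviation event *)

Section deviation_event.
Context {R : realType} {dT : measure_display} {T : measurableType dT}
  {P : probability T R} {d n : nat} {X : {RV P >-> Rvec R d}}
  {Xs : 'I_n -> {RV P >-> Rvec R d}} {kappa eps p : R}.
Hypothesis iid : iid_copies X Xs.
Hypothesis X2 : square_integrable X.
Hypothesis kappa1 : 1 < kappa.
Hypothesis kurt : (kurtosis_sup X <= kappa%:E)%E.
Hypothesis eps0 : 0 < eps.
Hypothesis size : sample_size_lb d kappa eps < n%:R.
Hypothesis p12 : 1 < p <= 2.

Lemma sample_in_gram_range : exists A, [/\ measurable A, P A = 1%E &
  forall w, A w -> forall theta i,
    inner (whitened_coef X theta) (whiten X (Xs i w)) = inner theta (Xs i w)].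
Proof.
pose off := [set x : Rvec R d | gram X *m moore_penrose (gram X) *m (x : 'cV[R]_d) != x].
have moff : measurable off by exact: measurable_off_gram_range.
have mpre i : measurable (Xs i @^-1` off).
  by rewrite -[X in measurable X]setTI; apply: measurable_funP.
pose B := \big[setU/set0]_(i < n) (Xs i @^-1` off).
have [mB PB] : measurable B /\ P B = 0%E.
  apply: (big_ind (fun C : set T => measurable C /\ P C = 0%E)) => [|C D [mC PC] [mD PD]|i _].
  - by split => //; exact: measure0.
  - by split; [exact: measurableU|rewrite measureU0].
  - split; first exact: mpre.
    by have := iid.2 i off moff; rewrite /distribution /pushforward => ->; exact: ae_in_gram_range.
exists (~` B); split; first exact: measurableC.
  by rewrite probability_setC// PB sube0.
move=> w Bw theta i; apply: whitened_coefE => //; apply/eqP; apply: contra_notT Bw => h.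
by rewrite /B (bigD1 i)//=; left.
Qed.

(** Two events of partition_function_event, one for each sign, and the event of
    iid_mean_upper_deviation lose at most 3 eps; the event of
    sample_in_gram_range loses nothing. Every theta with N(theta) > 0 is rescaled
    so that N(theta) = lam; if N(theta) = 0 the empirical form vanishes as well,
    and the ratio is 0 / 0 = 1. *)
Lemma deviation_event : exists A : set T,
  [/\ measurable A, ((1 - 3 * eps)%:E <= P A)%E &
    forall w, A w -> forall theta : 'cV[R]_d,
      let ratio := cdiv (empirical_Nform Xs w theta)%:E (Nform X theta) in
      ((- lower_dev d n kappa eps)%:E <= ratio - 1)%E
      /\ (delta_hat d n kappa eps <= 1 ->
          (ratio - 1 <= upper_dev X n kappa eps p)%E)].
Proof.
(* for eps >= 1 / 3 the empty event has the required probability *)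
have [he|he] := lerP 3^-1 eps.
  by exists set0; split => //; rewrite measure0 lee_fin; lra.
have L0 : 0 < log_term d eps.
  apply: ltr_wpDr; first by apply: mulr_ge0 => //; lra.
  by rewrite ln_gt0// invf_gt1//; lra.
have nR := sample_size_gt0 size; have n0 : (0 < n)%N by rewrite -(ltr0n R).
have lam0 : 0 < penalty_scale d n kappa eps.
  by rewrite sqrtr_gt0 divr_gt0 ?mulr_gt0// ?subr_gt0.
case: (gaussian_noise_exists R d) => dO; case=> O; case=> nu; case=> eta; case=> tau.
case=> rho noise.
have mom4 v := whitened_fourth_moment X2 v kurt.
have sgp : 1 ^+ 2 = 1 :> R by rewrite expr1n.
have sgm : (-1) ^+ 2 = 1 :> R by rewrite sqrrN expr1n.
have [A1 [mA1 PA1 hA1]] := partition_function_event iid (@measurable_whiten _ _ _ P d X)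
  mom4 noise (penalty_scale d n kappa eps) (@noise_scale R d n kappa) sgp eps0.
have [A2 [mA2 PA2 hA2]] := partition_function_event iid (@measurable_whiten _ _ _ P d X)
  mom4 noise (penalty_scale d n kappa eps) (@noise_scale R d n kappa) sgm eps0.
have [A3 [mA3 PA3 hA3]] := iid_mean_upper_deviation iid
  (measurable_excess (X := X) (n := n) (kappa := kappa) (eps := eps) (p := p))
  (excess_ge0 (p := p)) n0 eps0.
have [A4 [mA4 PA4 hA4]] := sample_in_gram_range.
exists (A1 `&` A2 `&` A3 `&` A4); split.
- by do 3 (apply: measurableI => //).
- have -> : 3 * eps = eps + eps + eps + 0 by ring.
  have P12 := probability_setI_ge mA1 mA2 PA1 PA2.
  have P123 := probability_setI_ge (measurableI _ _ mA1 mA2) mA3 P12 PA3.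
  apply: (probability_setI_ge _ mA4 P123); last by rewrite PA4 subr0.
  by do 2 apply: measurableI => //.
move=> w [[[/hA1 Z1 /hA2 Z2] /hA3 Z3] /hA4 pairing] theta.
have upper (x : R) : x <= mu_bound d n kappa eps + gamma_plus_factor d n kappa eps p *
    (n%:R^-1 * \sum_(i < n) excess (kappa := kappa) (eps := eps) (n := n) (p := p) (X := X) (Xs i w)) ->
    delta_hat d n kappa eps <= 1 -> (x%:E <= upper_dev X n kappa eps p)%E.
  move=> xle d1; apply: upper_dev_ge => //.
  apply: (@le_trans _ _ (mu_bound d n kappa eps + gamma_plus_factor d n kappa eps p *
    (n%:R^-1 * \sum_(i < n) excess (kappa := kappa) (eps := eps) (n := n) (p := p) (X := X) (Xs i w)))%:E).
    by rewrite lee_fin.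
  rewrite EFinD leeD2l// gamma_plus_tildeE EFinM lee_wpmul2l// lee_fin.
  exact: gamma_plus_factor_ge0.
have mu0 := mu_bound_ge0 d n kappa eps.
rewrite Nform_gram//; set N := inner theta _.
have N0 : 0 <= N by exact: gram_psd.
have [NE|Nn0] := eqVneq N 0.
  have emp0 : empirical_Nform Xs w theta = 0.
    rewrite /empirical_Nform big1 ?mulr0// => i _.
    rewrite -pairing (inner_eq0 (_ : inner (whitened_coef X theta) _ = 0)).
      by rewrite inner0l expr0n.
    by rewrite whitened_coef_norm.
  rewrite /= emp0 NE /cdiv eqxx /= subee//; split.
    rewrite lee_fin lerNl oppr0 -(subrr 1) lower_dev_ge//; first exact: ltW.
    by rewrite subrr addr_ge0// divr_ge0// sqr_ge0.
  apply: upper; rewrite addr_ge0// mulr_ge0 ?gamma_plus_factor_ge0// mulr_ge0 ?invr_ge0//.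
  by apply: sumr_ge0 => i _; exact: excess_ge0.
have Np : 0 < N by rewrite lt_def Nn0.
set r := empirical_Nform Xs w theta / N.
have -> : cdiv (empirical_Nform Xs w theta)%:E N%:E = r%:E.
  by rewrite /cdiv !eqe (negbTE Nn0) andbF inver (negbTE Nn0).
pose s := Num.sqrt (penalty_scale d n kappa eps / N).
have s2 : s ^+ 2 = penalty_scale d n kappa eps / N by rewrite sqr_sqrtr// divr_ge0// ltW.
have tl : inner (s *: theta) (gram X *m (s *: theta)) = penalty_scale d n kappa eps.
  by rewrite -scalemxAr innerZl innerZr mulrA -expr2 s2 divfK.
have ME : n%:R^-1 * \sum_(i < n) inner (whitened_coef X (s *: theta)) (whiten X (Xs i w)) ^+ 2 =
    penalty_scale d n kappa eps * r.
  rewrite /r /empirical_Nform.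
  under eq_bigr do rewrite pairing innerZl exprMn s2.
  by rewrite -mulr_sumr; ring.
rewrite /= -EFinB; split.
  rewrite lee_fin lerNl opprB; apply: lower_dev_ge => //; first exact: ltW.
    by rewrite divr_ge0// mulr_ge0 ?invr_ge0// sumr_ge0// => i _; rewrite sqr_ge0.
  have := whitened_lower_deviation X2 kappa1 kurt eps0 size L0 noise tl Z2.
  by rewrite ME -[X in X - _]mulr1 -mulrBr ler_pM2l.
apply: upper.
have := whitened_upper_deviation X2 kappa1 kurt eps0 size p12 L0 noise tl Z1.
by rewrite ME -[X in _ - X]mulr1 -mulrBr ler_pM2l.
Qed.

End deviation_event.

(** * Orders of magnitude *)

Section orders_of_magnitude.
Context {R : realType} (d n : nat) (kappa eps : R).
Hypothesis kappa1 : 1 < kappa.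
Hypothesis size : sample_size_lb d kappa eps < n%:R.
Local Notation L := (log_term d eps).
Local Notation mu := (mu_bound d n kappa eps).
Local Notation delta := (delta_hat d n kappa eps).
Local Notation lam := (penalty_scale d n kappa eps).

(** If L >= 0 then gamma_minus is lam^2 / 3, where (kappa - 1) lam <= mu <= delta_hat
    and the sample size condition bounds lam by 2. *)
Lemma lower_dev_order (kappa0 : R) : 1 < kappa0 <= kappa ->
  lower_dev d n kappa eps <= (1 + (kappa0 - 1)^-1) * delta.
Proof.
move=> /andP[k01 k0k]; have d0 := delta_hat_ge0 kappa1 size.
have md := delta_hat_ge_mu kappa1 size; have n0 := sample_size_gt0 size.
have kp : 0 < kappa - 1 by lra. have k0p : 0 < kappa0 - 1 by lra.
rewrite /lower_dev ler_pdivrMr; last by lra.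
suff h : gamma_minus d n kappa eps <= (kappa0 - 1)^-1 * delta.
  have i0 : 0 <= (kappa0 - 1)^-1 by rewrite invr_ge0 ltW.
  have : 0 <= (1 + (kappa0 - 1)^-1) * (delta * delta) by exact: mulr_ge0 (addr_ge0 ler01 i0) (mulr_ge0 d0 d0).
  by lra.
have [L0|L0] := ltP L 0.
  apply: (@le_trans _ _ 0); last by rewrite mulr_ge0// invr_ge0 ltW.
  by rewrite mulr_le0_ge0// ?invr_ge0 ?mulr_ge0// 1?ltW// pmulr_rlt0.
have l0 : 0 <= lam by exact: sqrtr_ge0.
have aE := sqrt_log_penalty_scale kappa1 size L0.
have al : (kappa - 1) * lam <= delta.
  apply: le_trans md; rewrite mu_boundE aE lerDl.
  by apply: mulr_ge0; [lra|rewrite mulr_ge0 ?sqrtr_ge0].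
have l2 : lam <= 2.
  have := sample_size_normalized kappa1 size; rewrite aE.
  rewrite (_ : (5 / 2 + _) * _ = 5 / 2 * ((kappa - 1) * lam) + lam / 2); last first.
    by field; rewrite gt_eqF.
  have := mulr_ge0 (ltW kp) l0; have := sqrtr_ge0 (kappa * d%:R / n%:R).
  by move: (Num.sqrt _) => c; move: ((kappa - 1) * lam) => a; lra.
rewrite gamma_minusE// -ler_pdivrMl ?invr_gt0// invrK.
apply: le_trans al; apply: (@le_trans _ _ ((kappa0 - 1) * lam)).
  rewrite ler_wpM2l ?(ltW k0p)// expr2.
  by have : 0 <= lam * (2 - lam) by [rewrite mulr_ge0 ?subr_ge0]; lra.
by rewrite ler_wpM2r// lerB.
Qed.

(** When 0 <= L, d + log (1 / eps) is at least 0.27 d and at least L, hence both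
    square roots in mu are of the order of the one on the right; moreover
    1 - 2 mu >= 3 / 100. *)
Lemma delta_hat_order : 0 <= L ->
  delta <= 700 * Num.sqrt (kappa * (d%:R + ln eps^-1) / n%:R).
Proof.
rewrite /log_term => L0; have n0 := sample_size_gt0 size; have mu0 := mu_bound_ge0 d n kappa eps.
have mu1 := mu_bound_lt kappa1 size; have k0 := lt_trans ltr01 kappa1.
have d0 : 0 <= d%:R :> R by []. set D := d%:R + ln eps^-1; set s := Num.sqrt _.
have s0 : 0 <= s by exact: sqrtr_ge0.
have aD : Num.sqrt (2 * (kappa - 1) / n%:R * log_term d eps) <= Num.sqrt 2 * s.
  rewrite -sqrtrM//; apply: ler_wsqrtr.
  rewrite (_ : 2 * (kappa - 1) / n%:R * _ = 2 * (((kappa - 1) * log_term d eps) / n%:R)); last by ring.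
  rewrite ler_wpM2l// ler_wpM2r ?invr_ge0 ?(ltW n0)//.
  apply: ler_pM; rewrite ?subr_ge0 ?(ltW kappa1)//; first by lra.
  by rewrite /log_term /D; lra.
have cD : Num.sqrt (kappa * d%:R / n%:R) <= 2 * s.
  have -> : 2 = Num.sqrt (2 ^+ 2) :> R by rewrite sqrtr_sqr ger0_norm.
  rewrite -sqrtrM ?sqr_ge0//; apply: ler_wsqrtr.
  rewrite mulrA ler_wpM2r ?invr_ge0 ?(ltW n0)// mulrCA ler_wpM2l ?(ltW k0)//.
  by rewrite /D expr2; lra.
have s2 := @sqrt2_le R; have s20 := sqrtr_ge0 (2 : R).
have mus : mu <= 21 * s.
  rewrite mu_boundE.
  have := ler_wpM2l s20 cD; have := ler_wpM2r s0 s2.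
  by move: aD; move: (Num.sqrt 2 * Num.sqrt _) (Num.sqrt _) => x y; lra.
rewrite /delta_hat ler_pdivrMr; last by lra.
have m3 : 3 / 100 <= 1 - 2 * mu by lra.
by have := ler_wpM2l s0 m3; lra.
Qed.

End orders_of_magnitude.

Lemma limn_esup_le_near {R : realType} (u : (\bar R)^nat) (c : \bar R) :
  (\forall m \near \oo, (u m <= c)%E) -> (limn_esup u <= c)%E.
Proof.
move=> h; rewrite /limn_esup limf_esupE.
apply: (@le_trans _ _ (ereal_sup (u @` [set m | (u m <= c)%E]))).
  by apply: ereal_inf_lbound; exists [set m | (u m <= c)%E].
by apply: ge_ereal_sup => _ [m h' <-].
Qed.

Section upper_order.
Context {R : realType} {dT : measure_display} {T : measurableType dT}
  {P : probability T R} {d : nat} {X : {RV P >-> Rvec R d}} {kappa eps p : R}.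
Hypothesis kappa1 : 1 < kappa.
Hypothesis eps0 : 0 < eps.
Hypothesis p12 : 1 < p <= 2.

Let mwn : measurable_fun setT (whitened_norm X).
Proof.
have -> : whitened_norm X = fun w => Num.sqrt (inner (whiten X (X w)) (whiten X (X w))) by [].
have : measurable_fun setT (fun w => inner (whiten X (X w)) (whiten X (X w))).
  by apply: measurable_inner => i; exact: (measurableT_comp (measurable_whiten i)).
exact: (measurableT_comp (continuous_measurable_fun (@sqrt_continuous R))).
Qed.

Let mwnp q : measurable_fun setT (fun w => (whitened_norm X w `^ q)%:E).
Proof. by apply/measurable_EFinP; exact: (measurableT_comp (measurable_powR q)). Qed.

Lemma excess_moment_le (dl q : R) : 0 <= dl -> 0 < q ->
  ('E_P[fun w => (pospart ((1 + dl) * whitened_norm X w ^+ 2 - 1) `^ q)%R] <=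
   ((1 + dl) `^ q)%:E * 'E_P[fun w => (whitened_norm X w `^ (2 * q))%R])%E.
Proof.
move=> dl0 q0; rewrite unlock -ge0_integralZl_EFin//; last 2 first.
- by move=> w _; rewrite lee_fin powR_ge0.
- exact: powR_ge0.
apply: ge0_le_integral => //.
- by move=> w _; rewrite lee_fin powR_ge0.
- have : measurable_fun setT (fun w => pospart ((1 + dl) * whitened_norm X w ^+ 2 - 1)).
    apply: measurable_maxr => //; apply: measurable_funB => //.
    by apply: measurable_funM => //; exact: measurable_funX.
  by move=> h; apply/measurable_EFinP; exact: (measurableT_comp (measurable_powR q)).
- by apply: emeasurable_funM.
move=> w _; rewrite -EFinM lee_fin.
have w0 : 0 <= whitened_norm X w by exact: sqrtr_ge0.
have dp : 0 <= 1 + dl by lra.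
rewrite powRrM powR_mulrn// -powRM ?sqr_ge0//.
apply: ge0_ler_powR; rewrite ?nnegrE ?(ltW q0) ?le_max ?lexx ?orbT//.
  by rewrite mulr_ge0// sqr_ge0.
by rewrite ge_max mulr_ge0 ?sqr_ge0// andbT; lra.
Qed.

(** The excess is at most (1 + delta_hat) |Y|^2, and the constant factor is taken
    out of the square root. *)
Lemma gamma_plus_tilde_le (n : nat) : 0 <= delta_hat d n kappa eps -> (0 < n)%N ->
  (gamma_plus_tilde X n kappa eps p <= gamma_plus_majorant X n kappa eps p)%E.
Proof.
move=> dl0 n0; have /andP[p1 p2] := p12.
have ne0 : 0 < n%:R * eps :> R by rewrite mulr_gt0// ltr0n.
have dp : 0 <= 1 + delta_hat d n kappa eps by lra.
have E0 q : (0 <= 'E_P[fun w => (whitened_norm X w `^ q)%R])%E.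
  by rewrite unlock; apply: integral_ge0 => w _; rewrite lee_fin powR_ge0.
rewrite /gamma_plus_tilde /gamma_plus_majorant.
set f := gamma_plus_factor d n kappa eps p; set dl := delta_hat d n kappa eps.
have f0 : 0 <= f by exact: gamma_plus_factor_ge0.
rewrite (EFinM f) -(muleA f%:E) lee_wpmul2l ?lee_fin//.
rewrite ge0_muleDr ?poweR_ge0//; apply: leeD.
  rewrite (_ : 2 * p + 2 = 2 * (p + 1)); last by ring.
  by apply: excess_moment_le => //; lra.
have -> : ((1 + dl) `^ (p + 1))%:E = (((1 + dl) `^ (2 * p + 2))%:E `^ 2^-1)%E.
  by rewrite poweR_EFin -powRrM; congr (_ `^ _)%:E; field.
rewrite -poweRM ?lee_fin ?powR_ge0//; last by rewrite mule_ge0// inver gt_eqF// lee_fin invr_ge0 ltW.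
have i0 : (0 <= ((n%:R * eps)%:E)^-1)%E by rewrite inver gt_eqF// lee_fin invr_ge0 ltW.
have e0 : (0 <= 'E_P[fun w => (pospart ((1 + dl) * whitened_norm X w ^+ 2 - 1) `^ (2 * p + 2))%R])%E.
  by rewrite unlock; apply: integral_ge0 => w _; rewrite lee_fin powR_ge0.
apply: gt0_ler_poweR => //; rewrite ?in_itv/= ?leey ?andbT ?mule_ge0 ?lee_fin ?powR_ge0//.
rewrite muleA lee_wpmul2r//.
rewrite (_ : 4 * p + 4 = 2 * (2 * p + 2)); last by ring.
by apply: excess_moment_le => //; lra.
Qed.

Hypothesis L0 : 0 <= log_term d eps.
Hypothesis mom : ('E_P[fun w => (whitened_norm X w `^ (4 * p + 4))%R] < +oo)%E.

(** Once delta_hat <= 1 the majorant is a constant times n ^ (- p / 2). *)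
Lemma gamma_plus_tilde_rate : exists2 C : R, 0 <= C & forall m : nat, (0 < m)%N ->
  0 <= delta_hat d m kappa eps <= 1 ->
  (gamma_plus_tilde X m kappa eps p <= (C * Num.sqrt m%:R `^ (- p))%:E)%E.
Proof.
have /andP[p1 p2] := p12.
have E0 q : (0 <= 'E_P[fun w => (whitened_norm X w `^ q)%R])%E.
  by rewrite unlock; apply: integral_ge0 => w _; rewrite lee_fin powR_ge0.
have : ('E_P[fun w => (whitened_norm X w `^ (2 * p + 2))%R] < +oo)%E.
  apply: (@le_lt_trans _ _ (1 + 'E_P[fun w => (whitened_norm X w `^ (4 * p + 4))%R])%E); last first.
    by rewrite lte_add_pinfty ?ltry.
  rewrite -[X in (X + _)%E](probability_setT P) -[P setT]mul1e -integral_cst//.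
  rewrite unlock -ge0_integralD//; last by move=> w _; rewrite lee_fin powR_ge0.
  apply: ge0_le_integral => //.
  - by move=> w _; rewrite lee_fin powR_ge0.
  - by apply: emeasurable_funD.
  - move=> w _; rewrite -EFinD lee_fin.
    have -> : whitened_norm X w `^ (4 * p + 4) = (whitened_norm X w `^ (2 * p + 2)) ^+ 2.
      by rewrite -powR_mulrn ?powR_ge0// -powRrM; congr (_ `^ _); ring.
    have := sqr_ge0 (whitened_norm X w `^ (2 * p + 2) - 1).
    have := powR_ge0 (whitened_norm X w) (2 * p + 2).
    by move: (_ `^ _) => x x0; rewrite sqrrB; lra.
have majle m := @gamma_plus_tilde_le m.
move: mom (E0 (4 * p + 4)) (E0 (2 * p + 2)); rewrite /gamma_plus_majorant in majle.
move: majle; case: ('E_P[_])%E => [m1| |]//; case: ('E_P[_])%E => [m2| |]// majle _ m20 m10 _.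
rewrite !lee_fin in m10 m20.
pose C0 := (2 * log_term d eps / (kappa - 1)) `^ (p / 2).
pose C := (p + 1)^-1 * C0 * 2 `^ (p + 1) * (m1 + (m2 / eps) `^ 2^-1).
exists C.
  by rewrite !mulr_ge0 ?powR_ge0 ?invr_ge0 ?addr_ge0 ?powR_ge0//; lra.
move=> m m0 /andP[dl0 dl1].
apply: (le_trans (majle m dl0 m0)).
have mR : 0 < m%:R :> R by rewrite ltr0n.
have me0 : 0 < m%:R * eps by rewrite mulr_gt0.
have -> : (m2%:E / (m%:R * eps)%:E = (m2 / (m%:R * eps))%:E)%E.
  by rewrite inver (gt_eqF me0).
rewrite poweR_EFin -EFinD -EFinM lee_fin.
have -> : gamma_plus_factor d m kappa eps p = (p + 1)^-1 * C0 * Num.sqrt m%:R `^ (- p).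
  rewrite /gamma_plus_factor -[RHS]mulrA; congr (_ * _).
  rewrite (_ : 2 * log_term d eps / _ = 2 * log_term d eps / (kappa - 1) * m%:R^-1); last first.
    by rewrite invfM mulrA.
  rewrite powRM ?invr_ge0 ?(ltW mR) ?divr_ge0 ?mulr_ge0 ?subr_ge0 ?(ltW kappa1)//; congr (_ * _).
  rewrite -powR12_sqrt ?(ltW mR)// -powRrM -powR_inv1 ?(ltW mR)// -powRrM.
  by congr (_ `^ _); ring.
rewrite /C; have : 0 <= C0 by exact: powR_ge0.
move: C0 {C} => c c0.
set r := Num.sqrt m%:R `^ (- p); have r0 : 0 <= r by exact: powR_ge0.
rewrite [leRHS](_ : _ = (p + 1)^-1 * c * r * 2 `^ (p + 1) * (m1 + (m2 / eps) `^ 2^-1)); last by ring.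
apply: ler_pM.
- by rewrite !mulr_ge0 ?powR_ge0 ?invr_ge0//; lra.
- by rewrite addr_ge0 ?powR_ge0.
- rewrite ler_wpM2l ?mulr_ge0 ?invr_ge0//; first by lra.
  by apply: ge0_ler_powR; rewrite ?nnegrE; lra.
- rewrite lerD2l; apply: ge0_ler_powR => //; rewrite ?nnegrE ?divr_ge0 ?mulr_ge0 ?(ltW eps0)//.
  rewrite ler_wpM2l// lef_pV2 ?posrE ?mulr_gt0// ler_peMl ?(ltW eps0)//.
  by rewrite ler1n.
Qed.

Let mu1 : R := Num.sqrt (2 * (kappa - 1) * log_term d eps)
  + 681 / 100 * Num.sqrt (2 * kappa * d%:R).

Let mu_bound_rate (m : nat) : mu_bound d m kappa eps = mu1 / Num.sqrt m%:R.
Proof.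
by rewrite /mu_bound /mu1 (mulrAC _ _ (log_term d eps)) !sqrtr_divr// mulrA -mulrDl.
Qed.

Lemma upper_dev_ratio_le (m : nat) : 0 <= delta_hat d m kappa eps <= 4^-1 ->
  (gamma_plus_tilde X m kappa eps p <= (delta_hat d m kappa eps)%:E)%E ->
  (cdiv (upper_dev X m kappa eps p) (delta_hat d m kappa eps)%:E <= 4%:E)%E.
Proof.
rewrite /upper_dev; have := gamma_plus_tilde_ge0 (X := X) (n := m) (kappa := kappa) (eps := eps) p12.
case: (gamma_plus_tilde _ _ _ _ _) => [g| |]//; move: (delta_hat _ _ _ _) => dl.
rewrite !lee_fin => g0 /andP[dl0 dl4] gd.
have -> : (epospart (1 - g%:E) = (1 - g)%:E)%E.
  by rewrite /epospart -EFinB -EFin_max max_l//; lra.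
have D0 : 0 < (1 - dl) * (1 - g) by rewrite mulr_gt0//; lra.
rewrite -EFinD -EFinM {2}/cdiv !eqe (gt_eqF D0) andbF inver (gt_eqF D0) -EFinM.
rewrite /cdiv !eqe; have [dE|dn0] := eqVneq dl 0.
  have -> : g = 0 by lra.
  by rewrite dE addr0 mul0r eqxx lee_fin ler1n.
rewrite andbF inver (negbTE dn0) -EFinM lee_fin.
have dp : 0 < dl by rewrite lt_def dn0.
rewrite ler_pdivrMr// ler_pdivrMr//.
have : 9 / 16 <= (1 - dl) * (1 - g).
  have : 0 <= (4^-1 - dl) * (1 - g) by rewrite mulr_ge0//; lra.
  lra.
by move=> /(ler_wpM2l dl0); lra.
Qed.

(** After n exceeds an explicit threshold delta_hat <= 1 / 4, and gamma_plus_tilde,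
    of order n ^ (- p / 2) with p > 1, is below delta_hat, of order n ^ (- 1 / 2). *)
Lemma upper_dev_order :
  (limn_esup (fun m => cdiv (upper_dev X m kappa eps p) (delta_hat d m kappa eps)%:E) <= 4%:E)%E.
Proof.
have /andP[p1 p2] := p12; have q0 : 0 < p - 1 by lra.
apply: limn_esup_le_near.
have s1 : 0 <= Num.sqrt (2 * (kappa - 1) * log_term d eps) by exact: sqrtr_ge0.
have s2 : 0 <= 681 / 100 * Num.sqrt (2 * kappa * d%:R).
  by apply: mulr_ge0; [lra|exact: sqrtr_ge0].
have : 0 <= mu1 by exact: addr_ge0.
rewrite le_eqVlt => /predU1P[mu10|mu10].
  have LE : log_term d eps = 0.
    have : Num.sqrt (2 * (kappa - 1) * log_term d eps) = 0 by move: mu10; rewrite /mu1; lra.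
    move=> /eqP; rewrite sqrtr_eq0 pmulr_rle0 ?mulr_gt0 ?subr_gt0// => L1.
    by apply/eqP; rewrite eq_le L1.
  near=> m; have dl : delta_hat d m kappa eps = 0.
    by rewrite /delta_hat mu_bound_rate -mu10 !mul0r.
  apply: upper_dev_ratio_le; rewrite dl ?lexx//=.
  rewrite /gamma_plus_tilde /gamma_plus_factor LE mulr0 mul0r powR0 ?mulr0 ?mul0e//.
  by rewrite gt_eqF//; lra.
have [C C0 rate] := gamma_plus_tilde_rate.
(* r ^ (p - 1) >= C / mu1 is what makes C r ^ (- p) <= mu1 / r *)
pose t := Num.max 1 (Num.max (6 * mu1) ((C / mu1) `^ (p - 1)^-1)).
have t1 : 1 <= t by rewrite /t le_max lexx.
have t2 : 6 * mu1 <= t by rewrite /t !le_max lexx orbT.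
have t3 : (C / mu1) `^ (p - 1)^-1 <= t by rewrite /t !le_max lexx !orbT.
near=> m.
have tm : t ^+ 2 <= m%:R by near: m; exact: nbhs_infty_ger.
have m0 : (0 < m)%N.
  rewrite -(ltr0n R); apply: lt_le_trans tm; rewrite exprn_gt0//; lra.
have tr : t <= Num.sqrt m%:R.
  have t0 : 0 <= t by lra.
  by rewrite -[leLHS](ger0_norm t0) -sqrtr_sqr ler_wsqrtr.
have := mu_bound_rate m; have := rate m m0; move: (Num.sqrt _) tr => r tr.
have r0 : 0 < r by lra.
move=> ratem muE.
have mu6 : mu_bound d m kappa eps <= 6^-1 by rewrite muE ler_pdivrMr//; lra.
have mup : 0 <= mu_bound d m kappa eps by exact: mu_bound_ge0.
have dmu : mu_bound d m kappa eps <= delta_hat d m kappa eps.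
  rewrite /delta_hat ler_pdivlMr; last by lra.
  by have := sqr_ge0 (mu_bound d m kappa eps); rewrite expr2; lra.
have d4 : delta_hat d m kappa eps <= 4^-1.
  by rewrite /delta_hat ler_pdivrMr; lra.
have dl0 : 0 <= delta_hat d m kappa eps by exact: le_trans dmu.
apply: upper_dev_ratio_le; first by rewrite dl0.
have dl01 : 0 <= delta_hat d m kappa eps <= 1 by rewrite dl0 (le_trans d4)//; lra.
apply: (le_trans (ratem dl01)).
rewrite lee_fin; apply: le_trans dmu; rewrite muE powRN.
have -> : r `^ p = r * r `^ (p - 1).
  rewrite -{2}(powRr1 (ltW r0)) -powRD; first by rewrite addrC subrK.
  by rewrite (gt_eqF r0) implybT.
have rq : C / mu1 <= r `^ (p - 1).
  have -> : C / mu1 = ((C / mu1) `^ (p - 1)^-1) `^ (p - 1).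
    by rewrite -powRrM mulVf ?gt_eqF// powRr1// divr_ge0// ltW.
  apply: ge0_ler_powR; rewrite ?nnegrE ?powR_ge0 ?(ltW r0) ?(ltW q0)//.
  exact: le_trans tr.
have qp : 0 < r `^ (p - 1) by exact: powR_gt0.
rewrite ler_pdivrMr ?mulr_gt0// mulrA divfK ?gt_eqF//.
by move: rq; rewrite ler_pdivrMr// mulrC.
Unshelve. all: by end_near.
Qed.

End upper_order.

(** * The uniform two-sided deviation bound *)

Theorem proposition2p4 (R : realType) :
  exists (c1 : R -> R) (c2 c3 : R),
  forall (dT : measure_display) (T : measurableType dT) (P : probability T R)
    (d n : nat) (X : {RV P >-> Rvec R d}) (Xs : 'I_n -> {RV P >-> Rvec R d})
    (kappa eps p : R),
  iid_copies X Xs ->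
  square_integrable X ->
  1 < kappa ->
  (kurtosis_sup X <= kappa%:E)%E ->
  0 < eps ->
  sample_size_lb d kappa eps < n%:R ->
  1 < p <= 2 ->
  [/\ (gamma_plus_tilde X n kappa eps p <= gamma_plus_majorant X n kappa eps p)%E,
      exists A : set T,
        [/\ measurable A, ((1 - 3 * eps)%:E <= P A)%E &
          forall w, A w -> forall theta : 'cV[R]_d,
            let ratio := cdiv (empirical_Nform Xs w theta)%:E (Nform X theta) in
            ((- lower_dev d n kappa eps)%:E <= ratio - 1)%E
            /\ (delta_hat d n kappa eps <= 1 ->
                (ratio - 1 <= upper_dev X n kappa eps p)%E)],
      forall kappa0, 1 < kappa0 <= kappa ->
        lower_dev d n kappa eps <= c1 kappa0 * delta_hat d n kappa eps,
      0 <= log_term d eps ->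
      ('E_P[fun w => (whitened_norm X w `^ (4 * p + 4))%R] < +oo)%E ->
        (limn_esup (fun m => cdiv (upper_dev X m kappa eps p)
                                  (delta_hat d m kappa eps)%:E) <= c2%:E)%E
    & 0 <= log_term d eps ->
        delta_hat d n kappa eps
        <= c3 * Num.sqrt (kappa * (d%:R + ln eps^-1) / n%:R)].
Proof.
exists (fun kappa0 => 1 + (kappa0 - 1)^-1), 4, 700.
move=> dT T P d n X Xs kappa eps p iid X2 kappa1 kurt eps0 size p12; split.
- apply: gamma_plus_tilde_le => //; first exact: delta_hat_ge0 kappa1 size.
  by rewrite -(ltr0n R) (sample_size_gt0 size).
- exact: deviation_event.
- by move=> kappa0; exact: lower_dev_order.
- by move=> L0 mom; exact: upper_dev_order.
- by move=> L0; exact: delta_hat_order.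
Qed.
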